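(* Let $\Lambda\subset\mathbb{R}^d$ be a lattice, let $\alpha>\frac{d+1}{2}$, and let $(X_N)_{N\in\mathbb{N}}$ be a QMC design sequence for $W^{\alpha,2}(\Omega_\Lambda)$. Then $(X_N)_{N\in\mathbb{N}}$ is hyperuniform for large balls, hyperuniform for small balls and hyperuniform for balls of threshold order.
   Context: Let $\Lambda=A\mathbb{Z}^d$ be a lattice in $\mathbb{R}^d$, generated by a nonsingular matrix $A=[v_1,\dots,v_d]$, with fundamental domain $\Omega_\Lambda=\{\sum_{j=1}^d\alpha_jv_j:\alpha_j\in[0,1)\}$ of $\mathbb{R}^d/\Lambda$, co-volume $|\Lambda|=|\det A|$ and dual lattice $\Lambda^*=\{w\in\mathbb{R}^d:\langle w,v\rangle\in\mathbb{Z}\text{ for all }v\in\Lambda\}$. Let $\mu$ be Lebesgue measure on $\Omega_\Lambda$ normalized so that $\mu(\Omega_\Lambda)=1$, and let $\mathrm{diam}\,\Omega_\Lambda$ be the Euclidean diameter. A sequence of point sets $(X_N)_{N\in\mathbb{N}}$ has $X_N=\{\mathbf{x}_1,\dots,\mathbf{x}_N\}\subset\Omega_\Lambda$ with $\#X_N=N$; the points may depend on $N$. Sobolev space: for $\alpha>\frac d2$, $W^{\alpha,2}(\Omega_\Lambda)$ is the space of (continuous, $\Lambda$-periodic, real-valued) functions $f$ with $\|f\|_{W^{\alpha,2}}=\big(\sum_{w\in\Lambda^*}(1+4\pi^2|w|^2)^{\alpha}|\hat f(w)|^2\big)^{1/2}<\infty$, where $\hat f(w)=\int_{\Omega_\Lambda}f(u)e^{-2\pi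 i\langle u,w\rangle}d\mu(u)$. QMC designs: for $\alpha>\frac d2$, $(X_N)$ is a QMC design sequence for $W^{\alpha,2}(\Omega_\Lambda)$ if there is $c(\alpha,d)>0$ independent of $N$ such that $\big|\frac1N\sum_{j=1}^Nf(\mathbf{x}_j)-\int_{\Omega_\Lambda}f\,d\mu\big|\le c(\alpha,d)N^{-\alpha/d}\|f\|_{W^{\alpha,2}}$ for all $f\in W^{\alpha,2}(\Omega_\Lambda)$ and all $N$. Balls on the torus: indicator functions of balls are $\Lambda$-periodized, i.e. for $\mathbf{x},\mathbf{y}\in\mathbb{R}^d$ and $R\ge 0$ put $\mathbb{1}_{B(\mathbf{x},R)}(\mathbf{y})=\#\{v\in\Lambda:|\mathbf{y}+v-\mathbf{x}|\le R\}$, and $\mathrm{Vol}(B(\mathbf{x},R))=\frac{1}{|\Lambda|}\frac{\pi^{d/2}}{\Gamma(d/2+1)}R^d$. Number variance: $V(X_N,R)=\int_{\Omega_\Lambda}\big(\sum_{j=1}^N\mathbb{1}_{B(\mathbf{x},R)}(\mathbf{x}_j)-N\,\mathrm{Vol}(B(\mathbf{x},R))\big)^2d\mu(\mathbf{x})$. $(X_N)$ is: - hyperuniform for large balls if $V(X_N,R)=o(N)$ as $N\to\infty$ for every $R\in(0,\frac12\mathrm{diam}\,\Omega_\Lambda)$; - hyperuniform for small balls if $V(X_N,R_N)=o(N\,\mathrm{Vol}(B(\cdot,R_N)))$ as $N\to\infty$ for all sequences of positive radii $(R_N)$ with $R_N\to0$ and $N\,\mathrm{Vol}(B(\cdot,R_N))\to\infty$;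 - hyperuniform for balls of threshold order if $\limsup_{N\to\infty}V(X_N,tN^{-1/d})=\mathcal{O}(t^{d-1})$ as $t\to\infty$. *)

(* Defs.v *)
From HB Require Import structures.
From mathcomp Require Import all_boot all_order all_algebra finmap.
From mathcomp Require Import all_classical all_reals all_analysis.
From mathcomp Require Import complex.

Set Implicit Arguments.
Unset Strict Implicit.
Unset Printing Implicit Defensive.

Import Order.TTheory GRing.Theory Num.Theory.
Import numFieldNormedType.Exports.

Local Open Scope classical_set_scope.
Local Open Scope ring_scope.

(* The sigma-algebra on column vectors generated by the coordinates, exactly
   as for [n.-tuple T] in the library. *)
Section measurable_cV.
Context {disp : measure_display} {T : sigmaRingType disp} (n : nat).

Let coors : 'I_n -> 'cV[T]_n -> T := fun i x => x i ord0.

Let cV_set0 : g_sigma_preimage coors set0.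
Proof. exact: sigma_algebra0. Qed.

Let cV_setC A : g_sigma_preimage coors A -> g_sigma_preimage coors (~` A).
Proof. exact: sigma_algebraC. Qed.

Let cV_bigcup (F : _^nat) : (forall i, g_sigma_preimage coors (F i)) ->
  g_sigma_preimage coors (\bigcup_i (F i)).
Proof. exact: sigma_algebra_bigcup. Qed.

HB.instance Definition _ := @isMeasurable.Build (measure_tuple_display disp)
  'cV[T]_n (g_sigma_preimage coors) cV_set0 cV_setC cV_bigcup.

End measurable_cV.

Lemma measurable_coord_cV d (T : sigmaRingType d) n (i : 'I_n) :
  measurable_fun [set: 'cV[T]_n] (fun x : 'cV[T]_n => x i ord0).
Proof.
move=> _ Y mY; rewrite setTI; apply: sub_sigma_algebra => /=.
rewrite -bigcup_seq/=; exists i => /=; first by rewrite mem_index_enum.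
by exists Y => //; rewrite setTI.
Qed.

Lemma measurable_fun_cVP d1 d2 (T1 : measurableType d1)
    (T2 : measurableType d2) n (f : T1 -> 'cV[T2]_n) :
  measurable_fun [set: T1] f <->
  forall i, measurable_fun [set: T1] (fun x => f x i ord0).
Proof.
split=> [mf i|mf].
  exact: (measurableT_comp (measurable_coord_cV i) mf).
move=> _ Y mY.
suff : (@measurable _ 'cV[T2]_n) `<=`
    image_set_system [set: T1] f (@measurable _ T1) by exact.
apply: smallest_sub.
  by apply: sigma_algebra_image; exact: sigma_algebra_measurable.
move=> Z; rewrite -bigcup_seq/= => -[i _ [B mB <-]].
by rewrite /image_set_system/= !setTI; have := mf i measurableT B mB;
  rewrite setTI.
Qed.

Section lebesgue_cV.
Variable R : realType.

Definition cons_cV n (p : R * 'cV[R]_n) : 'cV[R]_n.+1 :=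
  col_mx (p.1%:M : 'M[R]_1) p.2.

Lemma cons_cV0 n p : @cons_cV n p ord0 ord0 = p.1.
Proof.
rewrite /cons_cV (_ : ord0 = lshift n (ord0 : 'I_1)); last exact/val_inj.
by rewrite (@col_mxEu _ 1) mxE eqxx mulr1n.
Qed.

Lemma cons_cVS n p (i : 'I_n) : cons_cV p (lift ord0 i) ord0 = p.2 i ord0.
Proof.
rewrite /cons_cV (_ : lift ord0 i = rshift 1 i); last exact/val_inj.
by rewrite (@col_mxEd _ 1).
Qed.

Lemma measurable_cons_cV n : measurable_fun [set: R * 'cV[R]_n] (@cons_cV n).
Proof.
apply/measurable_fun_cVP => i.
have [j ->|->] := unliftP ord0 i.
  rewrite (_ : (fun x => _) = (fun x : 'cV[R]_n => x j ord0) \o snd).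
    apply: measurableT_comp => //; exact: measurable_coord_cV.
  by apply/funext => p /=; rewrite cons_cVS.
rewrite (_ : (fun x => _) = fst) //.
by apply/funext => p /=; rewrite cons_cV0.
Qed.

(* Lebesgue measure on R^d, by recursion on d: the image under
   R x R^n -> R^(n+1) of the product of the Lebesgue measures. *)
Fixpoint lebesgue_cV (d : nat) : set 'cV[R]_d -> \bar R :=
  match d with
  | 0 => \d_ (0 : 'cV[R]_0)
  | n.+1 => pushforward (lebesgue_measure \x @lebesgue_cV n)%E (@cons_cV n)
  end.

Let lebesgue_cV_sigma_finite d :
  {m : {sigma_finite_measure set 'cV[R]_d -> \bar R} |
    m = @lebesgue_cV d :> (set 'cV[R]_d -> \bar R)}.
Proof.
elim: d => [|n [m mE]]; first by exists (\d_ (0 : 'cV[R]_0)).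
pose f : measurableTypeR R * 'cV[R]_n -> 'cV[R]_n.+1 := @cons_cV n.
have mf : measurable_fun [set: measurableTypeR R * 'cV[R]_n] f.
  exact: measurable_cons_cV.
pose nu_ : {measure set 'cV[R]_n.+1 -> \bar R} :=
  pushforward (lebesgue_measure \x m)%E f.
pose nu := nu_ mf.
have snu : sigma_finite setT nu.
  pose g : 'cV[R]_n.+1 -> measurableTypeR R * 'cV[R]_n :=
    fun x => (x ord0 ord0, \col_i x (lift ord0 i) ord0).
  have fK : cancel f g.
    move=> [a b]; rewrite /g/f cons_cV0/=; congr pair.
    by apply/matrixP => i j; rewrite mxE cons_cVS (ord1 j).
  have mg : measurable_fun [set: 'cV[R]_n.+1] g.
    apply: measurable_fun_pair; first exact: measurable_coord_cV.
    apply/measurable_fun_cVP => i.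
    rewrite (_ : (fun x => _) = fun x : 'cV[R]_n.+1 => x (lift ord0 i) ord0).
      exact: measurable_coord_cV.
    by apply/funext => x; rewrite mxE.
  have /sigma_finiteP[F [FT ndF Foo]] := sigma_finiteT (@lebesgue_measure R).
  have /sigma_finiteP[G [GT ndG Goo]] := sigma_finiteT m.
  exists (fun k => g @^-1` (F k `*` G k)).
    rewrite -preimage_bigcup (_ : \bigcup_k _ = setT) ?preimage_setT//.
    rewrite -setXTT FT GT predeqE => -[x y]; split=> [[k _ []/= ? ?]|].
      by split; exists k.
    move=> [/= [k _ Fkx] [l _ Gly]]; exists (maxn k l) => //; split.
    - by move: x Fkx; exact/subsetPset/ndF/leq_maxl.
    - by move: y Gly; exact/subsetPset/ndG/leq_maxr.
  move=> k; have [? ?] := Foo k; have [? ?] := Goo k.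
  have mFG : measurable (F k `*` G k) by exact: measurableX.
  split; first by rewrite -[X in measurable X]setTI; exact: mg.
  rewrite /nu/= /pushforward (_ : f @^-1` _ = F k `*` G k).
    by rewrite product_measure1E// lte_mul_pinfty// ge0_fin_numE.
  by rewrite -comp_preimage (_ : g \o f = id)//; apply/funext => x /=; rewrite fK.
pose S := Measure_isSigmaFinite.Build _ _ _ nu snu.
pose nu' : {sigma_finite_measure set 'cV[R]_n.+1 -> \bar R} :=
  HB.pack (Measure.sort nu) S.
by exists nu'; rewrite /nu'/= /nu -mE.
Qed.

Let lebesgue_cV0 d : @lebesgue_cV d set0 = 0%E.
Proof. by have [m <-] := lebesgue_cV_sigma_finite d; rewrite measure0. Qed.

Let lebesgue_cV_ge0 d A : (0 <= @lebesgue_cV d A)%E.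
Proof. by have [m <-] := lebesgue_cV_sigma_finite d; exact: measure_ge0. Qed.

Let lebesgue_cV_sigma_additive d : semi_sigma_additive (@lebesgue_cV d).
Proof.
have [m <-] := lebesgue_cV_sigma_finite d.
exact: measure_semi_sigma_additive.
Qed.

HB.instance Definition _ d := isMeasure.Build _ _ _ (@lebesgue_cV d)
  (lebesgue_cV0 d) (@lebesgue_cV_ge0 d) (@lebesgue_cV_sigma_additive d).

Let lebesgue_cV_sigma_finiteT d : sigma_finite setT (@lebesgue_cV d).
Proof. by have [m <-] := lebesgue_cV_sigma_finite d; exact: sigma_finiteT. Qed.

HB.instance Definition _ d := Measure_isSigmaFinite.Build _ _ _
  (@lebesgue_cV d) (@lebesgue_cV_sigma_finiteT d).

Lemma lebesgue_cV_rectangle d (B : 'I_d -> set R) :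
  (forall i, measurable (B i)) ->
  lebesgue_cV [set x | forall i, B i (x i ord0)] =
  (\prod_(i < d) lebesgue_measure (B i))%E.
Proof.
elim: d B => [|n IH] B mB.
  by rewrite big_ord0 /= diracE mem_set// => -[].
pose C : set 'cV[R]_n := [set x | forall i, B (lift ord0 i) (x i ord0)].
have mC : measurable C.
  rewrite (_ : C = \big[setI/setT]_(i < n)
      ((fun x : 'cV[R]_n => x i ord0) @^-1` B (lift ord0 i))).
    apply: bigsetI_measurable => i _.
    by rewrite -[X in measurable X]setTI; exact: measurable_coord_cV.
  apply/seteqP; split=> x; rewrite -bigcap_seq.
    by move=> Bx i _; exact: Bx.
  by move=> Bx i; apply: (Bx i); rewrite /= mem_index_enum.
rewrite big_ord_recl /= /pushforward.
rewrite (_ : _ @^-1` _ = B ord0 `*` C).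
  rewrite (@product_measure1E _ _ _ _ _ lebesgue_measure (@lebesgue_cV n)).
  - by congr (_ * _)%E; exact: (IH (fun i => B (lift ord0 i))).
  - exact: (mB ord0).
  - exact: mC.
apply/seteqP; split=> -[a b]/=.
  move=> Bab; split; first by have := Bab ord0; rewrite cons_cV0.
  by move=> i; have := Bab (lift ord0 i); rewrite cons_cVS.
move=> [Ba Bb] i; have [j ->|->] := unliftP ord0 i; last by rewrite cons_cV0.
by rewrite cons_cVS; exact: Bb.
Qed.

End lebesgue_cV.
Arguments lebesgue_cV {R d}.

Section lattice.
Variables (R : realType) (d : nat).
Implicit Types (A : 'M[R]_d) (u v w x y : 'cV[R]_d) (r : R).

Definition dotv u v : R := \sum_(i < d) u i ord0 * v i ord0.

(* The norm [`|v|] of the library on matrices is the sup norm. *)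
Definition enorm v : R := Num.sqrt (dotv v v).

Definition lattice A : set 'cV[R]_d :=
  [set v | exists k : 'cV[int]_d, v = A *m map_mx intr k].

Definition fundamental_domain A : set 'cV[R]_d :=
  [set A *m a | a in [set a : 'cV[R]_d | forall i, 0 <= a i ord0 < 1]].

Definition covolume A : R := `|\det A|.

Definition dual_lattice A : set 'cV[R]_d :=
  [set w | forall v, lattice A v -> dotv w v \is a Num.int].

Definition ediam (S : set 'cV[R]_d) : R :=
  sup [set enorm (x - y) | x in S & y in S].

Lemma inv_domain_volume_ge0 A :
  0 <= (fine (lebesgue_cV (fundamental_domain A)))^-1.
Proof. by rewrite invr_ge0 fine_ge0. Qed.

(* Lebesgue measure scaled so that the fundamental domain has mass 1; it is
   used below only to integrate over the fundamental domain. *)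
Definition normalized_lebesgue A : {measure set 'cV[R]_d -> \bar R} :=
  mscale (NngNum (inv_domain_volume_ge0 A)) (@lebesgue_cV R d).

Definition torus_integral A (f : 'cV[R]_d -> R) : R :=
  \int[normalized_lebesgue A]_(u in fundamental_domain A) f u.

(* The integral of f(u) exp(-2 pi i <u, w>) for real-valued f, given by its
   real and imaginary parts since the library only integrates real-valued
   functions. *)
Definition fourier_coef A (f : 'cV[R]_d -> R) w : R[i] :=
  Complex (torus_integral A (fun u => f u * cos (2 * pi * dotv u w)))
          (- torus_integral A (fun u => f u * sin (2 * pi * dotv u w))).

Definition sobolev_sqnorm A (alpha : R) (f : 'cV[R]_d -> R) : \bar R :=
  \esum_(w in dual_lattice A)
    ((1 + 4 * pi ^+ 2 * enorm w ^+ 2) `^ alpha *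
     ComplexField.Normc.normc (fourier_coef A f w) ^+ 2)%:E.

Definition sobolev_norm A alpha f : R :=
  Num.sqrt (fine (sobolev_sqnorm A alpha f)).

Definition periodic A (f : 'cV[R]_d -> R) : Prop :=
  forall u v, lattice A v -> f (u + v) = f u.

Definition sobolev A (alpha : R) : set ('cV[R]_d -> R) :=
  [set f | [/\ continuous f, periodic A f &
               (sobolev_sqnorm A alpha f < +oo)%E]].

(* [X N] enumerates the N distinct points of the N-th point set. *)
Definition point_sets A (X : forall N, 'I_N -> 'cV[R]_d) : Prop :=
  forall N, injective (X N) /\ forall j, fundamental_domain A (X N j).

Definition qmc_design A (alpha : R) (X : forall N, 'I_N -> 'cV[R]_d) : Prop :=
  exists2 c : R, 0 < c & forall f, sobolev A alpha f ->
    forall N, (0 < N)%N ->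
      `|N%:R^-1 * \sum_(j < N) f (X N j) - torus_integral A f| <=
      c * N%:R `^ (- (alpha / d%:R)) * sobolev_norm A alpha f.

Definition ball_indicator A x r y : nat :=
  #|` fset_set [set v | lattice A v /\ enorm (y + v - x) <= r] |.

Definition Gamma (s : R) : R :=
  \int[lebesgue_measure]_(t in `]0, +oo[) (t `^ (s - 1) * expR (- t)).

Definition ball_vol A r : R :=
  (covolume A)^-1 * (pi `^ (d%:R / 2) / Gamma (d%:R / 2 + 1)) * r ^+ d.

Definition number_variance A N (Y : 'I_N -> 'cV[R]_d) r : R :=
  torus_integral A (fun x =>
    (\sum_(j < N) (ball_indicator A x r (Y j))%:R - N%:R * ball_vol A r) ^+ 2).

Definition hyperuniform_large A (X : forall N, 'I_N -> 'cV[R]_d) : Prop :=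
  forall r, 0 < r -> r < ediam (fundamental_domain A) / 2 ->
    (fun N => number_variance A (X N) r) =o_\oo (fun N => N%:R : R).

Definition hyperuniform_small A (X : forall N, 'I_N -> 'cV[R]_d) : Prop :=
  forall r_ : R^nat, (forall N, 0 < r_ N) ->
    r_ N @[N --> \oo] --> 0 ->
    N%:R * ball_vol A (r_ N) @[N --> \oo] --> +oo ->
    (fun N => number_variance A (X N) (r_ N)) =o_\oo
    (fun N => N%:R * ball_vol A (r_ N)).

(* The limsup is taken in the extended reals, so that the bound includes its
   finiteness. *)
Definition hyperuniform_threshold A (X : forall N, 'I_N -> 'cV[R]_d) : Prop :=
  exists C : R, \forall t \near +oo,
    (limn_esup (fun N =>
       (number_variance A (X N) (t * N%:R `^ (- d%:R^-1)))%:E) <=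
     (C * t ^+ d.-1)%:E)%E.

End lattice.

(* Main.v *)
(* In Fourier space the number variance is the sum over the nonzero dual vectors w of
   |1_B^(w)|^2 S(w), where S(w) = |sum_j exp(2 pi i <x_j, w>)|^2 and
   |1_B^(w)|^2 <= C R^(d-1) |w|^(-d-1) by an energy estimate for the Bessel-type equation satisfied
   by 1_B^. Applied to the trigonometric polynomial with coefficients
   (1 + 4 pi^2 |w|^2)^(-alpha) sum_j exp(-2 pi i <x_j, w>), the QMC property gives
   sum_w (1 + 4 pi^2 |w|^2)^(-alpha) S(w) <= c^2 N^(2 - 2 alpha/d).
   Since 2 alpha >= d + 1, this bounds sum |w|^(-d-1) S(w) over |w| <= N^(1/d) by a multiple of
   N^(1 - 1/d). For larger w, S is a positive definite function, so its sum over any translate of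
   the box of size N^(1/d) is at most a constant times its sum over a central box, which is O(N^2),
   and the same bound follows. Hence V(X_N, R) <= C R^(d-1) N^(1 - 1/d) for all N and R, which contains
   the three kinds of hyperuniformity. *)
Require Import Defs.
From HB Require Import structures.
From mathcomp Require Import all_boot all_order all_algebra fingroup perm finmap.
From mathcomp Require Import all_classical all_reals all_analysis.
From mathcomp Require Import measurable_realfun.
From mathcomp Require Import complex ring lra zify.

Set Implicit Arguments.
Unset Strict Implicit.
Unset Printing Implicit Defensive.

Import Order.TTheory GRing.Theory Num.Theory.
Import numFieldNormedType.Exports.

Local Open Scope classical_set_scope.
Local Open Scope ring_scope.

(** * Affine change of variables on column vectors *)

(** Since 2 alpha > d + 1, the weight |w|^(-2 alpha) that the QMC property controls decays faster
    than the weight |w|^(-d-1) of the variance, so it gives nothing useful for large w; this is what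
    forces the comparison of translated boxes. In that tail |w|^(-d-1) is replaced by a product over
    the coordinates of (1 + |q_i|)^(-1-1/d), where q indexes the box: the total degree is d + 1 and
    each factor is summable. For the variance only one half of Parseval is needed, the bound of an
    integral of a square by its Fourier sums. For the discontinuous discrepancy this is the half
    that requires completeness; Fejer means supply it, because the discrepancy is locally constant
    off finitely many surfaces of measure zero. The zero frequency drops out because the
    Gamma-function constant in [ball_vol] is the true volume of a ball, which is proved on the way.
    Everything is computed in lattice coordinates, with points in the unit cube and frequencies in
    Z^d; hence the linear change of variables at the start. *)

(** By uniqueness of Lebesgue measure: |u| times its image under x -> u x + c gives the right length
    to every interval ]a, b]. *)
Lemma lebesgue_measure_affine (R : realType) (u c : R) (f : R -> \bar R) :
  u != 0 -> measurable_fun setT f -> (forall x, 0 <= f x)%E ->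
  (`|u|%:E * \int[lebesgue_measure]_x f (u * x + c)%R =
   \int[lebesgue_measure]_x f x)%E.
Proof.
move=> u0 mf f0.
pose phi : measurableTypeR R -> measurableTypeR R := fun x => u * x + c.
have mphi : measurable_fun [set: measurableTypeR R] phi.
  by apply: measurable_funD => //; apply: measurable_funM.
transitivity (`|u|%:E * \int[pushforward (@lebesgue_measure R) phi]_x f x)%E.
  by rewrite ge0_integral_pushforward// preimage_setT.
pose nu_ : {measure set (measurableTypeR R) -> \bar R} := pushforward lebesgue_measure phi.
rewrite -[X in (X * _)%E]/((NngNum (normr_ge0 u))%:num%:E).
rewrite -(ge0_integral_mscale (nu_ mphi))//.
apply: eq_measure_integral => A mA _; apply/esym.
apply: lebesgue_measure_unique => // X [[a b]/= _ <-].
rewrite /mscale/= /pushforward lebesgue_measure_itv/= lte_fin.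
have uu : 0 < `|u| by rewrite normr_gt0.
have [u_gt0|u_lt0|/eqP] := ltrgt0P u; last by rewrite (negbTE u0).
- rewrite (_ : _ @^-1` _ = [set` `](a - c) / u, (b - c) / u]]); last first.
    apply/seteqP; split => x /=; rewrite !in_itv/= /phi ltr_pdivrMr// ler_pdivlMr// => /andP[? ?];
      by apply/andP; split; lra.
  rewrite lebesgue_measure_itv/= lte_fin ltr_pM2r ?invr_gt0// ltrD2r.
  case: ifPn => // _; last by rewrite mule0.
  by rewrite -!EFinB -EFinM; congr (_%:E); field.
(* A negative slope exchanges the open and the closed end. *)
- rewrite (_ : _ @^-1` _ = [set` `[(b - c) / u, (a - c) / u[]); last first.
    apply/seteqP; split => x /=; rewrite !in_itv/= /phi ltr_ndivlMr// ler_ndivrMr// => /andP[? ?];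
      by apply/andP; split; lra.
  rewrite lebesgue_measure_itv/= lte_fin ltr_nM2r ?invr_lt0// ltrD2r.
  case: ifPn => // _; last by rewrite mule0.
  by rewrite -!EFinB -EFinM; congr (_%:E); field.
Qed.

Section tonelli_cV.
Variables (R : realType) (n : nat) (f : 'cV[R]_n.+1 -> \bar R).
Hypotheses (mf : measurable_fun setT f) (f0 : forall x, (0 <= f x)%E).

Let mfc : measurable_fun [set: measurableTypeR R * 'cV[R]_n] (f \o @cons_cV R n).
Proof. by apply: measurableT_comp => //; exact: measurable_cons_cV. Qed.

Let integral_cons : (\int[lebesgue_cV]_x f x =
  \int[lebesgue_measure \x @lebesgue_cV R n]_p f (cons_cV p))%E.
Proof.
have mphi : measurable_fun [set: measurableTypeR R * 'cV[R]_n] (@cons_cV R n).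
  exact: measurable_cons_cV.
by rewrite -(@ge0_integral_pushforward _ _ _ _ _ _ mphi _ setT f).
Qed.

Lemma integral_cV_recl : (\int[lebesgue_cV]_x f x =
  \int[lebesgue_measure]_a \int[@lebesgue_cV R n]_x f (cons_cV (a, x)))%E.
Proof. by rewrite integral_cons fubini_tonelli1. Qed.

Lemma integral_cV_recr : (\int[lebesgue_cV]_x f x =
  \int[@lebesgue_cV R n]_x \int[lebesgue_measure]_a f (cons_cV (a, x)))%E.
Proof. by rewrite integral_cons fubini_tonelli2. Qed.

Lemma measurable_integral_cV_tail : measurable_fun [set: measurableTypeR R]
  (fun a => \int[@lebesgue_cV R n]_x f (cons_cV (a, x)))%E.
Proof.
exact: (@measurable_fun_fubini_tonelli_F _ _ _ _ _ (@lebesgue_cV R n)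
  (f \o @cons_cV R n) mfc (fun p => f0 _)).
Qed.

Lemma measurable_integral_cV_head : measurable_fun setT
  (fun x : 'cV[R]_n => \int[lebesgue_measure]_a f (cons_cV (a, x)))%E.
Proof.
exact: (@measurable_fun_fubini_tonelli_G _ _ _ _ _ (@lebesgue_measure R)
  (f \o @cons_cV R n) mfc (fun p => f0 _)).
Qed.

End tonelli_cV.

Lemma measurable_mulmx_add (R : realType) m n (B : 'M[R]_(m, n)) (c : 'cV[R]_m) :
  measurable_fun [set: 'cV[R]_n] (fun x : 'cV[R]_n => B *m x + c).
Proof.
apply/measurable_fun_cVP => i.
rewrite (_ : (fun x => _) =
    (fun x : 'cV[R]_n => \sum_j B i j * x j ord0 + c i ord0)); last first.
  by apply/funext => x; rewrite !mxE.
apply: measurable_funD => //; apply: measurable_sum => j.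
by apply: measurable_funM => //; exact: measurable_coord_cV.
Qed.

(** All translations are included because, when a block triangular matrix is treated one variable at
    a time, its off-diagonal block becomes a translation. Nonnegative functions suffice at this
    stage and let Tonelli apply unconditionally. *)
Definition affine_scaling (R : realType) d (B : 'M[R]_d) :=
  forall (c : 'cV[R]_d) (f : 'cV[R]_d -> \bar R), measurable_fun setT f ->
    (forall x, 0 <= f x)%E ->
  (`|\det B|%:E * \int[lebesgue_cV]_x f (B *m x + c)%R =
   \int[lebesgue_cV]_x f x)%E.

Lemma affine_scaling_mul (R : realType) d (B C : 'M[R]_d) :
  affine_scaling B -> affine_scaling C -> affine_scaling (B *m C).
Proof.
move=> hB hC c f mf f0.
have mfB : measurable_fun setT (fun x => f (B *m x + c)).
  exact: measurableT_comp mf (measurable_mulmx_add _ _).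
rewrite det_mulmx normrM -(hB c f mf f0) -(hC 0 (fun x => f (B *m x + c)))//.
rewrite EFinM -muleA; congr (_ * (_ * _))%E.
by apply: eq_integral => x _; rewrite addr0 mulmxA.
Qed.

Lemma cons_cV_addr (R : realType) n (a b : R) (x y : 'cV[R]_n) :
  cons_cV (a, x) + cons_cV (b, y) = cons_cV (a + b, x + y).
Proof.
rewrite /cons_cV/= raddfD.
exact: (@add_col_mx _ 1 n 1 a%:M x b%:M y).
Qed.

Lemma cV_consP (R : realType) n (c : 'cV[R]_n.+1) :
  exists a x, c = cons_cV (a, x).
Proof.
exists (c ord0 ord0), (\col_i c (lift ord0 i) ord0).
apply/matrixP => i j; rewrite (ord1 j).
have [k ->|->] := unliftP ord0 i; last by rewrite cons_cV0.
by rewrite cons_cVS mxE.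
Qed.

Lemma mul_block_cons_cV (R : realType) n (u : R) (r : 'rV[R]_n)
    (c : 'cV[R]_n) (B : 'M[R]_n) a x :
  (block_mx u%:M r c B : 'M[R]_(1 + n)) *m cons_cV (a, x) =
  cons_cV (u * a + (r *m x) ord0 ord0, a *: c + B *m x).
Proof.
apply: (etrans (@mul_block_col _ 1 n 1 n 1 u%:M r c B a%:M x)).
rewrite -scalar_mxM {1}[r *m x]mx11_scalar mul_mx_scalar /cons_cV/=.
by rewrite raddfD/=.
Qed.

(** Integrating over the head first, with the tail x fixed, makes r x a mere translation of the
    head. *)
Lemma affine_scaling_upper (R : realType) n (u : R) (r : 'rV[R]_n) (B : 'M[R]_n) :
  u != 0 -> affine_scaling B ->
  affine_scaling (block_mx u%:M r 0 B : 'M[R]_(1 + n)).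
Proof.
move=> u0 hB c f mf f0.
have [c0 [c' ->]] := cV_consP c.
set M := block_mx _ _ _ _.
have ME a x : M *m cons_cV (a, x) + cons_cV (c0, c') =
    cons_cV (u * a + ((r *m x) ord0 ord0 + c0), B *m x + c').
  by rewrite /M mul_block_cons_cV cons_cV_addr scaler0 add0r addrA.
rewrite (@det_ublock _ 1 n) det_scalar1 normrM.
have mfM : measurable_fun setT (fun x => f (M *m x + cons_cV (c0, c'))).
  exact: measurableT_comp mf (measurable_mulmx_add _ _).
rewrite integral_cV_recr// [RHS]integral_cV_recr//.
have mi := measurable_integral_cV_head mf f0.
have i0 x : (0 <= \int[lebesgue_measure]_a f (cons_cV (a, x)))%E.
  exact: integral_ge0.
rewrite -(hB c' _ mi i0) [X in (X%:E * _)%E]mulrC EFinM -muleA; congr (_ * _)%E.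
have mfc : measurable_fun [set: measurableTypeR R * 'cV[R]_n] (f \o @cons_cV R n).
  by apply: measurableT_comp => //; exact: measurable_cons_cV.
rewrite -ge0_integralZl_EFin//; last 2 first.
  - by move=> x _; exact: integral_ge0.
  - exact: (measurable_integral_cV_head mfM (fun x => f0 _)).
apply: eq_integral => x _.
under eq_integral do rewrite ME.
rewrite (lebesgue_measure_affine (f := fun a => f (cons_cV (a, B *m x + c'))) _ u0)//.
exact: (measurableT_comp mfc (measurable_pair2 _)).
Qed.

(** The opposite order of integration: with the head a fixed, a r is a translation of the tail. *)
Lemma affine_scaling_lower (R : realType) n (u : R) (r : 'cV[R]_n) (B : 'M[R]_n) :
  u != 0 -> affine_scaling B ->
  affine_scaling (block_mx u%:M 0 r B : 'M[R]_(1 + n)).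
Proof.
move=> u0 hB c f mf f0.
have [c0 [c' ->]] := cV_consP c.
set M := block_mx _ _ _ _.
have ME a x : M *m cons_cV (a, x) + cons_cV (c0, c') =
    cons_cV (u * a + c0, B *m x + (a *: r + c')).
  by rewrite /M mul_block_cons_cV cons_cV_addr mul0mx mxE addr0 addrCA addrA addrC.
rewrite (@det_lblock _ 1 n) det_scalar1 normrM.
have mfM : measurable_fun setT (fun x => f (M *m x + cons_cV (c0, c'))).
  exact: measurableT_comp mf (measurable_mulmx_add _ _).
rewrite integral_cV_recl// [RHS]integral_cV_recl//.
have mi := measurable_integral_cV_tail mf f0.
have i0 a : (0 <= \int[@lebesgue_cV R n]_x f (cons_cV (a, x)))%E.
  exact: integral_ge0.
rewrite -(lebesgue_measure_affine c0 u0 mi i0) EFinM -muleA; congr (_ * _)%E.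
have mfc : measurable_fun [set: measurableTypeR R * 'cV[R]_n] (f \o @cons_cV R n).
  by apply: measurableT_comp => //; exact: measurable_cons_cV.
rewrite -ge0_integralZl_EFin//; last 2 first.
  - by move=> a _; exact: integral_ge0.
  - exact: (measurable_integral_cV_tail mfM (fun x => f0 _)).
apply: eq_integral => a _.
under eq_integral do rewrite ME.
rewrite (hB _ (fun x => f (cons_cV (u * a + c0, x))))//.
exact: (measurableT_comp mfc (measurable_pair1 _)).
Qed.

Lemma block_mx_head (R : realType) n (M : 'M[R]_(1 + n)) :
  M = block_mx (M ord0 ord0)%:M (ursubmx M) (dlsubmx M) (drsubmx M).
Proof.
rewrite -[LHS]submxK [ulsubmx M]mx11_scalar !mxE.
by congr (block_mx (M _ _)%:M _ _ _); apply: val_inj.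
Qed.

Lemma affine_scaling_upper_trig (R : realType) d (U : 'M[R]_d) :
  U \in unitmx -> (forall i j : 'I_d, (j < i)%N -> U i j = 0) -> affine_scaling U.
Proof.
elim: d U => [|n IH] U Uu Ut.
  move=> c f mf f0; rewrite det_mx00 normr1 mul1e.
  by apply: eq_integral => x _; congr f; apply/matrixP => -[].
have Eu := block_mx_head (U : 'M[R]_(1 + n)).
have dl0 : dlsubmx (U : 'M[R]_(1 + n)) = 0.
  by apply/matrixP => i j; rewrite !mxE Ut//= ord1.
move: Uu; rewrite Eu dl0 unitmxE (@det_ublock _ 1 n) det_scalar1 unitfE mulf_eq0 negb_or.
move=> /andP[u0 B0]; apply: affine_scaling_upper => //.
apply: IH; first by rewrite unitmxE unitfE.
by move=> i j ji; rewrite !mxE Ut.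
Qed.

Lemma affine_scaling_lower_trig (R : realType) d (L : 'M[R]_d) :
  L \in unitmx -> (forall i j : 'I_d, (i < j)%N -> L i j = 0) -> affine_scaling L.
Proof.
elim: d L => [|n IH] U Uu Ut.
  move=> c f mf f0; rewrite det_mx00 normr1 mul1e.
  by apply: eq_integral => x _; congr f; apply/matrixP => -[].
have Eu := block_mx_head (U : 'M[R]_(1 + n)).
have dl0 : ursubmx (U : 'M[R]_(1 + n)) = 0.
  by apply/matrixP => i j; rewrite !mxE Ut//= ord1.
move: Uu; rewrite Eu dl0 unitmxE (@det_lblock _ 1 n) det_scalar1 unitfE mulf_eq0 negb_or.
move=> /andP[u0 B0]; apply: affine_scaling_lower => //.
apply: IH; first by rewrite unitmxE unitfE.
by move=> i j ji; rewrite !mxE Ut.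
Qed.

(** Boxes are stable under intersection and generate the sigma-algebra, and the cubes [-k, k]^d
    exhaust the space with finite measure. *)
Lemma lebesgue_cV_unique (R : realType) d
    (m : {measure set 'cV[R]_d -> \bar R}) :
  (forall B : 'I_d -> set R, (forall i, measurable (B i)) ->
    m [set x | forall i, B i (x i ord0)] =
    (\prod_(i < d) lebesgue_measure (B i))%E) ->
  forall S, measurable S -> m S = lebesgue_cV S.
Proof.
move=> mE S mS.
pose rect (B : 'I_d -> set R) := [set x : 'cV[R]_d | forall i, B i (x i ord0)].
pose G : set (set 'cV[R]_d) :=
  [set rect B | B in [set B | forall i, measurable (B i)]].
pose g k := rect (fun=> `[- k%:R, k%:R]%classic).
have Gm : G `<=` measurable.
  move=> _ [B mB <-]; rewrite (_ : rect B = \big[setI/setT]_(i < d)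
      ((fun x : 'cV[R]_d => x i ord0) @^-1` B i)).
    apply: bigsetI_measurable => i _.
    by rewrite -[X in measurable X]setTI; exact: (measurable_coord_cV _ _ (mB i)).
  apply/seteqP; split=> x; rewrite -bigcap_seq; first by move=> Bx i _; exact: Bx.
  by move=> Bx i; apply: (Bx i); rewrite /= mem_index_enum.
apply: (@measure_unique _ _ _ G g) => //.
- apply/seteqP; split; last by apply: smallest_sub => //; exact: sigma_algebra_measurable.
  apply: smallest_sub; first exact: smallest_sigma_algebra.
  move=> A; rewrite -bigcup_seq => -[i _ [B mB <-]]; rewrite setTI.
  apply: sub_sigma_algebra; exists (fun j => if j == i then B else setT).
    by move=> j; case: ifP.
  apply/seteqP; split => x /=; first by move/(_ i); rewrite eqxx.
  by move=> Bx j; case: eqP => [->|].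
- move=> _ _ [A mA <-] [B mB <-]; exists (fun i => A i `&` B i).
    by move=> i; exact: measurableI.
  apply/seteqP; split=> x /=; first by move=> AB; split=> i; case: (AB i).
  by move=> [Ax Bx] i; split; [exact: Ax|exact: Bx].
- by move=> k; exists (fun=> `[- k%:R, k%:R]%classic).
- apply/seteqP; split => // x _.
  exists (Num.truncn (\sum_i `|x i ord0|)).+1 => // i.
  rewrite /= in_itv/= -ler_norml.
  apply: le_trans (ltW (truncnS_gt _)).
  by rewrite (bigD1 i)//= lerDl sumr_ge0.
- by move=> _ [B mB <-]; rewrite [LHS]mE// [RHS]lebesgue_cV_rectangle.
- move=> k; rewrite [ltLHS]mE//.
  pose I : set R := `[- k%:R, k%:R]%classic.
  suff : (\prod_(i < d) lebesgue_measure I)%E \is a fin_num.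
    by rewrite fin_numElt => /andP[].
  elim/big_ind : _ => //= [x y|i _]; first exact: fin_numM.
  by rewrite /I lebesgue_measure_itv/=; case: ifP.
Qed.

Lemma affine_scaling_perm (R : realType) d (s : 'S_d) :
  affine_scaling (perm_mx s : 'M[R]_d).
Proof.
(* Translation invariance, which disposes of c; a permutation alone maps boxes to boxes. *)
have shift1 : affine_scaling (1%:M : 'M[R]_d).
  by apply: affine_scaling_upper_trig; [exact: unitmx1|move=> i j ji; rewrite mxE gt_eqF].
move=> c f mf f0.
have mp : measurable_fun setT (fun x : 'cV[R]_d => perm_mx s *m x).
  have := measurable_mulmx_add (perm_mx s) (0 : 'cV[R]_d).
  by under eq_fun do rewrite addr0.
have mfc : measurable_fun setT (fun x : 'cV[R]_d => f (x + c)).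
  apply: measurableT_comp => //.
  have := measurable_mulmx_add (1%:M : 'M[R]_d) c.
  by under eq_fun do rewrite mul1mx.
rewrite det_perm normrX normrN1 expr1n mul1e.
rewrite -[RHS](shift1 c f mf f0) det1 normr1 mul1e.
under [RHS]eq_integral do rewrite mul1mx.
pose m_ : {measure set 'cV[R]_d -> \bar R} := pushforward lebesgue_cV (fun x : 'cV[R]_d => perm_mx s *m x).
rewrite [RHS](eq_measure_integral (m_ mp)).
  by rewrite ge0_integral_pushforward// preimage_setT.
move=> S mS _; apply/esym; apply: lebesgue_cV_unique => // B mB.
rewrite /m_/= /pushforward (_ : _ @^-1` _ =
    [set x : 'cV[R]_d | forall i, B ((s^-1)%g i) (x i ord0)]).
  apply: (etrans (lebesgue_cV_rectangle (fun i => mB ((s^-1)%g i)))).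
  rewrite (reindex_inj (@perm_inj _ s))/=.
  by apply: eq_bigr => i _; rewrite permK.
apply/seteqP; split=> x /= h i.
  by have := h ((s^-1)%g i); rewrite -row_permE !mxE permKV.
by rewrite -row_permE !mxE -[i in B i](permK s); exact: h.
Qed.

(** The LUP factorization reduces an invertible matrix to a permutation and two triangular
    factors. *)
Lemma integral_affine (R : realType) d (B : 'M[R]_d) :
  B \in unitmx -> affine_scaling B.
Proof.
case: d B => [|n] B uB; first by apply: affine_scaling_upper_trig => // -[].
have := cormen_lup_correct B; have := cormen_lup_detL B.
have := cormen_lup_lower B; have := cormen_lup_upper B.
have := cormen_lup_perm B.
case: (cormen_lup B) => -[P L] U /= /is_perm_mxP[s ->] hU hL dL PE.
have uL : L \in unitmx by rewrite unitmxE dL unitr1.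
have BE : B = perm_mx s^-1 *m (L *m U).
  rewrite [L *m U](_ : _ = perm_mx s *m B); last by rewrite -[RHS]/(perm_mx s * B) PE.
  by rewrite mulmxA -perm_mxM mulVg perm_mx1 mul1mx.
have uU : U \in unitmx.
  by move: uB; rewrite BE !unitmx_mul => /andP[_ /andP[]].
rewrite BE; apply: affine_scaling_mul; first exact: affine_scaling_perm.
apply: affine_scaling_mul.
- apply: affine_scaling_lower_trig => // i j ij; rewrite hL ?(ltnW ij)//.
  by rewrite -val_eqE ltn_eqF.
- by apply: affine_scaling_upper_trig.
Qed.

Section change_of_variables.
Variables (R : realType) (d : nat) (B : 'M[R]_d) (c : 'cV[R]_d).
Hypothesis uB : B \in unitmx.

Let k0 : 0 < `|\det B|.
Proof. by rewrite normr_gt0 -unitfE -unitmxE. Qed.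

(** No integrability is required: multiplication by a positive real commutes with the difference of
    the two parts even when they are infinite. *)
Lemma integral_affine_measurable (f : 'cV[R]_d -> \bar R) :
  measurable_fun setT f ->
  (`|\det B|%:E * \int[lebesgue_cV]_x f (B *m x + c)%R =
   \int[lebesgue_cV]_x f x)%E.
Proof.
move=> mf; rewrite [in RHS]integralE.
rewrite -(integral_affine uB c (measurable_funepos mf) (fun x => funepos_ge0 _ _)).
rewrite -(integral_affine uB c (measurable_funeneg mf) (fun x => funeneg_ge0 _ _)).
rewrite integralE.
have -> : (fun x => f (B *m x + c)%R)^\+%E = (fun x => f^\+%E (B *m x + c)).
  by apply/funext => x; rewrite !funeposE.
have -> : (fun x => f (B *m x + c)%R)^\-%E = (fun x => f^\-%E (B *m x + c)).
  by apply/funext => x; rewrite !funenegE.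
set a := (X in (_ * (X - _) = _)%E); set b := (X in (_ * (_ - X) = _)%E).
have a0 : (0 <= a)%E by apply: integral_ge0 => x _; exact: funepos_ge0.
have b0 : (0 <= b)%E by apply: integral_ge0 => x _; exact: funeneg_ge0.
rewrite -[RHS]/(`|\det B|%:E * a - `|\det B|%:E * b)%E.
move: k0; set k : R := `|_| => kp.
case: a b a0 b0 => [a| |] [b| |]// a0 b0; rewrite ?(gt0_muley, gt0_muleNy, lte_fin)//=.
by rewrite -EFinB -!EFinM -EFinB mulrBr.
Qed.

Lemma Rintegral_affine (D : set 'cV[R]_d) (f : 'cV[R]_d -> R) :
  measurable D -> measurable_fun D f ->
  `|\det B| * \int[lebesgue_cV]_(x in [set x | D (B *m x + c)]) f (B *m x + c) =
  \int[lebesgue_cV]_(x in D) f x.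
Proof.
move=> mD mf; rewrite Rintegral_mkcond [RHS]Rintegral_mkcond /Rintegral.
have mfD : measurable_fun setT (EFin \o (f \_ D)).
  by apply/measurable_EFinP; apply/(measurable_restrictT _ _).1.
rewrite -(integral_affine_measurable mfD)/=.
rewrite (_ : (fun x => _) = (fun x => ((f \_ D) (B *m x + c))%:E)); last first.
  exact/funext.
(* An infinite integral has [fine] part 0, on both sides alike. *)
case: (integral _ _ _) => [r| |]//=.
- by rewrite gt0_muley ?lte_fin//= mulr0.
- by rewrite gt0_muleNy ?lte_fin//= mulr0.
Qed.

Lemma lebesgue_cV_affine (D : set 'cV[R]_d) : measurable D ->
  (`|\det B|%:E * lebesgue_cV [set x | D (B *m x + c)%R] = lebesgue_cV D)%E.
Proof.
move=> mD; have mB := measurable_mulmx_add B c.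
have mD' : measurable [set x | D (B *m x + c)].
  by rewrite -[X in measurable X]setTI; exact: mB.
rewrite -[RHS]mul1e -[LHS]/(_ * lebesgue_cV _)%E.
rewrite -[in RHS]integral_cst// -[lebesgue_cV (mkset _)]mul1e -integral_cst//.
rewrite integral_mkcond [in RHS]integral_mkcond.
by rewrite -[RHS]integral_affine_measurable//; apply/(measurable_restrictT _ _).1.
Qed.

End change_of_variables.

Lemma integral_cV_prod (R : realType) d (f : 'I_d -> R -> R) :
  (forall i, measurable_fun setT (f i)) -> (forall i x, 0 <= f i x) ->
  (\int[lebesgue_cV]_x (\prod_(i < d) f i (x i ord0))%:E =
   \prod_(i < d) \int[lebesgue_measure]_a (f i a)%:E)%E.
Proof.
elim: d f => [|n IH] f mf f0.
  rewrite big_ord0; under eq_integral do rewrite big_ord0.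
  by rewrite integral_cst//= diracT mule1.
pose P (x : 'cV[R]_n) := \prod_(i < n) f (lift ord0 i) (x i ord0).
have mP k (g : 'I_k -> R -> R) : (forall i, measurable_fun setT (g i)) ->
    measurable_fun setT (fun x : 'cV[R]_k => \prod_(i < k) g i (x i ord0)).
  move=> mg; apply: measurable_prod => i _.
  by apply: measurableT_comp => //; exact: measurable_coord_cV.
have P0 x : 0 <= P x by apply: prodr_ge0.
rewrite integral_cV_recl; last 2 first.
  - by apply/measurable_EFinP; exact: mP.
  - by move=> x; rewrite lee_fin prodr_ge0.
rewrite big_ord_recl -(IH (fun i => f (lift ord0 i)))//.
have mf0 : measurable_fun setT (EFin \o f ord0) by apply/measurable_EFinP; exact: mf.
transitivity (\int[lebesgue_measure]_a
    ((EFin \o f ord0) a * \int[lebesgue_cV]_x (P x)%:E))%E; last first.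
  rewrite ge0_integralZr//; first by move=> x _; rewrite /= lee_fin.
  by apply: integral_ge0 => x _; rewrite lee_fin.
apply: eq_integral => a _.
rewrite -ge0_integralZl_EFin//; last 2 first.
  - by move=> x _; rewrite lee_fin.
  - by apply/measurable_EFinP; exact: (mP _ (fun i => f (lift ord0 i))).
apply: eq_integral => x _; rewrite /= -EFinM big_ord_recl cons_cV0.
by congr ((_ * _)%:E); apply: eq_bigr => i _; rewrite cons_cVS.
Qed.

(** * Volumes of balls and spheres *)

Section euclidean.
Variables (R : realType) (d : nat).
Implicit Types x y c : 'cV[R]_d.

Lemma dotv_ge0 x : 0 <= dotv x x.
Proof. by apply: sumr_ge0 => i _; rewrite -expr2 sqr_ge0. Qed.

Lemma enorm_ge0 x : 0 <= enorm x.
Proof. exact: sqrtr_ge0. Qed.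

Lemma enorm_sqr x : enorm x ^+ 2 = dotv x x.
Proof. by rewrite sqr_sqrtr// dotv_ge0. Qed.

Lemma enorm_le x (r : R) : 0 <= r -> (enorm x <= r) = (dotv x x <= r ^+ 2).
Proof.
by move=> r0; rewrite -enorm_sqr ler_sqr// ?nnegrE// enorm_ge0.
Qed.

Lemma measurable_sub_enorm c : measurable_fun setT (fun x => dotv (x - c) (x - c)).
Proof.
have m : measurable_fun setT (fun x => x - c).
  have := measurable_mulmx_add (1%:M : 'M[R]_d) (- c).
  by under eq_fun do rewrite mul1mx.
apply: measurable_sum => i.
by apply: measurable_funM; exact: (measurable_fun_cVP _).1.
Qed.

Lemma measurable_ball_le c (r : R) : measurable [set x | dotv (x - c) (x - c) <= r].
Proof.
rewrite -[X in measurable X]setTI.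
exact: (measurable_fun_ler (measurable_sub_enorm c) (measurable_cst r)).
Qed.

End euclidean.

Section ball_volume.
Variables (R : realType) (d : nat).

Definition unit_ball_volume : R :=
  fine (lebesgue_cV [set x : 'cV[R]_d | dotv x x <= 1]).

Lemma measurable_dotv_le (r : R) : measurable [set x : 'cV[R]_d | dotv x x <= r].
Proof.
have := measurable_ball_le (0 : 'cV[R]_d) r.
by under eq_set do rewrite subr0.
Qed.

Lemma unit_ball_volumeE :
  lebesgue_cV [set x : 'cV[R]_d | dotv x x <= 1] = unit_ball_volume%:E.
Proof.
rewrite /unit_ball_volume fineK// ge0_fin_numE//.
pose I : set R := `[-1, 1]%classic.
have mI (i : 'I_d) : measurable I by exact: measurable_itv.
apply: (@le_lt_trans _ _ (lebesgue_cV [set x : 'cV[R]_d | forall i, I (x i ord0)])).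
  apply: le_measure; rewrite ?inE; first exact: measurable_dotv_le.
    rewrite (_ : mkset _ = \big[setI/setT]_(i < d)
        ((fun x : 'cV[R]_d => x i ord0) @^-1` I)).
      apply: bigsetI_measurable => i _.
      by rewrite -[X in measurable X]setTI; exact: (measurable_coord_cV _ _ (mI i)).
    apply/seteqP; split=> x; rewrite -bigcap_seq; first by move=> Bx i _; exact: Bx.
    by move=> Bx i; apply: (Bx i); rewrite /= mem_index_enum.
  move=> x /= x1 i; rewrite /I/= in_itv/= -ler_norml -(@ler_pXn2r _ 2)// ?nnegrE// expr1n.
  apply: le_trans x1; rewrite real_normK ?num_real// /dotv (bigD1 i)//= expr2 lerDl.
  by apply: sumr_ge0 => j _; rewrite -expr2 sqr_ge0.
have -> := lebesgue_cV_rectangle mI.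
suff : (\prod_(i < d) lebesgue_measure I)%E \is a fin_num.
  by rewrite fin_numElt => /andP[].
elim/big_ind : _ => //= [x y|i _]; first exact: fin_numM.
by rewrite /I lebesgue_measure_itv/=; case: ifP.
Qed.

Lemma lebesgue_cV_ball (c : 'cV[R]_d) (r : R) : 0 < r ->
  lebesgue_cV [set x | dotv (x - c) (x - c) <= r ^+ 2] =
  (unit_ball_volume * r ^+ d)%:E.
Proof.
move=> r0.
have u : (r%:M : 'M[R]_d) \in unitmx.
  by rewrite unitmxE det_scalar unitfE expf_neq0 ?gt_eqF.
rewrite -(lebesgue_cV_affine c u (measurable_ball_le c (r ^+ 2))).
rewrite det_scalar normrX gtr0_norm// mulrC EFinM; congr (_ * _)%E.
rewrite -unit_ball_volumeE; congr lebesgue_cV; apply/seteqP.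
have E x : dotv (r *: x) (r *: x) = r ^+ 2 * dotv x x.
  by rewrite /dotv mulr_sumr; apply: eq_bigr => i _; rewrite !mxE; ring.
by split=> x /=; rewrite addrK mul_scalar_mx E ger_pMr// exprn_gt0.
Qed.

Lemma integral_gauss_cV :
  (\int[@lebesgue_cV R d]_x (expR (- dotv x x))%:E = (pi `^ (d%:R / 2))%:E)%E.
Proof.
have -> : (fun x : 'cV[R]_d => (expR (- dotv x x))%:E) =
    (fun x => (\prod_(i < d) gauss_fun (x i ord0))%:E).
  apply/funext => x; rewrite /gauss_fun -expR_sum; congr (expR _)%:E.
  by rewrite -sumrN; apply: eq_bigr => i _; rewrite expr2.
rewrite (integral_cV_prod (fun i => @measurable_gauss_fun R) (fun i => @gauss_fun_ge0 R)).
under eq_bigr do rewrite integralT_gauss.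
rewrite prodEFin prodr_const card_ord -powR12_sqrt ?pi_ge0//.
by rewrite -powR_mulrn ?powR_ge0// -powRrM mulrC.
Qed.

Lemma integral_expRN_ge (s : R) :
  (\int[lebesgue_measure]_(t in `[s, +oo[) (expR (- t))%:E = (expR (- s))%:E)%E.
Proof.
rewrite (@ge0_continuous_FTC2y R _ (fun t => - expR (- t)) s 0).
- by rewrite -EFinB opprK add0r.
- by move=> x _; exact: expR_ge0.
- apply: continuous_subspaceT => x.
  by apply: continuous_comp; [exact: opp_continuous|exact: continuous_expR].
- rewrite -oppr0; apply: cvgN; exact: cvgr_expR.
- by move=> x _.
- apply: cvg_at_right_filter; apply: cvgN.
  by apply: continuous_comp; [exact: opp_continuous|exact: continuous_expR].
- by move=> x _; rewrite derive1E derive_val; rewrite !(mulrN1, mulN1r, scaler1, scaleN1r, scalerN, opprK).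
Qed.

(** With s = |x|^2 this is the inner integral of the double integral below. The condition 0 < t
    matches the open domain in [Gamma]; it matters only for s = 0, where it removes one point. *)
Lemma integral_expRN_itv (s : R) : 0 <= s ->
  (\int[lebesgue_measure]_t ((expR (- t) *+ ((s <= t) && (0 < t)))%:E) =
   (expR (- s))%:E)%E.
Proof.
move=> s0; rewrite -integral_expRN_ge.
move: s0; rewrite le_eqVlt => /predU1P[<-|s0].
  rewrite -integral_itv_obnd_cbnd; last first.
    apply: measurable_funTS; apply/measurable_EFinP; apply: measurableT_comp => //.
  rewrite [RHS]integral_mkcond; apply: eq_integral => t _.
  rewrite /patch mem_setE in_itv/= andbT.
  by case: ltP => [/ltW ->|]; rewrite ?andbF.
rewrite [RHS]integral_mkcond; apply: eq_integral => t _.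
rewrite /patch mem_setE in_itv/= andbT.
by case: (leP s t) => // st; rewrite (lt_le_trans s0 st).
Qed.

(* Both sides are the integral of exp(-|x|^2), the left one as the integral over t > 0 of
   exp(-t) times the volume of the ball of radius sqrt t. *)
Lemma unit_ball_volume_Gamma :
  unit_ball_volume * Gamma (d%:R / 2 + 1 : R) = pi `^ (d%:R / 2).
Proof.
pose S : set ('cV[R]_d * measurableTypeR R) :=
  [set p | (dotv p.1 p.1 <= p.2) && (0 < p.2)].
pose h (p : 'cV[R]_d * measurableTypeR R) : \bar R :=
  ((expR (- p.2) *+ ((dotv p.1 p.1 <= p.2) && (0 < p.2)))%:E).
have mdot : measurable_fun setT (fun p : 'cV[R]_d * measurableTypeR R => dotv p.1 p.1).
  apply: measurable_sum => i; apply: measurable_funM;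
  exact: (measurableT_comp (measurable_coord_cV i) measurable_fst).
have mh : measurable_fun setT h.
  apply/measurable_EFinP.
  rewrite (_ : (fun p => _) = (fun p : 'cV[R]_d * measurableTypeR R =>
      if (dotv p.1 p.1 <= p.2) && (0 < p.2) then expR (- p.2) else 0)); last first.
    by apply/funext => p; case: ifP.
  apply: measurable_fun_ifT => //.
    apply: measurable_and; first exact: measurable_fun_ler.
    by apply: measurable_fun_ltr.
  apply: measurableT_comp => //; apply: measurableT_comp => //.
have h0 p : (0 <= h p)%E by rewrite lee_fin mulrn_wge0// expR_ge0.
have := @fubini_tonelli _ _ _ _ _ (@lebesgue_cV R d) (@lebesgue_measure R) h mh h0.
under eq_integral do rewrite /h/= integral_expRN_itv ?dotv_ge0//.
rewrite integral_gauss_cV.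
have k0 : 0 <= unit_ball_volume by rewrite fine_ge0.
have mg : measurable_fun (`]0, +oo[%classic : set R)
    (fun t : R => (t `^ (d%:R / 2 + 1 - 1) * expR (- t))%:E).
  apply: measurable_funTS; apply/measurable_EFinP; apply: measurable_funM => //.
  by apply: measurableT_comp => //.
have -> : (\int[lebesgue_measure]_y \int[lebesgue_cV]_x h (x, y) =
    unit_ball_volume%:E * \int[lebesgue_measure]_(t in `]0%R, +oo[)
      (t `^ (d%:R / 2 + 1 - 1) * expR (- t))%:E)%E.
  rewrite -ge0_integralZl_EFin//; last first.
    by move=> t _; rewrite lee_fin mulr_ge0 ?powR_ge0 ?expR_ge0.
  rewrite [RHS]integral_mkcond; apply: eq_integral => t _.
  rewrite /patch mem_setE in_itv/= andbT /h/=.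
  case: ifPn => t0; last by under eq_integral do rewrite andbF; rewrite integral0.
  have := lebesgue_cV_ball (0 : 'cV[R]_d) (r := Num.sqrt t).
  rewrite sqr_sqrtr ?(ltW t0)// sqrtr_gt0 => /(_ t0).
  under eq_set do rewrite subr0.
  move=> Bt.
  transitivity (\int[lebesgue_cV]_x ((expR (- t))%:E * (\1_[set x : 'cV[R]_d | dotv x x <= t] x)%:E))%E.
    apply: eq_integral => x _; rewrite andbT -EFinM indicE mem_setE.
    by rewrite mulr_natr.
  rewrite ge0_integralZl_EFin ?expR_ge0//; last first.
    by apply/measurable_EFinP; apply: measurable_indic; exact: measurable_dotv_le.
  rewrite integral_indic//; last exact: measurable_dotv_le.
  rewrite setIT [X in (_ * X)%E]Bt -!EFinM; congr (_%:E).
  have -> : t `^ (d%:R / 2 + 1 - 1) = Num.sqrt t ^+ d.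
    by rewrite addrK -powR12_sqrt ?(ltW t0)// -powR_mulrn ?powR_ge0// -powRrM mulrC.
  by ring.
rewrite /Gamma /Rintegral.
have : (0 <= \int[@lebesgue_measure R]_(t in `]0%R, +oo[) (t `^ (d%:R / 2 + 1 - 1) * expR (- t))%:E)%E.
  apply: integral_ge0.
  by move=> t _; rewrite lee_fin mulr_ge0 ?powR_ge0 ?expR_ge0.
(* Finiteness of the Gamma integral is not known beforehand: an infinite value would make the
   product 0 or infinite, whereas it equals a positive real power of pi. *)
case: (integral _ _ _) => [r _ [->]//| _|//].
move: k0; rewrite le_eqVlt => /predU1P[<-|k0].
  by rewrite mul0e => -[/eqP]; rewrite gt_eqF// powR_gt0// pi_gt0.
by rewrite gt0_muley.
Qed.

Lemma unit_ball_volume_ge0 : 0 <= unit_ball_volume.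
Proof. by rewrite fine_ge0. Qed.

Lemma unit_ball_volume_gt0 : 0 < unit_ball_volume.
Proof.
rewrite lt_def unit_ball_volume_ge0 andbT; apply/eqP => k0.
have := unit_ball_volume_Gamma; rewrite k0 mul0r => /esym/eqP.
by rewrite gt_eqF// powR_gt0// pi_gt0.
Qed.

Lemma ball_volE (A : 'M[R]_d) r : ball_vol A r = (covolume A)^-1 * unit_ball_volume * r ^+ d.
Proof.
rewrite /ball_vol -unit_ball_volume_Gamma mulfK//.
apply/eqP => G0; have := unit_ball_volume_Gamma; rewrite G0 mulr0 => /esym/eqP.
by rewrite gt_eqF// powR_gt0// pi_gt0.
Qed.

End ball_volume.
Arguments unit_ball_volume {R} d.

(** A line parallel to the first axis meets a sphere in at most two points. The dimension is
    positive because in dimension 0 the sphere of radius 0 is the whole space, of measure 1. *)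
Lemma lebesgue_cV_sphere (R : realType) d (c : 'cV[R]_d.+1) (s : R) :
  lebesgue_cV [set x | dotv (x - c) (x - c) = s] = 0%E.
Proof.
have mS : measurable [set x | dotv (x - c) (x - c) = s].
  by have := measurable_sub_enorm c measurableT (measurable_set1 s); rewrite setTI.
move: mS; set S := mkset _ => mS.
have -> : lebesgue_cV S = (\int[@lebesgue_cV R d.+1]_x (\1_S x : R)%:E)%E.
  by rewrite integral_indic// setIT.
have mI : measurable_fun setT (fun x : 'cV[R]_d.+1 => (\1_S x : R)%:E).
  by apply/measurable_EFinP; exact: measurable_indic.
rewrite integral_cV_recr//.
apply: integral0_eq => x _.
have [c0 [c' cE]] := cV_consP c.
(* If the radicand is negative the slice is empty, so the value 0 of the root is harmless: only the
   inclusion of the slice in [T] is used. *)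
pose q := Num.sqrt (s - dotv (x - c') (x - c')).
pose T : set (measurableTypeR R) := [set c0 + q] `|` [set c0 - q].
have mT : measurable T by apply: measurableU; exact: measurable_set1.
have T0 : lebesgue_measure T = 0%E.
  apply/eqP; rewrite eq_le measure_ge0 andbT.
  apply: (le_trans (measureU2 _ _ _)); [exact: measurable_set1|exact: measurable_set1|].
  have l1 (u : R) : (lebesgue_measure [set u] <= 0)%E by rewrite lebesgue_measure_set1.
  by rewrite -[leRHS]adde0; exact: leeD (l1 _) (l1 _).
apply/eqP; rewrite eq_le integral_ge0 ?andbT; last by move=> a _; rewrite lee_fin.
apply: (@le_trans _ _ (\int[@lebesgue_measure R]_a (\1_T a : R)%:E)%E); last first.
  by rewrite integral_indic// setIT; rewrite -[leLHS]/(lebesgue_measure T) T0.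
apply: ge0_le_integral => //.
- have mp : measurable_fun setT (fun a : measurableTypeR R => cons_cV (a, x)).
    exact: (measurableT_comp (@measurable_cons_cV R _) (measurable_pair2 x)).
  exact: measurableT_comp mI mp.
- by apply/measurable_EFinP; exact: measurable_indic.
move=> a _; rewrite lee_fin !indicE ler_nat; case: (boolP (cons_cV _ \in S)) => //=.
rewrite inE /S/= cE => dE.
have {}dE : (a - c0) ^+ 2 = s - dotv (x - c') (x - c').
  rewrite -dE (_ : cons_cV (a, x) - cons_cV (c0, c') = cons_cV (a - c0, x - c')).
    rewrite /dotv big_ord_recl cons_cV0 -expr2.
    by under [X in _ + X - _]eq_bigr do rewrite cons_cVS; rewrite addrK.
  by apply/eqP; rewrite subr_eq cons_cV_addr !subrK.
have : (a - c0) ^+ 2 == q ^+ 2 by rewrite sqr_sqrtr -dE ?sqr_ge0.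
rewrite eqf_sqr => /orP[]/eqP aE; rewrite lt0b inE; [left|right] => /=.
  by rewrite -aE; ring.
by rewrite -aE; ring.
Qed.

(** * Decay of the Fourier transform of a ball *)

Section oscillatory.
Variable R : realType.
Implicit Types (h f g : R -> R) (x l t : R).

Lemma is_derive_mul f g x a b : is_derive x (1 : R) f a -> is_derive x (1 : R) g b ->
  is_derive x (1 : R) (fun t => f t * g t) (f x * b + g x * a).
Proof. by move=> Hf Hg; exact: is_deriveM. Qed.

Lemma is_derive_chain f g x a b : is_derive (g x) (1 : R) f a -> is_derive x (1 : R) g b ->
  is_derive x (1 : R) (fun t => f (g t)) (a * b).
Proof. by move=> Hf Hg; exact: is_derive1_comp. Qed.

Lemma is_derive_mulr_id x t : is_derive x (1 : R) (fun l => l * t) t.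
Proof.
apply: is_derive_eq (is_derive_mul (is_derive_id x 1) (is_derive_cst t x 1)) _.
by rewrite mulr0 add0r mulr1.
Qed.

Definition cos_int h l : R := \int[lebesgue_measure]_(t in `[-1, 1]) (h t * cos (l * t)).
Definition sin_int h l : R := \int[lebesgue_measure]_(t in `[-1, 1]) (h t * sin (l * t)).

Lemma integrable_m11 f : continuous f ->
  lebesgue_measure.-integrable `[-1, 1] (EFin \o f).
Proof.
move=> cf; apply: continuous_compact_integrable; first exact: segment_compact.
exact: continuous_subspaceT.
Qed.

Lemma continuous_mul f g : continuous f -> continuous g -> continuous (fun t => f t * g t).
Proof. by move=> cf cg t; apply: cvgM; [exact: cf|exact: cg]. Qed.

Lemma continuous_cos_mul l : continuous (fun t : R => cos (l * t)).
Proof.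
move=> t; apply: continuous_comp; last exact: continuous_cos.
exact: mulrl_continuous.
Qed.

Lemma continuous_sin_mul l : continuous (fun t : R => sin (l * t)).
Proof.
move=> t; apply: continuous_comp; last exact: continuous_sin.
exact: mulrl_continuous.
Qed.

(** Differentiation under the integral sign; since |t| <= 1, the derivative of the integrand is
    dominated by |h|. *)
Lemma is_derive_cos_int h l : continuous h ->
  is_derive l (1 : R) (cos_int h) (- sin_int (fun t => t * h t) l).
Proof.
move=> ch.
pose f l t := h t * cos (l * t).
have df x t : is_derive x (1 : R) (f^~ t) (- (t * h t * sin (x * t))).
  have H := is_derive_mul (is_derive_cst (h t) x 1)
    (is_derive_chain (g := fun l => l * t) (is_derive_cos (x * t))
      (is_derive_mulr_id x t)).
  by apply: (is_derive_eq H); rewrite /cst; ring.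
have p1E x t : partial1of2 f x t = - (t * h t * sin (x * t)).
  by rewrite partial1of2E; have [] := df x t.
have lI : (`]l - 1, l + 1[%classic : set R) l by rewrite /= in_itv/=; apply/andP; split; lra.
have if_ x : lebesgue_measure.-integrable `[-1, 1] (EFin \o f x).
  by apply: integrable_m11; apply: continuous_mul => //; exact: continuous_cos_mul.
have iG : lebesgue_measure.-integrable `[-1, 1] (EFin \o (fun t => `|h t|)).
  by apply: integrable_m11 => t; apply: continuous_comp; [exact: ch|exact: norm_continuous].
have fG x t : (`[-1, 1]%classic : set R) t -> `|partial1of2 f x t| <= `|h t|.
  rewrite /= in_itv/= -ler_norml => t1; rewrite p1E normrN !normrM.
  rewrite mulrAC ler_piMl// mulr_ile1//.
  by rewrite ler_norml sin_geN1 sin_le1.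
apply: DeriveDef.
  apply: (@derivable_under_integral R _ _ lebesgue_measure f _ _ l (l - 1) (l + 1) lI) iG _ => //.
  by move=> x t _; exact: fG.
rewrite -derive1E.
rewrite (@differentiation_under_integral R _ _ lebesgue_measure f _ _ l (l - 1) (l + 1) lI _ _ _ _ iG)//; last first.
  by move=> x t _; exact: fG.
under eq_Rintegral do rewrite p1E -mulN1r.
rewrite RintegralZl ?mulN1r//; apply: integrable_m11.
apply: continuous_mul; last exact: continuous_sin_mul.
by apply: continuous_mul => // t; exact: cvg_id.
Qed.

Lemma is_derive_sin_int h l : continuous h ->
  is_derive l (1 : R) (sin_int h) (cos_int (fun t => t * h t) l).
Proof.
move=> ch.
pose f l t := h t * sin (l * t).
have df x t : is_derive x (1 : R) (f^~ t) (t * h t * cos (x * t)).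
  have H := is_derive_mul (is_derive_cst (h t) x 1)
    (is_derive_chain (g := fun l => l * t) (is_derive_sin (x * t))
      (is_derive_mulr_id x t)).
  by apply: (is_derive_eq H); rewrite /cst; ring.
have p1E x t : partial1of2 f x t = t * h t * cos (x * t).
  by rewrite partial1of2E; have [] := df x t.
have lI : (`]l - 1, l + 1[%classic : set R) l by rewrite /= in_itv/=; apply/andP; split; lra.
have if_ x : lebesgue_measure.-integrable `[-1, 1] (EFin \o f x).
  by apply: integrable_m11; apply: continuous_mul => //; exact: continuous_sin_mul.
have iG : lebesgue_measure.-integrable `[-1, 1] (EFin \o (fun t => `|h t|)).
  by apply: integrable_m11 => t; apply: continuous_comp; [exact: ch|exact: norm_continuous].
have fG x t : (`[-1, 1]%classic : set R) t -> `|partial1of2 f x t| <= `|h t|.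
  rewrite /= in_itv/= -ler_norml => t1; rewrite p1E !normrM.
  rewrite mulrAC ler_piMl// mulr_ile1//.
  by rewrite ler_norml cos_geN1 cos_le1.
apply: DeriveDef.
  apply: (@derivable_under_integral R _ _ lebesgue_measure f _ _ l (l - 1) (l + 1) lI) iG _ => //.
  by move=> x t _; exact: fG.
rewrite -derive1E.
rewrite (@differentiation_under_integral R _ _ lebesgue_measure f _ _ l (l - 1) (l + 1) lI _ _ _ _ iG)//; last first.
  by move=> x t _; exact: fG.
by under eq_Rintegral do rewrite p1E.
Qed.

End oscillatory.

Section ball_weight.
Variables (R : realType) (n : nat).
Implicit Types (x l t : R).

(** For |t| <= 1, up to the volume of the unit ball of R^n, the volume of the slice at height t of
    the unit ball of R^(n+1). *)
Definition ball_weight t : R := Num.sqrt (1 - t ^+ 2) ^+ n.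

End ball_weight.
Arguments ball_weight {R} n t.

Lemma is_derive_pow (R : realType) (f : R -> R) (x a : R) m :
  is_derive x (1 : R) f a ->
  is_derive x (1 : R) (fun t => f t ^+ m) (m%:R * f x ^+ m.-1 * a).
Proof.
move=> h; rewrite (_ : (fun t => _) = (f ^+ m)); last by apply/funext => t; rewrite exprfctE.
exact: is_deriveX.
Qed.

Lemma is_derive_add (R : realType) (f g : R -> R) (x a b : R) :
  is_derive x (1 : R) f a -> is_derive x (1 : R) g b ->
  is_derive x (1 : R) (fun t => f t + g t) (a + b).
Proof. by move=> hf hg; exact: is_deriveD. Qed.

Section decay.
Variables (R : realType) (n : nat).
Implicit Types (x l t : R).

Lemma continuous_ball_weight k : continuous (@ball_weight R k).
Proof.
have cs : continuous (fun t : R => Num.sqrt (1 - t ^+ 2)).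
  move=> t; apply: continuous_comp; last exact: sqrt_continuous.
  by apply: cvgB; [exact: cvg_cst|exact: exprn_continuous].
move=> t; apply: (@continuous_comp _ _ _ (fun t : R => Num.sqrt (1 - t ^+ 2)) (fun y => y ^+ k)).
  exact: cs.
exact: exprn_continuous.
Qed.

Lemma is_derive_ball_weight t : `|t| < 1 ->
  is_derive t (1 : R) (ball_weight n.+2) (- (n.+2%:R * (t * ball_weight n t))).
Proof.
rewrite ltr_norml => /andP[t1 t2].
have s0 : 0 < 1 - t ^+ 2 by nra.
have dq : is_derive t (1 : R) (fun t : R => 1 - t ^+ 2) (- (2 * t)).
  have := is_deriveB (is_derive_cst (1 : R) t 1) (is_derive_pow 2 (is_derive_id t (1 : R))).
  by move=> h; apply: (is_derive_eq h); rewrite sub0r /= expr1 /GRing.scale/= mulr1.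
have ds := is_derive_chain (g := fun t : R => 1 - t ^+ 2) (is_derive1_sqrt s0) dq.
have h := is_derive_pow n.+2 ds.
apply: (is_derive_eq h); rewrite /ball_weight /GRing.scale/=.
set s := Num.sqrt _; have sn : s != 0 by rewrite gt_eqF// sqrtr_gt0.
by rewrite exprS; field.
Qed.

(** The weight of index n + 2 vanishes at both ends, which kills the boundary terms, and its
    derivative contains the weight of index n, continuous up to the ends. *)
Lemma cos_int_parts l : l != 0 ->
  cos_int (ball_weight n.+2) l =
  n.+2%:R / l * sin_int (fun t => t * ball_weight n t) l.
Proof.
move=> l0.
pose G t := l^-1 * sin (l * t).
have dG t : is_derive t (1 : R) G (cos (l * t)).
  have dm : is_derive t (1 : R) (fun t => l * t) l.
    have h := is_derive_mul (is_derive_cst l t 1) (is_derive_id t (1 : R)).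
    by apply: (is_derive_eq h); rewrite /cst; ring.
  have h := is_derive_mul (is_derive_cst l^-1 t 1) 
    (is_derive_chain (g := fun t : R => l * t) (is_derive_sin (l * t)) dm).
  by apply: (is_derive_eq h); rewrite /cst; field.
have cG : continuous G.
  by apply: continuous_mul; [move=> t; exact: cvg_cst|exact: continuous_sin_mul].
have cw := @continuous_ball_weight.
have ctw : continuous (fun t => t * ball_weight n t).
  by apply: continuous_mul => // t; exact: cvg_id.
have cf : continuous (fun t : R => - (n.+2%:R * (t * ball_weight n t))).
  have c0 := @continuous_mul _ (fun=> n.+2%:R) _ (@cst_continuous _ _ _) ctw.
  by move=> t; exact: cvgN (c0 t).
rewrite /cos_int (@Rintegration_by_parts R (ball_weight n.+2) G
  (fun t => - (n.+2%:R * (t * ball_weight n t))) (fun t => cos (l * t))).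
- rewrite /ball_weight sqrrN expr1n subrr sqrtr0 expr0n/= !mul0r subrr sub0r.
  rewrite -/(ball_weight n _).
  rewrite /sin_int -RintegralZl//; last first.
    by apply: integrable_m11; apply: continuous_mul => //; exact: continuous_sin_mul.
  rewrite -[LHS]mulN1r -[LHS]RintegralZl//; last first.
    by apply: integrable_m11; exact: continuous_mul.
  by apply: eq_Rintegral => t _; rewrite /G; field.
- by lra.
- exact: continuous_subspaceT.
- split; first by move=> t; rewrite in_itv/= -ltr_norml => t1; have [] := is_derive_ball_weight t1.
  + by apply: cvg_at_right_filter; exact: cw.
  + by apply: cvg_at_left_filter; exact: cw.
- move=> t; rewrite in_itv/= -ltr_norml => t1.
  by rewrite derive1E; have [] := is_derive_ball_weight t1.
- by apply: continuous_subspaceT; exact: continuous_cos_mul.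
- split; first by [].
  + by apply: cvg_at_right_filter; exact: cG.
  + by apply: cvg_at_left_filter; exact: cG.
- by move=> t _; rewrite derive1E; have [] := dG t.
Qed.

Let F := cos_int (@ball_weight R n).
Let S := sin_int (fun t : R => t * ball_weight n t).
Let g : R := n.+2%:R / 2.
(** As F' = -S, this is u' / l^g for u = l^g F. *)
Let H l := g * (F l / l) - S l.
(* F'' + (n+2)/l F' + F = 0, so u = l^g F satisfies u'' + (1 - k/l^2) u = 0 and E = u^2 + u'^2.
   Then E exp(k/l) is nonincreasing. *)
Let E l := l ^+ n.+2 * (F l ^+ 2 + H l ^+ 2).
Let k : R := g * (g - 1).

Let k0 : 0 <= k.
Proof.
have g1 : 1 <= g by rewrite /g -natr1 -natr1; have := ler0n R n; lra.
by rewrite /k; nra.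
Qed.

Let cw := @continuous_ball_weight n.

Let ctw : continuous (fun t => t * ball_weight n t).
Proof. by apply: continuous_mul => // t; exact: cvg_id. Qed.

Let dF l : is_derive l (1 : R) F (- S l).
Proof. exact: is_derive_cos_int. Qed.

(** Write t^2 = 1 - (1 - t^2): the second part carries the weight of index n + 2, and
    [cos_int_parts] turns it back into S. With F' = -S this is the differential equation of F. *)
Let dS l : 0 < l -> is_derive l (1 : R) S (F l - n.+2%:R / l * S l).
Proof.
move=> l0; apply: (is_derive_eq (is_derive_sin_int l ctw)).
rewrite /S -cos_int_parts ?gt_eqF// /F /cos_int -RintegralB//; last 2 first.
- by apply: integrable_m11; apply: continuous_mul => //; exact: continuous_cos_mul.
- apply: integrable_m11; apply: continuous_mul; last exact: continuous_cos_mul.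
  exact: continuous_ball_weight.
apply: eq_Rintegral => t; rewrite mem_setE in_itv/= => /andP[t1 t2].
rewrite /ball_weight !exprS; set s := Num.sqrt _.
have -> : s * (s * s ^+ n) = (1 - t ^+ 2) * s ^+ n.
  by rewrite mulrA -expr2 sqr_sqrtr//; nra.
by ring.
Qed.

Let dV l : 0 < l -> is_derive l (1 : R) (fun l => l^-1) (- l ^- 2).
Proof.
move=> l0; have l_neq0 : id l != 0 by rewrite gt_eqF.
have h := is_deriveV l_neq0 (is_derive_id l (1 : R)).
by apply: (is_derive_eq h); rewrite /GRing.scale/= mulr1.
Qed.

Let dH l : 0 < l -> is_derive l (1 : R) H
  (- F l + g / l * S l - g * F l / l ^+ 2).
Proof.
move=> l0.
have h := is_deriveB (is_derive_mul (is_derive_cst g l 1) (is_derive_mul (dF l) (dV l0))) (dS l0).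
apply: (is_derive_eq h); rewrite /cst /g; field.
by rewrite gt_eqF.
Qed.

Let dE l : 0 < l -> is_derive l (1 : R) E (2 * k * l ^+ n * F l * H l).
Proof.
move=> l0.
have h := is_derive_mul (is_derive_pow n.+2 (is_derive_id l (1 : R)))
  (is_derive_add (is_derive_pow 2 (dF l)) (is_derive_pow 2 (dH l0))).
apply: (is_derive_eq h); rewrite /GRing.scale/= !exprS.
have -> : S l = g * (F l / l) - H l by rewrite /H; ring.
rewrite /k /g; set m : R := n.+2%:R; set y := l ^+ n; set a := H l; set b := F l.
rewrite /= -/a -/b; field.
by rewrite gt_eqF.
Qed.

Let J l := E l * expR (k / l).

(** The factor exp(k/l) contributes -(k/l^2) E, which completes 2 F H in E' to the square -(F -
    H)^2. *)
Let dJ l : 0 < l -> is_derive l (1 : R) J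
  (- (expR (k / l) * (k * l ^+ n * (F l - H l) ^+ 2))).
Proof.
move=> l0.
have h := is_derive_mul (dE l0) (is_derive_chain (g := fun l => k / l) (is_derive_expR (k / l))
  (is_derive_mul (is_derive_cst k l 1) (dV l0))).
apply: (is_derive_eq h); rewrite /cst/= /E !exprS.
by field; rewrite gt_eqF.
Qed.

(** For l >= 1 this is the monotonicity of J, since exp(k/l) >= 1. For l < 1 the power of l is at
    most 1 and |F| is at most the integral of the weight. *)
Lemma cos_int_decay : exists2 C : R, 0 < C & forall l, 0 < l ->
  l ^+ n.+2 * cos_int (ball_weight n) l ^+ 2 <= C.
Proof.
have dJ1 l : 1 <= l -> J l <= J 1.
  move=> l1; apply: (@ler0_derive1_nincry R J 1) => //.
  - by move=> x; rewrite in_itv/= andbT => x1; have [] := dJ (lt_trans ltr01 x1).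
  - move=> x; rewrite in_itv/= andbT => x1; have x0 := lt_trans ltr01 x1.
    rewrite derive1E; have [_ ->] := dJ x0.
    have xn : 0 <= x ^+ n by rewrite exprn_ge0// ltW.
    by rewrite oppr_le0 mulr_ge0 ?expR_ge0// mulr_ge0 ?sqr_ge0// mulr_ge0.
  - apply: continuous_in_subspaceT => x; rewrite mem_setE in_itv/= andbT => x1.
    by apply/differentiable_continuous/derivable1_diffP; have [] := dJ (lt_le_trans ltr01 x1).
have cn (f : R -> R) : continuous f -> continuous (fun t => `|f t|).
  by move=> cf t; apply: (@continuous_comp _ _ _ f Num.norm); [exact: cf|exact: norm_continuous].
pose M : R := \int[lebesgue_measure]_(t in `[-1, 1]) `|ball_weight n t|.
have FM l : `|F l| <= M.
  apply: le_trans (le_normr_Rintegral _ _) _ => //.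
    apply: integrable_m11; apply: continuous_mul; last exact: continuous_cos_mul.
    exact: continuous_ball_weight.
  apply: le_Rintegral => //.
  - exact: integrable_m11 (cn _ (continuous_mul (@continuous_ball_weight n) (@continuous_cos_mul _ l))).
  - exact: integrable_m11 (cn _ (@continuous_ball_weight n)).
  - by move=> t _; rewrite normrM ler_piMr// ler_norml cos_geN1 cos_le1.
exists (J 1 + M ^+ 2 + 1).
  have E1 : 0 <= J 1 by rewrite mulr_ge0 ?expR_ge0// mulr_ge0 ?exprn_ge0// addr_ge0 ?sqr_ge0.
  by have := sqr_ge0 M; lra.
move=> l l0.
have E1 : 0 <= J 1 by rewrite mulr_ge0 ?expR_ge0// mulr_ge0 ?exprn_ge0// addr_ge0 ?sqr_ge0.
rewrite -/F; have [l1|l1] := leP 1 l.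
  apply: (@le_trans _ _ (J l)); last by have := dJ1 _ l1; have := sqr_ge0 M; lra.
  apply: (@le_trans _ _ (E l)).
    by rewrite /E ler_wpM2l ?exprn_ge0 ?(ltW l0)// lerDl sqr_ge0.
  rewrite /J ler_peMr//.
    by rewrite mulr_ge0 ?exprn_ge0 ?(ltW l0)// addr_ge0 ?sqr_ge0.
  by rewrite -expR0 ler_expR divr_ge0// ltW.
have : F l ^+ 2 <= M ^+ 2 by rewrite -[F l ^+ 2]real_normK ?num_real// ler_sqr ?nnegrE// (le_trans _ (FM l)).
have : l ^+ n.+2 <= 1 by rewrite exprn_ile1// ltW.
have := sqr_ge0 (F l); have : 0 <= l ^+ n.+2 by rewrite exprn_ge0// ltW.
by nra.
Qed.

End decay.

(** * Integrability and measurability of bounded trigonometric integrands *)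

Lemma integrable_bounded d (T : measurableType d) (R : realType)
    (mu : {measure set T -> \bar R}) (D : set T) (f : T -> R) (M : R) :
  measurable D -> (mu D < +oo)%E -> measurable_fun setT f ->
  (forall x, `|f x| <= M) -> mu.-integrable D (EFin \o f).
Proof.
move=> mD Doo mf fM; apply: measurable_bounded_integrable => //.
  exact: measurable_funTS.
by exists M; split; [exact: num_real|move=> y My x _; exact: le_trans (fM x) (ltW My)].
Qed.

Section integrable_EFin.
Context d (T : measurableType d) (R : realType) (mu : {measure set T -> \bar R}).
Variables (D : set T) (mD : measurable D).
Implicit Types f h : T -> R.

Lemma integrable_EFinZ f (c : R) : mu.-integrable D (EFin \o f) ->
  mu.-integrable D (EFin \o (fun x => c * f x)).
Proof.
move=> fi; rewrite (_ : _ \o _ = (fun x => c%:E * (EFin \o f) x)%E) //.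
exact: integrableZl.
Qed.

Lemma integrable_EFinD f h : mu.-integrable D (EFin \o f) ->
  mu.-integrable D (EFin \o h) -> mu.-integrable D (EFin \o (fun x => f x + h x)).
Proof.
move=> fi hi; rewrite (_ : _ \o _ = (fun x => (EFin \o f) x + (EFin \o h) x)%E) //.
exact: integrableD.
Qed.

Lemma integrable_EFin_sum (I : Type) (s : seq I) (f : I -> T -> R) :
  (forall i, mu.-integrable D (EFin \o f i)) ->
  mu.-integrable D (EFin \o (fun x => \sum_(i <- s) f i x)).
Proof.
move=> fi; rewrite (_ : _ \o _ = (fun x => \sum_(i <- s) (f i x)%:E)%E).
  by apply: integrable_sum => // i _; exact: fi.
by apply/funext => x; rewrite sumEFin.
Qed.

End integrable_EFin.

Lemma norm_cos_le1 (R : realType) (x : R) : `|cos x| <= 1.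
Proof. by rewrite ler_norml cos_geN1 cos_le1. Qed.

Lemma norm_sin_le1 (R : realType) (x : R) : `|sin x| <= 1.
Proof. by rewrite ler_norml sin_geN1 sin_le1. Qed.

Lemma dotv_cons (R : realType) n a b (x y : 'cV[R]_n) :
  dotv (cons_cV (a, x)) (cons_cV (b, y)) = a * b + dotv x y.
Proof.
rewrite /dotv big_ord_recl !cons_cV0; congr (_ + _).
by apply: eq_bigr => i _; rewrite !cons_cVS.
Qed.

Lemma measurable_dotv_l (R : realType) d (w : 'cV[R]_d) :
  measurable_fun setT (fun x : 'cV[R]_d => dotv w x).
Proof.
apply: measurable_sum => i.
by apply: measurable_funM => //; exact: measurable_coord_cV.
Qed.

Lemma measurable_cos_comp d (T : measurableType d) (R : realType) (f : T -> R) :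
  measurable_fun setT f -> measurable_fun setT (fun x => cos (f x)).
Proof.
move=> mf; apply: measurableT_comp => //.
exact: (continuous_measurable_fun (@continuous_cos R)).
Qed.

Lemma measurable_sin_comp d (T : measurableType d) (R : realType) (f : T -> R) :
  measurable_fun setT f -> measurable_fun setT (fun x => sin (f x)).
Proof.
move=> mf; apply: measurableT_comp => //.
exact: (continuous_measurable_fun (@continuous_sin R)).
Qed.

(** * The Fourier transform of a ball, by slices and rotation *)

Section ball_fourier.
Variables (R : realType).

Definition cball d (r : R) : set 'cV[R]_d := [set x | dotv x x <= r ^+ 2].

Lemma measurable_cball d r : measurable (@cball d r).
Proof. exact: measurable_dotv_le. Qed.

Lemma lebesgue_cball d (r : R) : 0 <= r ->
  lebesgue_cV (@cball d r) = (unit_ball_volume d * r ^+ d)%:E.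
Proof.
rewrite le_eqVlt => /predU1P[<-|r0]; last first.
  by rewrite -(lebesgue_cV_ball 0 r0) /cball; under [in RHS]eq_set do rewrite subr0.
case: d => [|n].
  rewrite expr0 mulr1 -unit_ball_volumeE; congr (lebesgue_cV _).
  by apply/seteqP; split => x _; rewrite /cball/= /dotv big_ord0 ?sqr_ge0.
rewrite exprS mul0r mulr0 -[RHS](lebesgue_cV_sphere (0 : 'cV[R]_n.+1) 0).
congr (lebesgue_cV _); apply/seteqP; rewrite /cball; split => x /=; rewrite subr0 expr0n/=.
  by move=> x0; apply/eqP; rewrite eq_le x0 dotv_ge0.
by move=> ->.
Qed.

Lemma lebesgue_cball_lty d (r : R) : 0 <= r -> (lebesgue_cV (@cball d r) < +oo)%E.
Proof. by move=> r0; rewrite lebesgue_cball// ltry. Qed.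

(** The summand 1 keeps the integrand nonnegative, so that Tonelli applies; it is removed in the
    next lemma. *)
Lemma slice_ball n (l : R) :
  \int[lebesgue_cV]_(x in @cball n.+1 1) (1 + cos (l * x ord0 ord0)) =
  unit_ball_volume n *
  \int[lebesgue_measure]_(t in `[-1, 1]) (ball_weight n t * (1 + cos (l * t))).
Proof.
have cc (u : R) : 0 <= 1 + cos u by have := cos_geN1 u; lra.
have mc : measurable_fun setT (fun t : R => 1 + cos (l * t)).
  by apply: measurable_funD => //; apply: measurable_cos_comp; exact: measurable_funM.
have cw : continuous (fun t : R => ball_weight n t * (1 + cos (l * t))).
  apply: continuous_mul; first exact: continuous_ball_weight.
  by move=> t; apply: cvgD; [exact: cvg_cst|exact: continuous_cos_mul].
rewrite -RintegralZl//; last exact: integrable_m11.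
congr fine; rewrite integral_mkcond.
have mf : measurable_fun setT ((fun x : 'cV[R]_n.+1 => (1 + cos (l * x ord0 ord0))%:E) \_ (cball 1)).
  apply/(measurable_restrictT _ _).1; first exact: measurable_cball.
  apply: measurable_funTS; apply/measurable_EFinP.
  exact: (measurableT_comp mc (measurable_coord_cV _)).
rewrite integral_cV_recl//; last first.
  by move=> x; rewrite /patch; case: ifP => // _; rewrite lee_fin.
rewrite [RHS]integral_mkcond; apply: eq_integral => t _.
have dE (x : 'cV[R]_n) : (cons_cV (t, x) \in cball 1) = (x \in [set x | dotv x x <= 1 - t ^+ 2]).
  by apply/idP/idP; rewrite !inE /cball/= dotv_cons expr1n -expr2 lerBrDl.
rewrite [in RHS]/patch; have -> : (t \in `[-1, 1]%classic) = (-1 <= t <= 1) by rewrite mem_setE in_itv.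
transitivity (\int[@lebesgue_cV R n]_x ((1 + cos (l * t))%:E *
    (\1_[set x : 'cV[R]_n | dotv x x <= 1 - t ^+ 2] x : R)%:E))%E.
  apply: eq_integral => x _; rewrite /patch dE cons_cV0 indicE.
  by case: ifP; rewrite ?mule1 ?mule0.
rewrite ge0_integralZl_EFin//; last first.
  by apply/measurable_EFinP; apply: measurable_indic; exact: measurable_dotv_le.
rewrite integral_indic//; last exact: measurable_dotv_le.
rewrite setIT; case: ifPn => t1.
  have h : 0 <= 1 - t ^+ 2 by case/andP : t1 => *; nra.
  rewrite -[in LHS](sqr_sqrtr h) [X in (_ * X)%E](lebesgue_cball n (sqrtr_ge0 _)).
  by rewrite -EFinM; congr (_%:E); rewrite /ball_weight; ring.
rewrite (_ : mkset _ = set0) ?measure0 ?mule0//.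
apply/seteqP; split=> x //= xt; exfalso; move: (dotv_ge0 x) t1.
by rewrite negb_and -!ltNge => x0 /orP[] ?; nra.
Qed.

Lemma cos_ball_axis n (l : R) :
  \int[lebesgue_cV]_(x in @cball n.+1 1) cos (l * x ord0 ord0) =
  unit_ball_volume n * cos_int (ball_weight n) l.
Proof.
have mb := @measurable_cball n.+1 1.
have bo := @lebesgue_cball_lty n.+1 1 ler01.
have ic (u : R) : lebesgue_cV.-integrable (@cball n.+1 1)
    (EFin \o (fun x : 'cV[R]_n.+1 => cos (u * x ord0 ord0))).
  apply: (@integrable_bounded _ _ _ _ _ _ 1) => //; last by move=> x; exact: norm_cos_le1.
  by apply: measurable_cos_comp; apply: measurable_funM => //; exact: measurable_coord_cV.
have i1 : lebesgue_cV.-integrable (@cball n.+1 1) (EFin \o (fun x : 'cV[R]_n.+1 => 1)).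
  by apply: (@integrable_bounded _ _ _ _ _ _ 1) => // x; rewrite normr1.
have cw (u : R) : continuous (fun t : R => ball_weight n t * cos (u * t)).
  by apply: continuous_mul; [exact: continuous_ball_weight|exact: continuous_cos_mul].
have iw (u : R) := integrable_m11 (cw u).
have iw1 := integrable_m11 (@continuous_ball_weight R n).
have key (u : R) : \int[lebesgue_cV]_(x in @cball n.+1 1) 1 +
    \int[lebesgue_cV]_(x in @cball n.+1 1) cos (u * x ord0 ord0) =
    unit_ball_volume n * (\int[lebesgue_measure]_(t in `[-1, 1]) ball_weight n t +
      cos_int (ball_weight n) u).
  rewrite -RintegralD// slice_ball; congr (_ * _).
  rewrite -RintegralD//; apply: eq_Rintegral => t _; ring.
(* At u = 0 the cosine is 1, so [key 0] is twice the identity for the constant 1, and half of it is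
   subtracted from [key l]. *)
have := key 0; rewrite /cos_int.
under [X in _ + X = _]eq_Rintegral do rewrite mul0r cos0.
under [X in _ = _ * (_ + X)]eq_Rintegral do rewrite mul0r cos0 mulr1.
have := key l; rewrite /cos_int; lra.
Qed.

End ball_fourier.

Section dotv_theory.
Variables (R : realType) (d : nat).
Implicit Types (x y u v w : 'cV[R]_d) (c : R).

Lemma dotvC u v : dotv u v = dotv v u.
Proof. by apply: eq_bigr => i _; rewrite mulrC. Qed.

Lemma dotvDr u v w : dotv u (v + w) = dotv u v + dotv u w.
Proof. by rewrite -big_split/=; apply: eq_bigr => i _; rewrite !mxE mulrDr. Qed.

Lemma dotvZr c u v : dotv u (c *: v) = c * dotv u v.
Proof. by rewrite mulr_sumr; apply: eq_bigr => i _; rewrite !mxE mulrCA. Qed.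

Lemma dotvNr u v : dotv u (- v) = - dotv u v.
Proof. by rewrite -scaleN1r dotvZr mulN1r. Qed.

Lemma dotvBr u v w : dotv u (v - w) = dotv u v - dotv u w.
Proof. by rewrite dotvDr dotvNr. Qed.

Lemma dotvDl u v w : dotv (u + v) w = dotv u w + dotv v w.
Proof. by rewrite dotvC dotvDr ![dotv w _]dotvC. Qed.

Lemma dotvZl c u v : dotv (c *: u) v = c * dotv u v.
Proof. by rewrite dotvC dotvZr dotvC. Qed.

Lemma dotvNl u v : dotv (- u) v = - dotv u v.
Proof. by rewrite dotvC dotvNr dotvC. Qed.

Lemma dotvBl u v w : dotv (u - v) w = dotv u w - dotv v w.
Proof. by rewrite dotvDl dotvNl. Qed.

Lemma dotv0r u : dotv u 0 = 0.
Proof. by apply: big1 => i _; rewrite mxE mulr0. Qed.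

Lemma dotv0l u : dotv 0 u = 0.
Proof. by rewrite dotvC dotv0r. Qed.

Lemma dotv_mx u v : u^T *m v = (dotv u v)%:M.
Proof.
apply/matrixP => i j; rewrite !mxE (ord1 i) (ord1 j) eqxx mulr1n.
by apply: eq_bigr => k _; rewrite mxE.
Qed.

Lemma dotv_eq0 u : (dotv u u == 0) = (u == 0).
Proof.
apply/eqP/eqP => [u0|->]; last exact: dotv0r.
apply/matrixP => i j; rewrite (ord1 j) mxE; apply/eqP; rewrite -sqrf_eq0 expr2.
have /psumr_eq0P : forall i : 'I_d, true -> 0 <= u i ord0 * u i ord0.
  by move=> k _; rewrite -expr2 sqr_ge0.
by move=> /(_ u0 i isT)/eqP.
Qed.

Lemma enorm_eq0 u : (enorm u == 0) = (u == 0).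
Proof. by rewrite sqrtr_eq0 -dotv_eq0 eq_le dotv_ge0 andbT. Qed.

Lemma enorm_gt0 u : (0 < enorm u) = (u != 0).
Proof. by rewrite lt_def enorm_ge0 andbT enorm_eq0. Qed.

Lemma dotv_mulmx_trmx (B : 'M[R]_d) u v : dotv u (B *m v) = dotv (B^T *m u) v.
Proof.
have : (dotv u (B *m v))%:M = (dotv (B^T *m u) v)%:M :> 'M[R]_1.
  by rewrite -!dotv_mx trmx_mul trmxK mulmxA.
by move=> /matrixP /(_ ord0 ord0); rewrite !mxE eqxx !mulr1n.
Qed.

End dotv_theory.

Section ball_fourier_decay.
Variables (R : realType) (n : nat).
Implicit Types (x xi : 'cV[R]_n.+1).

(* Householder reflection exchanging [xi] with [enorm xi] times the first basis vector. *)
Lemma reflection_to_axis xi : exists O : 'M[R]_n.+1,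
  [/\ O \in unitmx, `|\det O| = 1, forall x, dotv (O *m x) (O *m x) = dotv x x &
      forall x, dotv xi (O *m x) = enorm xi * x ord0 ord0].
Proof.
pose e : 'cV[R]_n.+1 := delta_mx ord0 ord0.
have ex x : dotv e x = x ord0 ord0.
  rewrite /dotv (bigD1 ord0)//= big1 ?addr0 ?mxE ?eqxx ?mul1r// => i /negbTE i0.
  by rewrite mxE i0 mul0r.
have ee : dotv e e = 1 by rewrite ex mxE !eqxx.
have [v vdef] : exists v, v = xi - enorm xi *: e by exists (xi - enorm xi *: e).
(* If [xi] already lies on the positive axis, or is 0, there is no mirror direction and the identity
   serves. *)
have [v0|v0] := eqVneq v 0.
  exists 1%:M; rewrite unitmx1 det1 normr1; split=> // x; rewrite mul1mx//.
  by rewrite -ex -dotvZl; move/eqP: v0; rewrite vdef subr_eq0 => /eqP <-.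
have dv : dotv v v != 0 by rewrite dotv_eq0.
pose c := 2 / dotv v v.
pose O : 'M[R]_n.+1 := 1%:M - c *: (v *m v^T).
have OE x : O *m x = x - (c * dotv v x) *: v.
  by rewrite mulmxBl mul1mx -scalemxAl -mulmxA dotv_mx mul_mx_scalar scalerA.
have Oe x : dotv (O *m x) (O *m x) = dotv x x.
  rewrite OE !(dotvBl, dotvBr, dotvZl, dotvZr) [dotv x v]dotvC /c; field.
  exact: dv.
have OO x : O *m (O *m x) = x.
  rewrite !OE dotvBr dotvZr; set a := dotv v x.
  have -> : c * (a - c * a * dotv v v) = - (c * a) by rewrite /c; field; exact: dv.
  by rewrite scaleNr opprK subrK.
have O2 : O *m O = 1%:M.
  apply/matrixP => i j.
  have := OO (delta_mx j ord0) => /matrixP /(_ i ord0).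
  by rewrite mulmxA -colE !mxE eqxx andbT.
have dO : `|\det O| = 1.
  apply/eqP; rewrite -(@pexpr_eq1 _ _ 2)// -normrX expr2 -det_mulmx O2 det1.
  by rewrite normr1.
exists O; split => //.
  by rewrite unitmxE unitfE -normr_eq0 dO oner_eq0.
move=> x; rewrite OE dotvBr dotvZr.
(* Both exchanged vectors have the same length, so the reflection in the hyperplane orthogonal to
   their difference swaps them. *)
have vE : dotv v v = 2 * dotv xi v.
  rewrite vdef !(dotvBl, dotvBr, dotvZl, dotvZr) ee [dotv e xi]dotvC.
  by rewrite -(enorm_sqr xi); ring.
have xv : dotv xi v != 0 by move: dv; rewrite vE mulf_eq0 pnatr_eq0.
have -> : c * dotv v x * dotv xi v = dotv v x by rewrite /c vE; field.
by rewrite -dotvBl vdef opprB addrCA subrr addr0 dotvZl ex.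
Qed.

Lemma cos_ball_radial (xi : 'cV[R]_n.+1) :
  \int[lebesgue_cV]_(x in cball 1) cos (2 * pi * dotv xi x) =
  unit_ball_volume n * cos_int (ball_weight n) (2 * pi * enorm xi).
Proof.
have [Q [uO detO Oe Ox]] := reflection_to_axis xi.
rewrite -cos_ball_axis -(Rintegral_affine 0 uO); last 2 first.
- exact: measurable_cball.
- apply: measurable_funTS; apply: measurable_cos_comp; apply: measurable_funM => //.
  exact: measurable_dotv_l.
rewrite detO mul1r (_ : mkset _ = @cball R n.+1 1); last first.
  by apply/seteqP; split=> x; rewrite /cball/= addr0 Oe.
by apply: eq_Rintegral => x _; rewrite addr0 Ox mulrA.
Qed.

Lemma cos_ball_scale (xi : 'cV[R]_n.+1) (r : R) : 0 < r ->
  \int[lebesgue_cV]_(x in cball r) cos (2 * pi * dotv xi x) =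
  r ^+ n.+1 * \int[lebesgue_cV]_(x in cball 1) cos (2 * pi * dotv (r *: xi) x).
Proof.
move=> r0.
have u : (r%:M : 'M[R]_n.+1) \in unitmx.
  by rewrite unitmxE det_scalar unitfE expf_neq0 ?gt_eqF.
rewrite -(Rintegral_affine 0 u); last 2 first.
- exact: measurable_cball.
- apply: measurable_funTS; apply: measurable_cos_comp; apply: measurable_funM => //.
  exact: measurable_dotv_l.
rewrite det_scalar normrX gtr0_norm//; congr (_ * _).
rewrite (_ : mkset _ = @cball R n.+1 1); last first.
  apply/seteqP; split=> x; rewrite /cball/= addr0 mul_scalar_mx dotvZl dotvZr mulrA -expr2 expr1n.
    by rewrite ger_pMr// exprn_gt0.
  by rewrite ger_pMr// exprn_gt0.
by apply: eq_Rintegral => x _; rewrite addr0 mul_scalar_mx dotvZl dotvZr.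
Qed.

Lemma enormZ (r : R) (xi : 'cV[R]_n.+1) : 0 <= r -> enorm (r *: xi) = r * enorm xi.
Proof.
move=> r0; rewrite /enorm dotvZl dotvZr mulrA -expr2 sqrtrM ?sqr_ge0//.
by rewrite sqrtr_sqr ger0_norm.
Qed.

(** Scaling to the unit ball costs r^(2(n+1)), and the decay at 2 pi r |xi| gives back r^(-n-2),
    which leaves r^n. *)
Lemma cos_ball_decay : exists2 C : R, 0 < C & forall (xi : 'cV[R]_n.+1) (r : R),
  xi != 0 -> 0 < r ->
  (\int[lebesgue_cV]_(x in cball r) cos (2 * pi * dotv xi x)) ^+ 2 <=
  C * r ^+ n / enorm xi ^+ n.+2.
Proof.
have [C C0 hC] := @cos_int_decay R n.
exists (unit_ball_volume n ^+ 2 * C / (2 * pi) ^+ n.+2).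
  by apply: divr_gt0; apply: exprn_gt0 || (apply: mulr_gt0 => //; apply: exprn_gt0);
    rewrite ?mulr_gt0 ?pi_gt0 ?unit_ball_volume_gt0.
move=> xi r xi0 r0; rewrite cos_ball_scale// cos_ball_radial enormZ ?(ltW r0)//.
have e0 : 0 < enorm xi by rewrite enorm_gt0.
have := hC (2 * pi * (r * enorm xi)).
rewrite !mulr_gt0 ?pi_gt0// => /(_ isT).
set F := cos_int _ _ => hF.
rewrite ler_pdivlMr ?exprn_gt0//.
rewrite -(@ler_pM2r _ ((2 * pi) ^+ n.+2 * r ^+ n.+2)); last first.
  by rewrite mulr_gt0 ?exprn_gt0 ?mulr_gt0 ?pi_gt0.
have p0 : (2 * pi : R) != 0 by rewrite mulf_neq0 ?gt_eqF ?pi_gt0.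
rewrite [leRHS](_ : _ = r ^+ n.+1 ^+ 2 * unit_ball_volume n ^+ 2 * C); last first.
  rewrite [r ^+ n.+2]exprS [r ^+ n.+1]exprS.
  have P0 : ((2 * pi) ^+ n.+2 : R) != 0 by rewrite expf_neq0.
  by move: P0; move: ((2 * pi) ^+ n.+2) (r ^+ n) => P y P0; field.
rewrite [leLHS](_ : _ = r ^+ n.+1 ^+ 2 * unit_ball_volume n ^+ 2 *
   ((2 * pi * (r * enorm xi)) ^+ n.+2 * F ^+ 2)); last by rewrite !exprMn; ring.
by rewrite ler_wpM2l// mulr_ge0 ?sqr_ge0.
Qed.

End ball_fourier_decay.

(** The integrand is odd under x -> -x, which preserves the ball. *)
Lemma sin_ball_eq0 (R : realType) n (xi : 'cV[R]_n) (r : R) : 0 <= r ->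
  \int[lebesgue_cV]_(x in cball r) sin (2 * pi * dotv xi x) = 0.
Proof.
move=> r0.
have u : ((-1)%:M : 'M[R]_n) \in unitmx.
  by rewrite unitmxE det_scalar unitrX// unitrN1.
have mb := @measurable_cball R n r.
have ms : measurable_fun setT (fun x => sin (2 * pi * dotv xi x)).
  by apply: measurable_sin_comp; apply: measurable_funM => //; exact: measurable_dotv_l.
have := Rintegral_affine 0 u mb (measurable_funTS ms).
rewrite det_scalar normrX normrN1 expr1n mul1r (_ : mkset _ = @cball R n r); last first.
  by apply/seteqP; split=> x; rewrite /cball/= addr0 mul_scalar_mx scaleN1r dotvNl dotvNr opprK.
under eq_Rintegral do rewrite addr0 mul_scalar_mx scaleN1r dotvNr mulrN sinN -mulN1r.
rewrite RintegralZl//; first by lra.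
apply: (@integrable_bounded _ _ _ _ _ _ 1) => //; first exact: lebesgue_cball_lty.
by move=> x; exact: norm_sin_le1.
Qed.

Lemma Rintegral_sum d (T : measurableType d) (R : realType)
    (mu : {measure set T -> \bar R}) (D : set T) (I : Type) (s : seq I)
    (f : I -> T -> R) : measurable D ->
  (forall i, mu.-integrable D (EFin \o f i)) ->
  \int[mu]_(x in D) (\sum_(i <- s) f i x) = \sum_(i <- s) \int[mu]_(x in D) f i x.
Proof.
move=> mD fi; elim: s => [|i s IH].
  by rewrite big_nil; under eq_Rintegral do rewrite big_nil; rewrite Rintegral_cst// mul0r.
rewrite big_cons -IH -RintegralD//; first by under eq_Rintegral do rewrite big_cons.
rewrite (_ : _ \o _ = (fun x => \sum_(j <- s) (f j x)%:E)%E).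
  by apply: (integrable_sum mD); move=> j _; exact: fi.
by apply/funext => x /=; rewrite sumEFin.
Qed.

Lemma sinD2piz (R : realType) (x : R) (m : int) : sin (x + m%:~R * (2 * pi)) = sin x.
Proof.
have pos (y : R) n : sin (y + n%:R * (2 * pi)) = sin y.
  by rewrite mulrC mulr_natr (mulrC 2) mulr_natr; exact: (periodicn (@sinD2pi R)).
case: (intP m) => [|n|n]; first by rewrite mul0r addr0.
  exact: pos.
by rewrite mulrNz mulNr -[in RHS](subrK (n.+1%:R * (2 * pi)) x) pos.
Qed.

Lemma cosD2piz (R : realType) (x : R) (m : int) : cos (x + m%:~R * (2 * pi)) = cos x.
Proof.
have pos (y : R) n : cos (y + n%:R * (2 * pi)) = cos y.
  by rewrite mulrC mulr_natr (mulrC 2) mulr_natr; exact: (periodicn (@cosD2pi R)).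
case: (intP m) => [|n|n]; first by rewrite mul0r addr0.
  exact: pos.
by rewrite mulrNz mulNr -[in RHS](subrK (n.+1%:R * (2 * pi)) x) pos.
Qed.

(** * Fejer means and a Parseval bound on the unit cube *)

Section cube.
Variable R : realType.

Definition cube d : set 'cV[R]_d := [set a | forall i, 0 <= a i ord0 < 1].
Arguments cube : clear implicits.

Let I01 : set R := `[0, 1[%classic.

Lemma cubeE d : cube d = [set a : 'cV[R]_d | forall i, I01 (a i ord0)].
Proof. by apply/seteqP; split=> a ha i; have := ha i; rewrite /I01/= in_itv. Qed.

Lemma measurable_cube d : measurable (cube d).
Proof.
rewrite cubeE (_ : mkset _ = \big[setI/setT]_(i < d)
    ((fun x : 'cV[R]_d => x i ord0) @^-1` I01)).
  apply: bigsetI_measurable => i _; rewrite -[X in measurable X]setTI.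
  by apply: (measurable_coord_cV i) => //; exact: measurable_itv.
apply/seteqP; split=> x; rewrite -bigcap_seq; first by move=> Bx i _; exact: Bx.
by move=> Bx i; apply: (Bx i); rewrite /= mem_index_enum.
Qed.

Lemma lebesgue_cube d : lebesgue_cV (cube d) = 1%E.
Proof.
rewrite cubeE (lebesgue_cV_rectangle (fun i => measurable_itv _)) big1// => i _.
by rewrite lebesgue_measure_itv/= lte_fin ltr01 -EFinB subr0.
Qed.

Lemma lebesgue_cube_lty d : (lebesgue_cV (cube d) < +oo)%E.
Proof. by rewrite lebesgue_cube ltry. Qed.

Lemma integrable_cube d (f : 'cV[R]_d -> R) (M : R) : measurable_fun setT f ->
  (forall x, `|f x| <= M) -> lebesgue_cV.-integrable (cube d) (EFin \o f).
Proof.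
move=> mf fM; apply: (integrable_bounded (M := M)) => //; first exact: measurable_cube.
exact: lebesgue_cube_lty.
Qed.

Lemma integral_cube_prod d (f : 'I_d -> R -> R) :
  (forall i, measurable_fun setT (f i)) -> (forall i x, 0 <= f i x) ->
  (\int[lebesgue_cV]_(x in cube d) (\prod_(i < d) f i (x i ord0))%:E =
   \prod_(i < d) \int[lebesgue_measure]_(a in `[0%R, 1%R[) (f i a)%:E)%E.
Proof.
move=> mf f0; rewrite integral_mkcond.
transitivity (\int[lebesgue_cV]_x
    (\prod_(i < d) (f i (x i ord0) * \1_I01 (x i ord0)))%:E)%E.
  apply: eq_integral => x _; rewrite /patch; case: ifPn; rewrite ?inE ?notin_setE => hx.
    congr (_%:E); apply: eq_bigr => i _; rewrite indicE mem_set ?mulr1//.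
    by have := hx i; rewrite /I01/= in_itv.
  have [i hi] : exists i, ~~ (0 <= x i ord0 < 1).
    apply: contrapT => nh; apply: hx => i; apply: contrapT => hi.
    by apply: nh; exists i; apply/negP.
  rewrite (bigD1 i)//= [\1_I01 _]indicE memNset ?mulr0 ?mul0r//.
  by rewrite /I01/= in_itv/=; apply/negP.
rewrite (integral_cV_prod (f := fun i t => f i t * \1_I01 t)); last 2 first.
- by move=> i; apply: measurable_funM => //; apply: measurable_indic; exact: measurable_itv.
- by move=> i x; rewrite mulr_ge0.
apply: eq_bigr => i _; rewrite [RHS]integral_mkcond; apply: eq_integral => a _.
by rewrite /patch indicE /I01; case: ifP; rewrite ?mulr1 ?mulr0.
Qed.

(** In the induction on the dimension the amplitude e is the factor (m' == 0) produced by the other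
    coordinates, and the summand 1 is the one that keeps the integrand nonnegative. *)
Lemma integral_cos_period (m : int) (e th : R) :
  \int[lebesgue_measure]_(t in `[0, 1[) (1 + e * cos (2 * pi * (m%:~R * t) + th)) =
  1 + e * ((m == 0)%:R * cos th).
Proof.
have ct : continuous (fun t : R => 1 + e * cos (2 * pi * (m%:~R * t) + th)).
  move=> t; apply: cvgD; first exact: cvg_cst.
  apply: cvgMr; apply: continuous_comp; last exact: continuous_cos.
  apply: cvgD; last exact: cvg_cst.
  by apply: cvgMr; exact: mulrl_continuous.
have ic : lebesgue_measure.-integrable `[0, 1] (EFin \o (fun t : R => 1 + e * cos (2 * pi * (m%:~R * t) + th))).
  by apply: continuous_compact_integrable; [exact: segment_compact|exact: continuous_subspaceT].
rewrite Rintegral_itv_bndo_bndc; last first.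
  by apply: integrableS ic => //; apply: subset_itvl; rewrite bnd_simp.
have [->|m0] := eqVneq m 0.
  under eq_Rintegral do rewrite mul0r mulr0 add0r.
  rewrite mul1r Rintegral_cst//= lebesgue_measure_itv/= lte_fin ltr01.
  by rewrite -EFinB subr0 mulr1.
rewrite mul0r mulr0 addr0.
have k0 : (2 * pi * m%:~R : R) != 0.
  by rewrite !mulf_eq0 intr_eq0 (negbTE m0) orbF pnatr_eq0/= gt_eqF ?pi_gt0.
pose G t : R := t + e * (sin (2 * pi * (m%:~R * t) + th) / (2 * pi * m%:~R)).
have dG t : is_derive t (1 : R) G (1 + e * cos (2 * pi * (m%:~R * t) + th)).
  have dl : is_derive t (1 : R) (fun t : R => 2 * pi * (m%:~R * t) + th) (2 * pi * m%:~R).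
    have h := is_derive_add (is_derive_mul (is_derive_cst (2 * pi : R) t 1)
      (is_derive_mul (is_derive_cst (m%:~R : R) t 1) (is_derive_id t (1 : R)))) (is_derive_cst th t 1).
    by apply: (is_derive_eq h); rewrite /cst; ring.
  have h := is_derive_add (is_derive_id t (1 : R)) (is_derive_mul (is_derive_cst e t 1)
    (is_derive_mul (is_derive_chain (g := fun t : R => 2 * pi * (m%:~R * t) + th)
      (is_derive_sin _) dl) (is_derive_cst (2 * pi * m%:~R)^-1 t 1))).
  apply: (is_derive_eq h); rewrite /cst !mulr0 !add0r addr0; congr (_ + _ * _).
  by move: k0; set K := 2 * pi * m%:~R; move=> k0; field.
have cG : continuous G.
  by move=> t; apply/differentiable_continuous/derivable1_diffP; have [] := dG t.
rewrite /Rintegral (@continuous_FTC2 R _ G)//.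
- rewrite /= /G mulr0 mulr1 mulr0 add0r.
  rewrite [_ * _ + th](_ : _ = th + m%:~R * (2 * pi)); last by ring.
  by rewrite sinD2piz add0r; ring.
- exact: continuous_subspaceT.
- split => //.
  + by apply: cvg_at_right_filter; exact: cG.
  + by apply: cvg_at_left_filter; exact: cG.
- by move=> t _; rewrite derive1E; have [] := dG t.
Qed.

Lemma lebesgue_setM_itv_lty : (@lebesgue_measure R `[0%R, 1%R[%classic < +oo)%E.
Proof. by rewrite lebesgue_measure_itv/= lte_fin ltr01 ltry. Qed.

Definition phase d (m : 'cV[int]_d) (a : 'cV[R]_d) : R :=
  2 * pi * dotv (map_mx intr m) a.

Lemma measurable_phase d (m : 'cV[int]_d) : measurable_fun setT (phase m).
Proof. by apply: measurable_funM => //; exact: measurable_dotv_l. Qed.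

(** The free shift [th] carries the induction: with the first coordinate fixed, its phase is
    absorbed into the shift. *)
Lemma ge0_integral_cube_phase d (m : 'cV[int]_d) (th : R) :
  (\int[lebesgue_cV]_(a in cube d) (1 + cos (phase m a + th))%:E =
   (1 + (m == 0)%:R * cos th)%:E)%E.
Proof.
have cc (u : R) : 0 <= 1 + cos u by have := cos_geN1 u; lra.
elim: d m th => [|n IH] m th.
  rewrite (_ : m = 0); last by apply/matrixP => -[].
  rewrite eqxx mul1r (eq_integral (cst (1 + cos th)%:E)).
    apply: (etrans (integral_cst _ (@measurable_cube 0) _)).
    by rewrite -[RHS]mule1; congr (_ * _)%E; exact: lebesgue_cube.
  by move=> a _; rewrite /phase /dotv big_ord0 mulr0 add0r.
have [m0 [m' mE]] : exists m0 m', m = col_mx (m0%:M : 'M[int]_1) m'.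
  exists (m ord0 ord0), (dsubmx (m : 'M[int]_(1 + n, 1))).
  apply: (etrans (esym (@vsubmxK _ 1 n 1 m))).
  rewrite [usubmx _]mx11_scalar !mxE; congr (col_mx ((m _ _)%:M) _).
  exact/val_inj.
have phE a x : phase m (cons_cV (a, x)) + th = phase m' x + (2 * pi * (m0%:~R * a) + th).
  rewrite /phase.
  have -> : map_mx intr m = cons_cV (m0%:~R, map_mx intr m') :> 'cV[R]_n.+1.
    rewrite mE; apply: (etrans (@map_col_mx _ _ intr 1 n 1 _ _)).
    by rewrite /cons_cV/= map_scalar_mx.
  by rewrite dotv_cons; ring.
have m_eq0 : (m == 0) = (m0 == 0) && (m' == 0).
  rewrite mE; apply: (etrans (@col_mx_eq0 _ 1 n 1 _ _)); congr andb.
  apply/eqP/eqP => [/matrixP/(_ ord0 ord0)|->]; last exact: raddf0.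
  by rewrite !mxE eqxx mulr1n.
rewrite integral_mkcond integral_cV_recl; last 2 first.
- apply/(measurable_restrictT _ _).1; first exact: measurable_cube.
  apply: measurable_funTS; apply/measurable_EFinP.
  apply: measurable_funD => //; apply: measurable_cos_comp.
  by apply: measurable_funD => //; exact: measurable_phase.
- by move=> x; rewrite /patch; case: ifP => // _; rewrite lee_fin.
have cons_cube a x : (cons_cV (a, x) \in cube n.+1) = (a \in I01) && (x \in cube n).
  apply/idP/andP => [|[]]; rewrite !inE /I01/= in_itv/= => h.
    by split; [have := h ord0; rewrite cons_cV0|move=> i; have := h (lift ord0 i); rewrite cons_cVS].
  by move=> h' i; have [j ->|->] := unliftP ord0 i; rewrite ?cons_cV0 ?cons_cVS.
transitivity (\int[lebesgue_measure]_(a in `[0%R, 1%R[)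
    (1 + (m' == 0)%:R * cos (2 * pi * (m0%:~R * a) + th))%:E)%E.
  rewrite [RHS]integral_mkcond; apply: eq_integral => a _.
  rewrite {2}/patch -/I01; case: ifPn => aI; last first.
    by apply: integral0_eq => x _; rewrite /patch cons_cube (negbTE aI).
  rewrite -IH [RHS]integral_mkcond; apply: eq_integral => x _.
  by rewrite /patch cons_cube aI/= phE.
have fi : lebesgue_measure.-integrable (`[0, 1[%classic : set R)
  (EFin \o (fun a : R => 1 + (m' == 0)%:R * cos (2 * pi * (m0%:~R * a) + th))).
  apply: (integrable_bounded (M := 2)) => //; first exact: lebesgue_setM_itv_lty.
    apply: measurable_funD => //; apply: measurable_funM => //; apply: measurable_cos_comp.
    by apply: measurable_funD => //; do 2 apply: measurable_funM => //.
  move=> x; rewrite (le_trans (ler_normD _ _))// normr1 -natr1 addrC lerD2r normrM.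
  by rewrite mulr_ile1 ?norm_cos_le1// normr_nat; case: (m' == 0).
rewrite -[LHS]fineK; last by apply: (@integrable_fin_num _ _ _ _ _ _ _ fi); exact: measurable_itv.
congr (_%:E); apply: (etrans (integral_cos_period m0 _ th)).
by rewrite m_eq0 mulrA -natrM mulnb andbC.
Qed.

Lemma integral_cube_phase d (m : 'cV[int]_d) (th : R) :
  \int[lebesgue_cV]_(a in cube d) cos (phase m a + th) = (m == 0)%:R * cos th.
Proof.
have := ge0_integral_cube_phase m th => /(congr1 fine)/=.
rewrite -[LHS]/(\int[lebesgue_cV]_(a in cube d) (1 + cos (phase m a + th))).
rewrite RintegralD; [|exact: measurable_cube| |].
- rewrite Rintegral_cst; last exact: measurable_cube.
  by rewrite [X in 1 * X](_ : _ = 1) ?mulr1; [apply: addrI|rewrite [X in fine X]lebesgue_cube].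
- by apply: (integrable_cube (M := 1)) => // x; rewrite normr1.
- apply: (integrable_cube (M := 1)) => [|x]; last exact: norm_cos_le1.
  apply: measurable_cos_comp; apply: measurable_funD => //; exact: measurable_phase.
Qed.

End cube.
Arguments cube {R} d.

Section trigonometric_sums.
Variable R : realType.

Definition expi (t : R) : R[i] := Complex (cos t) (sin t).

Lemma expiD s t : expi (s + t) = expi s * expi t.
Proof.
by apply/eqP; rewrite eq_complex /= cosD sinD eqxx/= addrC [cos s * _]mulrC [sin s * _]mulrC.
Qed.

Definition sqn (z : R[i]) : R := let: Complex a b := z in a ^+ 2 + b ^+ 2.

Lemma sqnM z w : sqn (z * w) = sqn z * sqn w.
Proof. by case: z w => [a b] [c d]; rewrite /sqn/=; ring. Qed.

Lemma sqn1 : sqn 1 = 1.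
Proof. by rewrite /sqn/=; ring. Qed.

Lemma ReIm_sum_expi (I : Type) (s : seq I) (f : I -> R) :
  \sum_(i <- s) expi (f i) = Complex (\sum_(i <- s) cos (f i)) (\sum_(i <- s) sin (f i)).
Proof.
elim: s => [|i s IH]; first by rewrite !big_nil.
by rewrite !big_cons IH.
Qed.

(* |sum exp(i f)|^2 *)
Lemma sqn_sum_expi (I : Type) (s : seq I) (f : I -> R) :
  sqn (\sum_(i <- s) expi (f i)) = \sum_(i <- s) \sum_(j <- s) cos (f i - f j).
Proof.
rewrite ReIm_sum_expi /sqn/= !expr2 !mulr_suml -big_split/=.
apply: eq_bigr => i _; rewrite !mulr_sumr -big_split/=.
by apply: eq_bigr => j _; rewrite cosB.
Qed.

Lemma sqn_ge0 z : 0 <= sqn z.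
Proof. by case: z => a b; rewrite addr_ge0 ?sqr_ge0. Qed.

Definition fejer n (t : R) : R :=
  n%:R^-1 * sqn (\sum_(k < n) expi (2 * pi * (k%:R * t))).

Lemma fejer_ge0 n t : 0 <= fejer n t.
Proof. by rewrite mulr_ge0 ?invr_ge0// sqn_ge0. Qed.

Lemma fejerE n t :
  fejer n t = n%:R^-1 * \sum_(k < n) \sum_(l < n) cos (2 * pi * ((k%:Z - l%:Z)%:~R * t)).
Proof.
rewrite /fejer sqn_sum_expi; congr (_ * _); apply: eq_bigr => k _; apply: eq_bigr => l _.
by rewrite rmorphB/= -!pmulrn; congr cos; ring.
Qed.

Lemma measurable_fejer n : measurable_fun setT (fejer n).
Proof.
rewrite (_ : fejer n = (fun t => n%:R^-1 * \sum_(k < n) \sum_(l < n) cos (2 * pi * ((k%:Z - l%:Z)%:~R * t)))).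
  apply: measurable_funM => //; apply: measurable_sum => k; apply: measurable_sum => l.
  by apply: measurable_cos_comp; do 2 apply: measurable_funM => //.
by apply/funext => t; rewrite fejerE.
Qed.

(** Only the n diagonal terms k = l survive integration, each with weight 1/n. *)
Lemma integral_fejer n (a : R) : (0 < n)%N ->
  (\int[lebesgue_measure]_(b in `[0%R, 1%R[) (fejer n (a - b))%:E = 1)%E.
Proof.
move=> n0.
have n0' : (n%:R : R) != 0 by rewrite pnatr_eq0 -lt0n.
have i01 (f : R -> R) M : measurable_fun setT f -> (forall x, `|f x| <= M) ->
    lebesgue_measure.-integrable (`[0, 1[%classic : set R) (EFin \o f).
  by move=> mf fM; apply: (integrable_bounded (M := M)) => //; exact: lebesgue_setM_itv_lty.
have icos (m : int) (th : R) : lebesgue_measure.-integrable (`[0, 1[%classic : set R)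
    (EFin \o (fun b => cos (2 * pi * (m%:~R * b) + th))).
  apply: (i01 _ 1) => [|x]; last exact: norm_cos_le1.
  by apply: measurable_cos_comp; apply: measurable_funD => //; do 2 apply: measurable_funM => //.
have Icos (m : int) (th : R) : \int[lebesgue_measure]_(b in `[0, 1[)
    cos (2 * pi * (m%:~R * b) + th) = (m == 0)%:R * cos th.
  have := integral_cos_period m 1 th.
  under eq_Rintegral do rewrite mul1r.
  rewrite mul1r RintegralD//; last by apply: (i01 _ 1) => // x; rewrite normr1.
  rewrite Rintegral_cst//= lebesgue_measure_itv/= lte_fin ltr01 -EFinB subr0 mulr1.
  exact: addrI.
have E b : fejer n (a - b) = \sum_(k < n) \sum_(l < n)
    n%:R^-1 * cos (2 * pi * ((l%:Z - k%:Z)%:~R * b) + 2 * pi * ((k%:Z - l%:Z)%:~R * a)).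
  rewrite fejerE mulr_sumr; apply: eq_bigr => k _; rewrite mulr_sumr; apply: eq_bigr => l _.
  by congr (_ * cos _); rewrite -[l%:Z - k%:Z]opprB mulrNz; ring.
have iE k l : lebesgue_measure.-integrable (`[0, 1[%classic : set R) (EFin \o (fun b =>
    n%:R^-1 * cos (2 * pi * ((l%:Z - k%:Z)%:~R * b) + 2 * pi * ((k%:Z - l%:Z)%:~R * a)))).
  rewrite (_ : _ \o _ = (fun b => (n%:R^-1)%:E * (EFin \o (fun b =>
    cos (2 * pi * ((l%:Z - k%:Z)%:~R * b) + 2 * pi * ((k%:Z - l%:Z)%:~R * a)))) b)%E) //.
  by apply: integrableZl => //; exact: icos.
transitivity (\int[lebesgue_measure]_(b in `[0, 1[) fejer n (a - b))%:E.
  rewrite fineK//; apply: (@integrable_fin_num _ _ _ _ _ _ _ _); first exact: measurable_itv.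
  rewrite (_ : (fun b => _) = (fun b => \sum_(k < n) \sum_(l < n) (n%:R^-1 *
      cos (2 * pi * ((l%:Z - k%:Z)%:~R * b) + 2 * pi * ((k%:Z - l%:Z)%:~R * a)))%:E)%E).
    apply: integrable_sum => [|k _]; first exact: measurable_itv.
    by apply: integrable_sum => [|l _]; [exact: measurable_itv|exact: iE].
  by apply/funext => b; rewrite E -sumEFin; apply: eq_bigr => k _; rewrite -sumEFin.
congr (_%:E); under eq_Rintegral do rewrite E.
have iS k : lebesgue_measure.-integrable (`[0, 1[%classic : set R) (EFin \o (fun b => \sum_(l < n)
    n%:R^-1 * cos (2 * pi * ((l%:Z - k%:Z)%:~R * b) + 2 * pi * ((k%:Z - l%:Z)%:~R * a)))).
  rewrite (_ : _ \o _ = (fun b => \sum_(l < n) (n%:R^-1 *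
      cos (2 * pi * ((l%:Z - k%:Z)%:~R * b) + 2 * pi * ((k%:Z - l%:Z)%:~R * a)))%:E)%E).
    by apply: integrable_sum => [|l _]; [exact: measurable_itv|exact: iE].
  by apply/funext => b; rewrite sumEFin.
rewrite Rintegral_sum//. 
transitivity (\sum_(k < n) n%:R^-1 : R); last first.
  by rewrite sumr_const card_ord -[LHS]mulr_natl divff.
apply: eq_bigr => k _; rewrite Rintegral_sum//.
rewrite (bigD1 k)//= big1 ?addr0; last first.
  move=> l lk; rewrite RintegralZl// Icos subr_eq0 eqz_nat -[(l : nat) == k]/(l == k) (negbTE lk) mul0r mulr0//.
by rewrite RintegralZl// Icos !subrr eqxx mul0r mulr0 cos0 !mulr1.
Qed.

(** Multiplied by 2 sin(pi t), the sums of cosines and of sines telescope to quantities of size at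
    most 2. Estimating the two separately gives the constant 2 in place of the sharp 1. *)
Lemma fejer_le n (t : R) : sin (pi * t) != 0 -> fejer n t <= 2 / (n%:R * sin (pi * t) ^+ 2).
Proof.
move=> s0; set s := sin (pi * t) in s0 *.
have C : 2 * s * \sum_(k < n) cos (2 * pi * (k%:R * t)) = sin ((2 * n%:R - 1) * (pi * t)) + s.
  elim: n => [|n IH].
    by rewrite big_ord0 !mulr0 sub0r mulN1r sinN addNr.
  rewrite big_ord_recr/= mulrDr IH -[n.+1%:R]natr1.
  have -> : 2 * pi * (n%:R * t) = (2 * n%:R) * (pi * t) by ring.
  rewrite (_ : (2 * (n%:R + 1) - 1) * (pi * t) = (2 * n%:R) * (pi * t) + pi * t); last by ring.
  rewrite (_ : (2 * n%:R - 1) * (pi * t) = (2 * n%:R) * (pi * t) - pi * t); last by ring.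
  by rewrite sinB sinD -/s; ring.
have S : 2 * s * \sum_(k < n) sin (2 * pi * (k%:R * t)) = cos (pi * t) - cos ((2 * n%:R - 1) * (pi * t)).
  elim: n {C} => [|n IH].
    by rewrite big_ord0 !mulr0 sub0r mulN1r cosN subrr.
  rewrite big_ord_recr/= mulrDr IH -[n.+1%:R]natr1.
  have -> : 2 * pi * (n%:R * t) = (2 * n%:R) * (pi * t) by ring.
  rewrite (_ : (2 * (n%:R + 1) - 1) * (pi * t) = (2 * n%:R) * (pi * t) + pi * t); last by ring.
  rewrite (_ : (2 * n%:R - 1) * (pi * t) = (2 * n%:R) * (pi * t) - pi * t); last by ring.
  by rewrite cosB cosD -/s; ring.
have [->|n0] := posnP n; first by rewrite /fejer invr0 !mul0r invr0 mulr0.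
have n0' : 0 < n%:R :> R by rewrite ltr0n.
have ss : 0 < s ^+ 2 by rewrite lt_def sqr_ge0 sqrf_eq0 s0.
rewrite /fejer invfM mulrCA ler_pM2l ?invr_gt0// ler_pdivlMr//.
rewrite ReIm_sum_expi /sqn/=.
move: C S; set x := \sum_(k < n) cos _; set y := \sum_(k < n) sin _ => C S.
have Cb : (2 * s * x) ^+ 2 <= 4.
  rewrite C; set u := sin _; have := norm_sin_le1 ((2 * n%:R - 1) * (pi * t)); have := norm_sin_le1 (pi * t).
  by rewrite -/s -/u !ler_norml => /andP[? ?] /andP[? ?]; nra.
have Sb : (2 * s * y) ^+ 2 <= 4.
  rewrite S; set u := cos ((2 * n%:R - 1) * (pi * t)); set v := cos (pi * t).
  have := norm_cos_le1 ((2 * n%:R - 1) * (pi * t)); have := norm_cos_le1 (pi * t).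
  by rewrite -/u -/v !ler_norml => /andP[? ?] /andP[? ?]; nra.
have : 4 * ((x ^+ 2 + y ^+ 2) * s ^+ 2) = (2 * s * x) ^+ 2 + (2 * s * y) ^+ 2 by ring.
lra.
Qed.

End trigonometric_sums.

(** * Integer boxes and products of Fejer kernels *)

Section int_box.
Variable d : nat.

(** Listing the box through finite functions makes a sum over it the expansion of a product of d
    sums. *)
Definition int_box n : seq 'cV[int]_d :=
  [seq (\col_i (f i : nat)%:Z)%R | f : {ffun 'I_d -> 'I_n}].

Lemma uniq_int_box n : uniq (int_box n).
Proof.
rewrite map_inj_uniq ?enum_uniq// => f g /matrixP fg.
apply/ffunP => i; apply/val_inj; have := fg i ord0.
by rewrite !mxE => -[].
Qed.

Lemma mem_int_box n m : (m \in int_box n) = [forall i, (0 <= m i ord0 < n%:Z)%R].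
Proof.
apply/mapP/forallP => [[f _ ->] i|h].
  by rewrite mxE/= ltz_nat ltn_ord.
have hm i : (`|m i ord0| < n)%N by have := h i; lia.
exists [ffun i => Ordinal (hm i)]; first by rewrite mem_enum.
apply/matrixP => i j; rewrite (ord1 j) mxE ffunE/=.
by have /andP[m0 _] := h i; rewrite gez0_abs.
Qed.

Lemma big_int_box (V : nmodType) n (F : 'cV[int]_d -> V) :
  \sum_(m <- int_box n) F m = \sum_(f : {ffun 'I_d -> 'I_n}) F (\col_i (f i : nat)%:Z).
Proof. by rewrite big_map big_enum. Qed.

Lemma size_int_box n : size (int_box n) = (n ^ d)%N.
Proof. by rewrite size_map -cardE card_ffun !card_ord. Qed.

End int_box.

Section parseval.
Variables (R : realType) (d : nat).
Implicit Types (a b x : 'cV[R]_d) (m : 'cV[int]_d) (g : 'cV[R]_d -> R).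

Definition fejer_kernel n x : R := \prod_(i < d) fejer n (x i ord0).

Lemma fejer_kernel_ge0 n x : 0 <= fejer_kernel n x.
Proof. by apply: prodr_ge0 => i _; exact: fejer_ge0. Qed.

Lemma expi_sum (I : Type) (s : seq I) (f : I -> R) :
  expi (\sum_(i <- s) f i) = \prod_(i <- s) expi (f i).
Proof.
elim: s => [|i s IH]; last by rewrite !big_cons expiD IH.
by rewrite !big_nil /expi cos0 sin0.
Qed.

Lemma sqn_prod (I : Type) (s : seq I) (f : I -> R[i]) :
  sqn (\prod_(i <- s) f i) = \prod_(i <- s) sqn (f i).
Proof.
elim: s => [|i s IH]; last by rewrite !big_cons sqnM IH.
by rewrite !big_nil sqn1.
Qed.

Lemma phaseB m m' a : phase (m - m') a = phase m a - phase m' a.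
Proof. by rewrite /phase map_mxB dotvBl mulrBr. Qed.

Lemma phaseD m m' a : phase (m + m') a = phase m a + phase m' a.
Proof. by rewrite /phase map_mxD dotvDl mulrDr. Qed.

Lemma phaseBr m a b : phase m (a - b) = phase m a - phase m b.
Proof. by rewrite /phase dotvBr mulrBr. Qed.

Lemma phase0 a : phase (0 : 'cV[int]_d) a = 0.
Proof. by rewrite /phase map_mx0 dotv0l mulr0. Qed.

(** The squared modulus is multiplicative, so the product of the one-dimensional kernels is the
    squared modulus of one exponential sum over the box. *)
Lemma fejer_kernelE n x : fejer_kernel n x =
  n%:R ^- d * \sum_(k <- int_box d n) \sum_(l <- int_box d n) cos (phase (k - l) x).
Proof.
rewrite /fejer_kernel /fejer big_split/= prodr_const card_ord exprVn; congr (_ * _).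
transitivity (sqn (\sum_(k <- int_box d n) expi (phase k x))); last first.
  rewrite sqn_sum_expi; apply: eq_bigr => k _; apply: eq_bigr => l _.
  by rewrite phaseB.
rewrite -sqn_prod bigA_distr_bigA/= big_int_box; congr sqn.
apply: eq_bigr => f _; rewrite -expi_sum /phase /dotv mulr_sumr; congr expi.
by apply: eq_bigr => i _; rewrite !mxE -pmulrn.
Qed.

Definition fourier_cos g m : R := \int[lebesgue_cV]_(x in cube d) (g x * cos (phase m x)).
Definition fourier_sin g m : R := \int[lebesgue_cV]_(x in cube d) (g x * sin (phase m x)).

Section fixed_function.
Variables (g : 'cV[R]_d -> R) (M : R).
Hypotheses (mg : measurable_fun setT g) (gM : forall x, `|g x| <= M).

Let M0 : 0 <= M. Proof. exact: le_trans (normr_ge0 _) (gM 0). Qed.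

Definition fejer_mean n a : R :=
  \int[lebesgue_cV]_(b in cube d) (g b * fejer_kernel n (a - b)).

Let mcos m : measurable_fun setT (fun x => cos (phase m x : R)).
Proof. by apply: measurable_cos_comp; exact: measurable_phase. Qed.

Let msin m : measurable_fun setT (fun x => sin (phase m x : R)).
Proof. by apply: measurable_sin_comp; exact: measurable_phase. Qed.

Let integrable_mul (h : 'cV[R]_d -> R) (C : R) : measurable_fun setT h -> (forall x, `|h x| <= C) ->
  lebesgue_cV.-integrable (cube d) (EFin \o (fun x => g x * h x)).
Proof.
move=> mh hC; apply: (integrable_cube (M := M * C)); first exact: measurable_funM.
by move=> x; rewrite normrM ler_pM.
Qed.

Let igcos m := integrable_mul (mcos m) (fun x => norm_cos_le1 _).
Let igsin m := integrable_mul (msin m) (fun x => norm_sin_le1 _).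

Lemma fejer_meanE n a : fejer_mean n a = n%:R ^- d *
  \sum_(k <- int_box d n) \sum_(l <- int_box d n)
    (cos (phase (k - l) a) * fourier_cos g (k - l) + sin (phase (k - l) a) * fourier_sin g (k - l)).
Proof.
have mc := @measurable_cube R d.
pose T (k l : 'cV[int]_d) b := cos (phase (k - l) a) * (g b * cos (phase (k - l) b)) +
       sin (phase (k - l) a) * (g b * sin (phase (k - l) b)).
have E b : g b * fejer_kernel n (a - b) = n%:R ^- d *
    \sum_(k <- int_box d n) \sum_(l <- int_box d n) T k l b.
  rewrite fejer_kernelE mulrCA; congr (_ * _).
  rewrite mulr_sumr; apply: eq_bigr => k _; rewrite mulr_sumr; apply: eq_bigr => l _.
  by rewrite /T phaseBr cosB; ring.
have iT k l : lebesgue_cV.-integrable (cube d) (EFin \o T k l).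
  by apply: integrable_EFinD => //; apply: integrable_EFinZ => //.
rewrite /fejer_mean; under eq_Rintegral do rewrite E.
rewrite RintegralZl//; last by apply: integrable_EFin_sum => // k; apply: integrable_EFin_sum.
congr (_ * _); rewrite Rintegral_sum//; last by move=> k; apply: integrable_EFin_sum.
apply: eq_bigr => k _; rewrite Rintegral_sum//.
apply: eq_bigr => l _; rewrite /T RintegralD//; last 2 first.
- by apply: integrable_EFinZ => //; exact: igcos.
- by apply: integrable_EFinZ => //; exact: igsin.
by rewrite !RintegralZl.
Qed.

Lemma measurable_fejer_mean n : measurable_fun setT (fejer_mean n).
Proof.
rewrite (_ : fejer_mean n = fun a => n%:R ^- d *
  \sum_(k <- int_box d n) \sum_(l <- int_box d n)
    (cos (phase (k - l) a) * fourier_cos g (k - l) + sin (phase (k - l) a) * fourier_sin g (k - l))); last first.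
  by apply/funext => a; rewrite fejer_meanE.
apply: measurable_funM => //; apply: measurable_sum => k; apply: measurable_sum => l.
by apply: measurable_funD; apply: measurable_funM.
Qed.


Lemma integral_fejer_kernel n a : (0 < n)%N ->
  \int[lebesgue_cV]_(b in cube d) fejer_kernel n (a - b) = 1.
Proof.
move=> n0; rewrite /Rintegral.
rewrite (eq_integral (fun b : 'cV[R]_d => (\prod_(i < d) fejer n (a i ord0 - b i ord0))%:E)); last first.
  by move=> b _; congr (_%:E); apply: eq_bigr => i _; rewrite !mxE.
rewrite (integral_cube_prod (f := fun i t => fejer n (a i ord0 - t))).
- by rewrite big1// => i _; exact: integral_fejer.
- by move=> i; apply: measurableT_comp; [exact: measurable_fejer|exact: measurable_funB].
- by move=> i x; exact: fejer_ge0.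
Qed.

Definition far (de : R) a b (i : 'I_d) : bool := de <= `|a i ord0 - b i ord0|.

(** The other coordinates integrate to 1. In coordinate i the bound on a_i also gives |a_i - b_i| <=
    1 - de, so the difference stays away from every integer and the sine in [fejer_le] is at least
    sin(pi de). *)
Lemma integral_fejer_kernel_far n a de (i : 'I_d) : (0 < n)%N ->
  0 < de -> de <= a i ord0 <= 1 - de ->
  (\int[lebesgue_cV]_(b in cube d) ((far de a b i)%:R * fejer_kernel n (a - b))%:E <=
  (2 / (n%:R * sin (pi * de) ^+ 2))%:E)%E.
Proof.
move=> n0 de0 /andP[ai1 ai2].
pose f (j : 'I_d) (t : R) : R :=
  (if j == i then (if de <= `|a i ord0 - t| then 1 else 0) else 1) * fejer n (a j ord0 - t).
rewrite (eq_integral (fun b : 'cV[R]_d => (\prod_(j < d) f j (b j ord0))%:E)); last first.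
  move=> b _; congr (_%:E); rewrite /f big_split/=; congr (_ * _).
    rewrite (bigD1 i)//= eqxx big1 ?mulr1; last by move=> j /negbTE ->.
    by rewrite /far; case: ifP.
  by apply: eq_bigr => j _; rewrite !mxE.
have mf j : measurable_fun setT (f j).
  apply: measurable_funM; last first.
    by apply: measurableT_comp; [exact: measurable_fejer|exact: measurable_funB].
  case: (j == i) => //.
  apply: measurable_fun_ifT => //; apply: measurable_fun_ler => //.
  by apply: measurableT_comp => //; exact: measurable_funB.
have f0 j t : 0 <= f j t.
  by rewrite mulr_ge0 ?fejer_ge0//; case: ifP => // _; case: ifP.
rewrite integral_cube_prod// (bigD1 i)//= [X in (_ * X)%E]big1 ?mule1; last first.
  move=> j /negbTE ji; rewrite -(@integral_fejer R n (a j ord0) n0).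
  by apply: eq_integral => t _; rewrite /f ji mul1r.
have sde : 0 < sin (pi * de).
  apply: sin_gt0_pi; rewrite mulr_gt0 ?pi_gt0//=.
  by rewrite gtr_pMr ?pi_gt0//; lra.
have c0 : 0 <= 2 / (n%:R * sin (pi * de) ^+ 2) by rewrite divr_ge0// mulr_ge0// sqr_ge0.
apply: (@le_trans _ _ (\int[@lebesgue_measure R]_(t in `[0%R, 1%R[) 
  (cst (2 / (n%:R * sin (pi * de) ^+ 2))%:E t))%E).
  apply: ge0_le_integral => //.
  - by move=> t _; rewrite lee_fin.
  - apply/measurable_EFinP; apply: measurable_funTS; exact: mf.
  move=> t; rewrite /= in_itv/= => /andP[t0 t1]; rewrite lee_fin /f eqxx.
  case: (leP de `|a i ord0 - t|) => far1; last by rewrite mul0r.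
  rewrite mul1r.
  have far2 : `|a i ord0 - t| <= 1 - de.
    by rewrite ler_norml; apply/andP; split; lra.
  have ss : sin (pi * de) ^+ 2 <= sin (pi * (a i ord0 - t)) ^+ 2.
    have -> : sin (pi * (a i ord0 - t)) ^+ 2 = sin (pi * `|a i ord0 - t|) ^+ 2.
      by case: (ger0P (a i ord0 - t)) => _ //; rewrite mulrN sinN sqrrN.
    set u := `|_| in far1 far2 *.
    have p0 := pi_gt0 R.
    rewrite ler_sqr ?nnegrE ?(ltW sde)//; last first.
      by apply: sin_ge0_pi; apply/andP; split; nra.
    (* The difference of the sines is 2 cos p sin q, and de <= u <= 1 - de puts p and q in
       [0, pi/2]. *)
    pose p := (pi * u + pi * de) / 2; pose q := (pi * u - pi * de) / 2.
    have -> : pi * u = p + q by rewrite /p /q; field.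
    have -> : pi * de = p - q by rewrite /p /q; field.
    rewrite -subr_ge0 sinD sinB (_ : _ - _ = 2 * (cos p * sin q)); last by ring.
    rewrite !mulr_ge0//.
      by apply: cos_ge0_pihalf; rewrite /p; apply/andP; split; nra.
    by apply: sin_ge0_pi; rewrite /q; apply/andP; split; nra.
  have s2 : 0 < sin (pi * (a i ord0 - t)) ^+ 2 by rewrite (lt_le_trans _ ss)// exprn_gt0.
  apply: le_trans (fejer_le _ _) _; first by rewrite -sqrf_eq0 gt_eqF.
  have n0' : 0 < n%:R :> R by rewrite ltr0n.
  by rewrite ler_pM2l// lef_pV2 ?ler_pM2l// posrE pmulr_rgt0// exprn_gt0.
rewrite integral_cst//=.
by rewrite lebesgue_measure_itv/= lte_fin ltr01 -EFinB subr0 mule1.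
Qed.


Lemma measurable_fejer_kernel n a : measurable_fun setT (fun b => fejer_kernel n (a - b)).
Proof.
apply: measurable_prod => i _.
rewrite (_ : (fun _ => _) = fun b => fejer n (a i ord0 - b i ord0)); last first.
  by apply/funext => b; rewrite !mxE.
apply: measurableT_comp; first exact: measurable_fejer.
by apply: measurable_funB => //; exact: measurable_coord_cV.
Qed.

Lemma fejer_kernel_bound n : exists C : R, forall x, `|fejer_kernel n x| <= C.
Proof.
exists (n%:R ^- d * \sum_(k <- int_box d n) \sum_(l <- int_box d n) 1) => x.
rewrite fejer_kernelE normrM ger0_norm ?invr_ge0 ?exprn_ge0//.
rewrite ler_wpM2l ?invr_ge0 ?exprn_ge0//.
apply: (le_trans (ler_norm_sum _ _ _)); apply: ler_sum => k _.
apply: (le_trans (ler_norm_sum _ _ _)); apply: ler_sum => l _.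
exact: norm_cos_le1.
Qed.

Lemma integrable_mul_kernel (h : 'cV[R]_d -> R) (C : R) n a :
  measurable_fun setT h -> (forall x, `|h x| <= C) ->
  lebesgue_cV.-integrable (cube d) (EFin \o (fun b => h b * fejer_kernel n (a - b))).
Proof.
move=> mh hC; have [K hK] := fejer_kernel_bound n.
apply: (integrable_cube (M := C * K)).
  by apply: measurable_funM => //; exact: measurable_fejer_kernel.
by move=> x; rewrite normrM ler_pM.
Qed.

Lemma fejer_mean_le n a : (0 < n)%N -> `|fejer_mean n a| <= M.
Proof.
move=> n0; have mc := @measurable_cube R d.
apply: le_trans (le_normr_Rintegral mc (integrable_mul_kernel n a mg gM)) _.
have gM' x : `| `|g x| | <= M by rewrite normr_id.
have mg' : measurable_fun setT (fun x => `|g x|) by apply: measurableT_comp.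
have i1 := integrable_mul_kernel n a (measurable_cst (M : R)) (fun x => lexx `|M|).
apply: (@le_trans _ _ (\int[lebesgue_cV]_(b in cube d) (M * fejer_kernel n (a - b)))).
  under eq_Rintegral do rewrite normrM (ger0_norm (fejer_kernel_ge0 _ _)).
  apply: le_Rintegral => //; first exact: (integrable_mul_kernel n a mg' gM').
  by move=> b _; rewrite ler_wpM2r// fejer_kernel_ge0.
have i2 := integrable_mul_kernel n a (measurable_cst (1 : R)) (fun x => lexx `|1|).
rewrite RintegralZl// ?integral_fejer_kernel ?mulr1//.
by move: i2; rewrite (_ : (fun b => _) = fun b => fejer_kernel n (a - b))//; apply/funext => b; rewrite mul1r.
Qed.

(** The point has to be interior: [g] is not assumed periodic, and near a face the kernel also takes
    mass from the opposite face. *)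
Lemma fejer_mean_cvg a : (forall i, 0 < a i ord0 < 1) ->
  (forall e : R, 0 < e -> exists2 de : R, 0 < de &
     forall b, (forall i, `|a i ord0 - b i ord0| < de) -> `|g b - g a| <= e) ->
  fejer_mean n.+1 a @[n --> \oo] --> g a.
Proof.
move=> a01 ga; have mc := @measurable_cube R d.
apply/cvgrPdist_le => /= e e0.
have e20 : 0 < e / 2 by lra.
have [de1 de10 hde1] := ga _ e20.
have [de2 de20 hde2] : exists2 de : R, 0 < de & forall i, de <= a i ord0 <= 1 - de.
  (* All factors lie in ]0, 1], so their product is below each of them, hence below a_i and 1 - a_i;
     it replaces a minimum over i. *)
  pose q i : R := a i ord0 * (1 - a i ord0).
  have q0 i : 0 < q i by have /andP[? ?] := a01 i; rewrite /q; nra.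
  have q1 i : q i <= 1 by have /andP[? ?] := a01 i; rewrite /q; nra.
  exists (\prod_i q i); first by apply: prodr_gt0.
  move=> i; have /andP[? ?] := a01 i.
  have : \prod_j q j <= q i.
    rewrite (bigD1 i)//= ler_piMr ?(ltW (q0 i))// prodr_ile1// => j _.
    by rewrite (ltW (q0 j)) q1.
  by rewrite /q => h; apply/andP; split; nra.
pose de := Num.min de1 de2.
have de0 : 0 < de by rewrite lt_min de10.
have hde i : de <= a i ord0 <= 1 - de.
  have /andP[h1 h2] := hde2 i; have : de <= de2 by rewrite ge_min lexx orbT.
  by move=> h; apply/andP; split; lra.
have mfar i : measurable_fun setT (fun b => (far de a b i)%:R : R).
  rewrite (_ : (fun _ => _) = fun b => if de <= `|a i ord0 - b i ord0| then 1 else 0); last first.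
    by apply/funext => b; rewrite /far; case: ifP.
  apply: measurable_fun_ifT => //; apply: measurable_fun_ler => //.
  apply: measurableT_comp => //; apply: measurable_funB => //; exact: measurable_coord_cV.
have far1 i b : `|(far de a b i)%:R : R| <= 1 by case: (far de a b i); rewrite ?normr1 ?normr0 ?ler01.
have key n : (0 < n)%N -> `|g a - fejer_mean n a| <=
    e / 2 + (2 * M * d%:R * (2 / sin (pi * de) ^+ 2)) / n%:R.
  move=> n0.
  have ifar i := integrable_mul_kernel n a (mfar i) (far1 i).
  have ig := integrable_mul_kernel n a mg gM.
  have ic (c : R) := integrable_mul_kernel n a (measurable_cst (c : R)) (fun x => lexx `|c|).
  have iK : lebesgue_cV.-integrable (cube d) (EFin \o (fun b => fejer_kernel n (a - b))).
    have := ic 1; rewrite (_ : (fun b => _) = fun b => fejer_kernel n (a - b))//.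
    by apply/funext => b; rewrite mul1r.
  have cK (c : R) : \int[lebesgue_cV]_(b in cube d) (c * fejer_kernel n (a - b)) = c.
    by rewrite RintegralZl// integral_fejer_kernel// mulr1.
  have mdif : measurable_fun setT (fun b => g a - g b) by exact: measurable_funB.
  have dif2 b : `|g a - g b| <= 2 * M.
    by rewrite (le_trans (ler_normB _ _))// mulr_natl mulr2n lerD.
  have idif := integrable_mul_kernel n a mdif dif2.
  have -> : g a - fejer_mean n a =
      \int[lebesgue_cV]_(b in cube d) ((g a - g b) * fejer_kernel n (a - b)).
    rewrite -{1}(cK (g a)) -RintegralB//; last exact: (ic (g a)).
    by apply: eq_Rintegral => b _; rewrite mulrBl.
  apply: le_trans (le_normr_Rintegral mc idif) _.
  have madif : measurable_fun setT (fun b => `|g a - g b|) by apply: measurableT_comp.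
  have adif2 b : `| `|g a - g b| | <= 2 * M by rewrite normr_id.
  have iadif := integrable_mul_kernel n a madif adif2.
  have isum : lebesgue_cV.-integrable (cube d)
      (EFin \o (fun b => \sum_i (far de a b i)%:R * fejer_kernel n (a - b))).
    by apply: integrable_EFin_sum => // i; exact: ifar.
  have iZ : lebesgue_cV.-integrable (cube d)
      (EFin \o (fun b => 2 * M * \sum_i (far de a b i)%:R * fejer_kernel n (a - b))).
    exact: integrable_EFinZ.
  apply: (@le_trans _ _ (\int[lebesgue_cV]_(b in cube d) (e / 2 * fejer_kernel n (a - b) +
      2 * M * \sum_i (far de a b i)%:R * fejer_kernel n (a - b)))).
    under eq_Rintegral do rewrite normrM (ger0_norm (fejer_kernel_ge0 _ _)).
    apply: le_Rintegral => //.
      by apply: integrable_EFinD => //; exact: ic.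
    move=> b _; rewrite -mulr_suml mulrA -mulrDl ler_wpM2r ?fejer_kernel_ge0//.
    (* If some coordinate is far, the number of far coordinates is at least 1 and 2 M suffices;
       otherwise b is close to a and e / 2 suffices. *)
    have [/existsP[i fi]|/existsPn nf] := boolP [exists i, far de a b i].
      apply: (le_trans (dif2 b)); rewrite -[leLHS]add0r lerD ?(ltW e20)//.
      rewrite ler_peMr ?mulr_ge0// (bigD1 i)//= fi lerDl sumr_ge0//.
    rewrite distrC; apply: (@le_trans _ _ (e / 2)).
      apply: hde1 => i; have := nf i; rewrite /far -ltNge => /lt_le_trans; apply.
      by rewrite ge_min lexx.
    by rewrite lerDl mulr_ge0 ?mulr_ge0 ?sumr_ge0.
  rewrite RintegralD//; last exact: (ic (e / 2)).
  rewrite cK lerD2l RintegralZl//.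
  rewrite Rintegral_sum//.
  rewrite -!mulrA ler_wpM2l// ler_wpM2l//.
  rewrite [leRHS](_ : _ = \sum_(i < d) (2 / (n%:R * sin (pi * de) ^+ 2))); last first.
    by rewrite sumr_const card_ord -[RHS]mulr_natl [(n%:R * _)^-1]invfM; ring.
  apply: ler_sum => i _.
  rewrite -lee_fin fineK; last exact: (integrable_fin_num mc (ifar i)).
  exact: integral_fejer_kernel_far.
have [N0 hN0] : exists N0 : nat, forall n, (N0 <= n)%N ->
    (2 * M * d%:R * (2 / sin (pi * de) ^+ 2)) / n.+1%:R <= e / 2.
  set C := 2 * M * _ * _.
  exists (Num.truncn (C / (e / 2))).+1 => n hn.
  rewrite ler_pdivrMr ?ltr0n// mulrC -ler_pdivrMr//.
  apply: (le_trans (ltW (truncnS_gt _))); rewrite ler_nat.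
  exact: leq_trans hn _.
exists N0 => // n /= hn.
apply: (le_trans (key n.+1 isT)); rewrite [leRHS](_ : e = e / 2 + e / 2); last by lra.
by rewrite lerD2l; exact: hN0.
Qed.


Let mc := @measurable_cube R d.

Lemma fejer_mean_pairing n :
  \int[lebesgue_cV]_(a in cube d) (g a * fejer_mean n a) = n%:R ^- d *
  \sum_(k <- int_box d n) \sum_(l <- int_box d n)
    (fourier_cos g (k - l) ^+ 2 + fourier_sin g (k - l) ^+ 2).
Proof.
pose T (k l : 'cV[int]_d) a := fourier_cos g (k - l) * (g a * cos (phase (k - l) a)) +
       fourier_sin g (k - l) * (g a * sin (phase (k - l) a)).
have E a : g a * fejer_mean n a = n%:R ^- d *
    \sum_(k <- int_box d n) \sum_(l <- int_box d n) T k l a.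
  rewrite fejer_meanE mulrCA; congr (_ * _).
  rewrite mulr_sumr; apply: eq_bigr => k _; rewrite mulr_sumr; apply: eq_bigr => l _.
  by rewrite /T; ring.
have iT k l : lebesgue_cV.-integrable (cube d) (EFin \o T k l).
  by apply: integrable_EFinD => //; apply: integrable_EFinZ.
under eq_Rintegral do rewrite E.
rewrite RintegralZl//; last by apply: integrable_EFin_sum => // k; apply: integrable_EFin_sum.
congr (_ * _); rewrite Rintegral_sum//; last by move=> k; apply: integrable_EFin_sum.
apply: eq_bigr => k _; rewrite Rintegral_sum//.
apply: eq_bigr => l _; rewrite /T RintegralD//; last 2 first.
- by apply: integrable_EFinZ.
- by apply: integrable_EFinZ.
by rewrite !RintegralZl// !expr2.
Qed.

(* The integral of g times its Fejer mean is an average of n^d partial sums of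
   |ghat|^2, and the Fejer means converge to g off Z. *)
Lemma integral_sqr_le (Z : set 'cV[R]_d) (B : R) :
  measurable Z -> lebesgue_cV Z = 0%E ->
  (forall a, ~ Z a -> forall e : R, 0 < e -> exists2 de : R, 0 < de &
     forall b, (forall i, `|a i ord0 - b i ord0| < de) -> `|g b - g a| <= e) ->
  (forall F : seq 'cV[int]_d, uniq F ->
     \sum_(m <- F) (fourier_cos g m ^+ 2 + fourier_sin g m ^+ 2) <= B) ->
  \int[lebesgue_cV]_(a in cube d) g a ^+ 2 <= B.
Proof.
move=> mZ Z0 cg FB.
(* The faces of the cube, discarded because [fejer_mean_cvg] is about interior points. *)
pose Y i : set 'cV[R]_d := [set a | a i ord0 = 0].
have mY i : measurable (Y i).
  rewrite -[Y i]setTI.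
  exact: (@measurable_coord_cV _ R d i measurableT [set 0] (measurable_set1 0)).
have Y0 i : lebesgue_cV (Y i) = 0%E.
  rewrite (_ : Y i = [set a : 'cV[R]_d | forall j, (if j == i then [set 0] else setT) (a j ord0)]).
    rewrite (@lebesgue_cV_rectangle R d (fun j => if j == i then [set 0] else setT)); last first.
      by move=> j; case: ifP => // _; exact: measurable_set1.
    by rewrite (bigD1 i)//= eqxx lebesgue_measure_set1 mul0e.
  apply/seteqP; split=> a /=; first by move=> ai j; case: eqP => // ->.
  by move/(_ i); rewrite eqxx.
have ae : {ae lebesgue_cV, forall a : 'cV[R]_d, cube d a -> fejer_mean n.+1 a @[n --> \oo] --> g a}.
  have nZ : lebesgue_cV.-negligible (Z `|` \big[setU/set0]_(i < d) Y i).
    apply: negligibleU; first by exists Z; split.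
    elim/big_ind : _ => [|A C|i _]; [exact: negligible_set0|exact: negligibleU|].
    by exists (Y i); split; [exact: mY|exact: Y0|].
  apply: (negligibleS _ nZ) => a /= h; apply: contrapT => /not_orP[nZa nYa]; apply: h => ca.
  apply: fejer_mean_cvg; last exact: cg.
  move=> i; have /andP[a0 a1] := ca i; rewrite a1 andbT lt_def a0 andbT.
  by apply/eqP => ai0; apply: nYa; rewrite -bigcup_seq; exists i => //=; rewrite mem_index_enum.
have mgn n : measurable_fun (cube d) (fun a => (g a * fejer_mean n.+1 a)%:E).
  apply: measurable_funTS; apply/measurable_EFinP; apply: measurable_funM => //.
  exact: measurable_fejer_mean.
have mg2 : measurable_fun (cube d) (fun a => (g a ^+ 2)%:E).
  by apply: measurable_funTS; apply/measurable_EFinP; apply: measurable_funX.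
have [] := @dominated_convergence _ _ _ (@lebesgue_cV R d) (cube d) mc
  (fun n a => (g a * fejer_mean n.+1 a)%:E) (fun a => (g a ^+ 2)%:E) (fun=> (M ^+ 2)%:E) mgn mg2.
- apply: filterS ae => a ha ca; apply: cvg_EFin; first exact: nearW.
  by rewrite expr2; apply: cvgMr; exact: ha.
- by apply: (integrable_cube (M := `|M ^+ 2|)).
- apply: aeW => a n _; rewrite lee_fin normrM expr2 ler_pM//; exact: fejer_mean_le.
move=> ig2 _ cv.
rewrite -lee_fin /Rintegral fineK; last exact: (integrable_fin_num mc ig2).
rewrite -(cvg_lim _ cv)//; apply: lime_le; first exact: cvgP cv.
apply: nearW => n.
have imean : lebesgue_cV.-integrable (cube d) (EFin \o (fun a => g a * fejer_mean n.+1 a)).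
  apply: (integrable_mul (C := M)); first exact: measurable_fejer_mean.
  by move=> a; exact: fejer_mean_le.
rewrite -[leLHS]fineK; last exact: (integrable_fin_num mc imean).
rewrite lee_fin [leLHS](fejer_mean_pairing n.+1).
apply: (@le_trans _ _ (n.+1%:R ^- d * \sum_(k <- int_box d n.+1) B)); last first.
  rewrite big_const_seq count_predT size_int_box iter_addr_0 -[B *+ _]mulr_natl natrX.
  by rewrite mulKf// expf_neq0// pnatr_eq0.
rewrite ler_wpM2l ?invr_ge0 ?exprn_ge0//; apply: ler_sum => k _.
(* For fixed k the frequencies k - l are distinct, so the inner sum is one of those bounded by B;
   the n^d values of k cancel the prefactor. *)
rewrite -(big_map (fun l => k - l) predT (fun m => fourier_cos g m ^+ 2 + fourier_sin g m ^+ 2)).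
apply: FB; rewrite map_inj_uniq ?uniq_int_box//.
by move=> x y /addrI/oppr_inj.
Qed.

End fixed_function.
End parseval.

Lemma ler_sum_uniq_sub (R : numDomainType) (I : eqType) (s1 s2 : seq I) (f : I -> R) :
  uniq s1 -> (forall i, i \in s1 -> f i != 0 -> i \in s2) -> (forall i, 0 <= f i) ->
  \sum_(i <- s1) f i <= \sum_(i <- s2) f i.
Proof.
move=> u1 s12 f0; elim: s1 s2 u1 s12 => [|x s IH] s2 /=.
  by move=> _ _; rewrite big_nil sumr_ge0.
move=> /andP[xs us] s12; rewrite big_cons.
have [fx|fx] := eqVneq (f x) 0.
  by rewrite fx add0r; apply: IH => // i ix; apply: s12; rewrite inE ix orbT.
have x2 : x \in s2 by apply: s12; rewrite ?mem_head.
rewrite (perm_big _ (perm_to_rem x2)) big_cons lerD2l; apply: IH => // i ix fi.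
have : i \in s2 by apply: s12; rewrite ?inE ?ix ?orbT.
rewrite (perm_mem (perm_to_rem x2)) inE => /predU1P[ixE|//].
by move: xs; rewrite -ixE ix.
Qed.

Lemma integral_mscale_EFin d (T : measurableType d) (R : realType)
    (mu : {measure set T -> \bar R}) (k : {nonneg R}) (D : set T) (f : T -> \bar R) :
  measurable D -> mu.-integrable D f ->
  (\int[mscale k mu]_(x in D) f x = k%:num%:E * \int[mu]_(x in D) f x)%E.
Proof.
move=> mD fi; have mf := measurable_int mu fi.
rewrite [LHS]integralE [in RHS]integralE (ge0_integral_mscale _ mD _ (measurable_funepos mf))//.
rewrite (ge0_integral_mscale _ mD _ (measurable_funeneg mf))//.
rewrite -(fineK (integrable_pos_fin_num mD fi)) -(fineK (integrable_neg_fin_num mD fi)).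
have H (c a b : R) : (c%:E * (a%:E - b%:E) = c%:E * a%:E - c%:E * b%:E)%E.
  by rewrite -EFinB -!EFinM -EFinB mulrBr.
exact/esym/H.
Qed.

(** * Trigonometric polynomials as Sobolev functions *)

Section torus.
Variables (R : realType) (d : nat) (A : 'M[R]_d).
Hypothesis uA : A \in unitmx.
Implicit Types (f : 'cV[R]_d -> R).

Let detA : `|\det A| != 0.
Proof. by rewrite normr_eq0 -unitfE -unitmxE. Qed.

Lemma fundamental_domainE : fundamental_domain A = [set u | cube d (invmx A *m u)].
Proof.
apply/seteqP; split => u /=; first by move=> [a ha <-]; rewrite mulKmx.
by move=> h; exists (invmx A *m u) => //; rewrite mulKVmx.
Qed.

Lemma measurable_fundamental_domain : measurable (fundamental_domain A).
Proof.
have := measurable_mulmx_add (invmx A) 0 measurableT (@measurable_cube R d).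
rewrite setTI fundamental_domainE; congr measurable.
by apply/seteqP; split => u /=; rewrite /preimage/= addr0.
Qed.

Let preimage_domain : [set a | fundamental_domain A (A *m a + 0)] = cube d.
Proof. by apply/seteqP; split => a; rewrite fundamental_domainE/= addr0 mulKmx. Qed.

Lemma lebesgue_fundamental_domain : lebesgue_cV (fundamental_domain A) = (`|\det A|)%:E.
Proof.
rewrite -(lebesgue_cV_affine 0 uA measurable_fundamental_domain) preimage_domain.
by rewrite [X in (_ * X)%E]lebesgue_cube mule1.
Qed.

(** The Jacobian |det A| of a -> A a cancels the normalization of the measure. *)
Lemma torus_integralE f (M : R) : measurable_fun setT f -> (forall u, `|f u| <= M) ->
  torus_integral A f = \int[lebesgue_cV]_(a in cube d) f (A *m a).
Proof.
move=> mf fM; have mD := measurable_fundamental_domain.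
have i1 : lebesgue_cV.-integrable (fundamental_domain A) (EFin \o f).
  apply: integrable_bounded fM => //.
  by apply: (le_lt_trans (_ : _ <= `|\det A|%:E)%E); rewrite ?ltry// -lebesgue_fundamental_domain.
rewrite /torus_integral /Rintegral integral_mscale_EFin//=.
rewrite fineM//; last exact: integrable_fin_num i1.
rewrite -[fine (integral _ _ _)]/(\int[lebesgue_cV]_(x in fundamental_domain A) f x).
rewrite -(Rintegral_affine 0 uA mD (measurable_funTS mf)) preimage_domain.
have -> : lebesgue_cV (fundamental_domain A) = (`|\det A|)%:E by exact: lebesgue_fundamental_domain.
rewrite /= mulKf//.
by apply: eq_Rintegral => a _; rewrite addr0.
Qed.

(** The dual lattice is the image of Z^d under the inverse transpose of A; this indexes frequencies
    by integer vectors, paired with lattice coordinates by [dotv_dual]. *)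
Definition dual_vector (m : 'cV[int]_d) : 'cV[R]_d := (invmx A)^T *m map_mx intr m.

Lemma dotv_dual m a : dotv (dual_vector m) (A *m a) = dotv (map_mx intr m) a.
Proof.
by rewrite dotv_mulmx_trmx /dual_vector mulmxA -trmx_mul mulVmx// trmx1 mul1mx.
Qed.

Lemma dual_phase m a : 2 * pi * dotv (A *m a) (dual_vector m) = phase m a.
Proof. by rewrite dotvC dotv_dual. Qed.

(** The integers are the pairings of w with the columns of A. *)
Lemma dual_latticeP w : dual_lattice A w -> exists m, w = dual_vector m.
Proof.
move=> dw.
have /choice[m hm] : forall i : 'I_d, exists k : int, (A^T *m w) i ord0 = k%:~R.
  move=> i; have /dw /intrP[k kE] : lattice A (A *m delta_mx i ord0).
    by exists (delta_mx i ord0); rewrite map_delta_mx.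
  exists k; rewrite -kE dotv_mulmx_trmx /dotv (bigD1 i)//= big1 ?addr0.
    by rewrite [delta_mx i ord0 i ord0]mxE !eqxx mulr1.
  by move=> j /negbTE ji; rewrite [delta_mx i ord0 j ord0]mxE ji mulr0.
exists (\col_i m i); rewrite /dual_vector.
have -> : map_mx intr (\col_i m i) = A^T *m w.
  by apply/matrixP => i j; rewrite !mxE -[in LHS]hm (ord1 j) mxE.
by rewrite mulmxA -trmx_mul mulmxV// trmx1 mul1mx.
Qed.

Lemma dual_vector_lattice m v : lattice A v -> dotv (dual_vector m) v \is a Num.int.
Proof.
move=> [k ->]; rewrite dotv_dual; apply: rpred_sum => i _.
by rewrite !mxE rpredM// intr_int.
Qed.

End torus.

Lemma esum_le_sum (R : realType) (T : choiceType) (S : set T) (t : T -> R) (s : seq T) :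
  (forall x, 0 <= t x) -> (forall x, S x -> t x != 0 -> x \in s) ->
  (\esum_(x in S) (t x)%:E <= (\sum_(x <- s) t x)%:E)%E.
Proof.
move=> t0 ts; rewrite /esum; apply: ge_ereal_sup => _ [F [fF FS] <-].
rewrite fsbig_finite// sumEFin lee_fin; apply: ler_sum_uniq_sub => //.
by move=> x; rewrite in_fset_set// inE => Fx; apply: ts; exact: FS.
Qed.

Lemma continuous_sum_at (T : topologicalType) (R : realType) (I : Type) (s : seq I)
    (f : I -> T -> R) (x : T) :
  (forall i, f i y @[y --> x] --> f i x) ->
  \sum_(i <- s) f i y @[y --> x] --> \sum_(i <- s) f i x.
Proof.
move=> cf; elim: s => [|i s IH].
  rewrite big_nil (_ : (fun y => _) = cst 0); first exact: cvg_cst.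
  by apply/funext => y; rewrite big_nil.
rewrite big_cons (_ : (fun y => _) = (fun y => f i y + \sum_(j <- s) f j y)).
  by apply: cvgD; [exact: cf|exact: IH].
by apply/funext => y; rewrite big_cons.
Qed.

Section test_function.
Variables (R : realType) (d : nat) (A : 'M[R]_d) (alpha : R).
Hypothesis uA : A \in unitmx.
Variables (F : seq 'cV[int]_d) (c p q : 'cV[int]_d -> R).
Hypotheses (uF : uniq F) (symF : forall m, (- m \in F) = (m \in F)).
Hypotheses (cN : forall m, c (- m) = c m) (pN : forall m, p (- m) = p m)
  (qN : forall m, q (- m) = - q m).

(** With F symmetric, c and p even and q odd, the terms of m and -m coincide, so the Fourier
    coefficient at m in F is c (p - i q), without factors 1/2. *)
Definition trig_poly (u : 'cV[R]_d) : R :=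
  \sum_(m <- F) c m * (p m * cos (2 * pi * dotv (dual_vector A m) u) +
                       q m * sin (2 * pi * dotv (dual_vector A m) u)).

Lemma continuous_dotv_l (w : 'cV[R]_d) : continuous (fun u : 'cV[R]_d => dotv w u).
Proof.
move=> u; apply: continuous_sum_at => i.
have cu : v i ord0 @[v --> u] --> u i ord0 by exact: (@coord_continuous R d 1 i ord0 u).
apply: (@cvgM R 'cV[R]_d (nbhs u) _ (cst (w i ord0)) (fun v : 'cV[R]_d => v i ord0)).
  exact: cvg_cst.
exact: cu.
Qed.

Lemma continuous_trig_poly : continuous trig_poly.
Proof.
move=> u; apply: continuous_sum_at => m.
have MC (f : 'cV[R]_d -> R) (k : R) : f v @[v --> u] --> f u -> k * f v @[v --> u] --> k * f u.
  by move=> cf; apply: (@cvgM R 'cV[R]_d (nbhs u) _ (cst k) f) => //; exact: cvg_cst.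
have cl := MC _ (2 * pi) (@continuous_dotv_l (dual_vector A m) u).
have cc : cos (2 * pi * dotv (dual_vector A m) v) @[v --> u] --> cos (2 * pi * dotv (dual_vector A m) u).
  exact: (continuous_cvg _ (@continuous_cos R _) cl).
have cs : sin (2 * pi * dotv (dual_vector A m) v) @[v --> u] --> sin (2 * pi * dotv (dual_vector A m) u).
  exact: (continuous_cvg _ (@continuous_sin R _) cl).
apply: (MC (fun v => p m * cos (2 * pi * dotv (dual_vector A m) v) +
  q m * sin (2 * pi * dotv (dual_vector A m) v))).
apply: (@cvgD R R 'cV[R]_d (nbhs u) _
  (fun v => p m * cos (2 * pi * dotv (dual_vector A m) v))
  (fun v => q m * sin (2 * pi * dotv (dual_vector A m) v))).
  exact: (MC (fun v => cos (2 * pi * dotv (dual_vector A m) v))).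
exact: (MC (fun v => sin (2 * pi * dotv (dual_vector A m) v))).
Qed.

Lemma periodic_trig_poly : Defs.periodic A trig_poly.
Proof.
move=> u v lv; apply: eq_bigr => m _.
have /intrP[k kE] := dual_vector_lattice uA m lv.
have E : 2 * pi * dotv (dual_vector A m) (u + v) =
    2 * pi * dotv (dual_vector A m) u + k%:~R * (2 * pi).
  by rewrite dotvDr kE; ring.
by rewrite E sinD2piz cosD2piz.
Qed.

Lemma trig_poly_phase a : trig_poly (A *m a) =
  \sum_(m <- F) c m * (p m * cos (phase m a) + q m * sin (phase m a)).
Proof. by apply: eq_bigr => m _; rewrite dotv_dual. Qed.

Lemma measurable_trig_poly : measurable_fun setT trig_poly.
Proof.
apply: measurable_sum => m; apply: measurable_funM => //.
have ml : measurable_fun setT (fun u : 'cV[R]_d => 2 * pi * dotv (dual_vector A m) u).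
  by apply: measurable_funM => //; exact: measurable_dotv_l.
apply: measurable_funD; apply: measurable_funM => //.
  exact: measurable_cos_comp.
exact: measurable_sin_comp.
Qed.

Let M : R := \sum_(m <- F) `|c m| * (`|p m| + `|q m|).

Lemma trig_poly_bound u : `|trig_poly u| <= M.
Proof.
apply: (le_trans (ler_norm_sum _ _ _)); apply: ler_sum => m _.
rewrite normrM ler_wpM2l// (le_trans (ler_normD _ _))// lerD// normrM ler_piMr//.
  exact: norm_cos_le1.
exact: norm_sin_le1.
Qed.

Let mcube := @measurable_cube R d.

Let icos m (th : R) : lebesgue_cV.-integrable (cube d) (EFin \o (fun a : 'cV[R]_d => cos (phase m a + th))).
Proof.
apply: (integrable_cube (M := 1)) => [|x]; last exact: norm_cos_le1.
by apply: measurable_cos_comp; apply: measurable_funD => //; exact: measurable_phase.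
Qed.

(* cos x = cos (x + 0) and sin x = cos (x - pi/2), so both cases are product-to-sum formulas *)
Lemma integral_cos_cos m m' (th th' : R) :
  \int[lebesgue_cV]_(a in cube d) (cos (phase m a + th) * cos (phase m' a + th')) =
  ((m == m')%:R * cos (th - th') + (m == - m')%:R * cos (th + th')) / 2.
Proof.
have E a : cos (phase m a + th) * cos (phase m' a + th') =
    2^-1 * cos (phase (m - m') a + (th - th')) + 2^-1 * cos (phase (m + m') a + (th + th')).
  rewrite phaseB phaseD.
  rewrite (_ : phase m a - phase m' a + (th - th') = (phase m a + th) - (phase m' a + th')); last by ring.
  rewrite (_ : phase m a + phase m' a + (th + th') = (phase m a + th) + (phase m' a + th')); last by ring.
  by move: (phase m a + th) (phase m' a + th') => x y; rewrite cosB cosD; field.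
under eq_Rintegral do rewrite E.
rewrite RintegralD//; [|exact: integrable_EFinZ..].
rewrite !RintegralZl// !integral_cube_phase subr_eq0 addr_eq0.
by field.
Qed.

Lemma integral_trig_cos m' (th : R) :
  \int[lebesgue_cV]_(a in cube d) (trig_poly (A *m a) * cos (phase m' a + th)) =
  (m' \in F)%:R * (c m' * (p m' * cos th - q m' * sin th)).
Proof.
have E a : trig_poly (A *m a) * cos (phase m' a + th) =
  \sum_(m <- F) (c m * p m * (cos (phase m a + 0) * cos (phase m' a + th)) +
                 c m * q m * (cos (phase m a + - (pi / 2)) * cos (phase m' a + th))).
  rewrite trig_poly_phase mulr_suml; apply: eq_bigr => m _.
  by rewrite addr0 cosBpihalf; ring.
have icc m (t : R) : lebesgue_cV.-integrable (cube d) (EFin \o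
    (fun a : 'cV[R]_d => cos (phase m a + t) * cos (phase m' a + th))).
  apply: (integrable_cube (M := 1)) => [|x].
    by apply: measurable_funM; apply: measurable_cos_comp; apply: measurable_funD => //; exact: measurable_phase.
  by rewrite normrM mulr_ile1// norm_cos_le1.
under eq_Rintegral do rewrite E.
rewrite Rintegral_sum//; last first.
  by move=> m; apply: integrable_EFinD => //; exact: integrable_EFinZ.
transitivity (\sum_(m <- F) ((m == m')%:R * (c m' * (p m' * cos th - q m' * sin th) / 2) +
                            (m == - m')%:R * (c m' * (p m' * cos th - q m' * sin th) / 2))).
  apply: eq_bigr => m _.
  rewrite RintegralD//; [|exact: integrable_EFinZ..].
  rewrite !RintegralZl// !integral_cos_cos sub0r cosN add0r.
  have -> : cos (- (pi / 2) - th) = - sin th by rewrite -opprD cosN addrC cosDpihalf.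
  have -> : cos (- (pi / 2) + th) = sin th by rewrite addrC cosBpihalf.
  have [->|mm] := eqVneq m m'.
    (* Usually m' and -m' contribute one half each. When they coincide both halves fall on the same
       term, and oddness forces q to vanish there. *)
    have [mm'|mm'] := eqVneq m' (- m').
      have q0 : q m' = 0 by have := qN m'; rewrite -mm'; lra.
      by rewrite q0 /=; field.
    by rewrite /=; field.
  have [->|_] := eqVneq m (- m'); last by rewrite /=; field.
  by rewrite cN pN qN /=; field.
have S m (x : R) : \sum_(i <- F) (i == m)%:R * x = (m \in F)%:R * x.
  rewrite -mulr_suml; congr (_ * _).
  have [mF|mF] := boolP (m \in F).
    rewrite (perm_big _ (perm_to_rem mF)) big_cons eqxx big_seq big1 => [|i]; first exact: addr0.
    by rewrite mem_rem_uniq// inE => /andP[/negbTE ->].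
  by rewrite big_seq big1// => i iF; case: eqP => // im; move: mF; rewrite -im iF.
by rewrite big_split/= !S symF; field.
Qed.

Lemma integral_trig_poly : 0 \notin F -> torus_integral A trig_poly = 0.
Proof.
move=> F0; rewrite (torus_integralE uA measurable_trig_poly trig_poly_bound).
have := @integral_trig_cos 0 0; rewrite (negbTE F0) mul0r => <-.
by apply: eq_Rintegral => a _; rewrite phase0 addr0 cos0 mulr1.
Qed.

Lemma fourier_trig_poly m : fourier_coef A trig_poly (dual_vector A m) =
  Complex ((m \in F)%:R * (c m * p m)) (- ((m \in F)%:R * (c m * q m))).
Proof.
have Mb (h : R -> R) (w : 'cV[R]_d) : (forall x, `|h x| <= 1) ->
    forall u, `|trig_poly u * h (2 * pi * dotv u w)| <= M.
  move=> h1 u; rewrite normrM (le_trans _ (trig_poly_bound u))// ler_piMr//.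
have mw (w : 'cV[R]_d) : measurable_fun setT (fun u => 2 * pi * dotv u w).
  apply: measurable_funM => //.
  rewrite (_ : (fun u => _) = fun u => dotv w u); first exact: measurable_dotv_l.
  by apply/funext => u; rewrite dotvC.
rewrite /fourier_coef; congr Complex; last congr (- _).
  rewrite (torus_integralE uA (M := M)); last exact: (Mb cos _ (@norm_cos_le1 R)).
    transitivity (\int[lebesgue_cV]_(a in cube d) (trig_poly (A *m a) * cos (phase m a + 0))).
      by apply: eq_Rintegral => a _; rewrite dual_phase// addr0.
    by rewrite integral_trig_cos cos0 sin0; ring.
  by apply: measurable_funM; [exact: measurable_trig_poly|exact: measurable_cos_comp].
rewrite (torus_integralE uA (M := M)); last exact: (Mb sin _ (@norm_sin_le1 R)).
  transitivity (\int[lebesgue_cV]_(a in cube d) (trig_poly (A *m a) * cos (phase m a + - (pi / 2)))).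
    by apply: eq_Rintegral => a _; rewrite dual_phase// cosBpihalf.
  by rewrite integral_trig_cos cosN sinN cos_pihalf sin_pihalf; ring.
by apply: measurable_funM; [exact: measurable_trig_poly|exact: measurable_sin_comp].
Qed.

Definition sobolev_weight m : R := 1 + 4 * pi ^+ 2 * enorm (dual_vector A m) ^+ 2.

(** An upper bound is enough, because the norm stands on the larger side of the quadrature estimate;
    possible repetitions among the dual vectors are then harmless. *)
Lemma sobolev_trig_poly_le : (sobolev_sqnorm A alpha trig_poly <=
  (\sum_(m <- F) sobolev_weight m `^ alpha * (c m ^+ 2 * (p m ^+ 2 + q m ^+ 2)))%:E)%E.
Proof.
rewrite /sobolev_sqnorm.
have -> : \sum_(m <- F) sobolev_weight m `^ alpha * (c m ^+ 2 * (p m ^+ 2 + q m ^+ 2)) =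
   \sum_(w <- map (dual_vector A) F) ((1 + 4 * pi ^+ 2 * enorm w ^+ 2) `^ alpha *
     ComplexField.Normc.normc (fourier_coef A trig_poly w) ^+ 2).
  rewrite big_map big_seq [RHS]big_seq; apply: eq_bigr => m mF.
  rewrite fourier_trig_poly mF/= sqr_sqrtr ?addr_ge0 ?sqr_ge0//.
  by congr (_ * _); ring.
apply: esum_le_sum => [w|w dw].
  by rewrite mulr_ge0 ?powR_ge0 ?sqr_ge0.
have [m ->] := dual_latticeP uA dw.
rewrite fourier_trig_poly; apply: contraNT => mF.
have -> : (m \in F) = false by apply/negbTE; apply: contra mF => mF; exact: map_f.
by rewrite /= !mul0r oppr0 expr0n/= addr0 sqrtr0 expr0n/= mulr0.
Qed.

Lemma sobolev_trig_poly : sobolev A alpha trig_poly.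
Proof.
split; [exact: continuous_trig_poly|exact: periodic_trig_poly|].
by apply: (le_lt_trans sobolev_trig_poly_le); rewrite ltry.
Qed.

End test_function.

Lemma absz_subz_le (z : int) (n : nat) : 0 <= z < (2 * n).+1%:Z -> (`|z - n%:Z| <= n)%N.
Proof. lia. Qed.

Lemma absz_addz_lt (z : int) (n : nat) : (`|z| <= n)%N -> 0 <= z + n%:Z < (2 * n).+1%:Z.
Proof. lia. Qed.

Lemma addz_lt2 (x y : int) (n : nat) : 0 <= x < n%:Z -> 0 <= y < n%:Z ->
  0 <= x + y < (2 * n)%N%:Z.
Proof. lia. Qed.

Lemma ltz_double (x : int) (n : nat) : 0 <= x < n%:Z -> 0 <= x < (2 * n)%N%:Z.
Proof. lia. Qed.

Lemma absz_subz_lt (x y : int) (n : nat) : 0 <= x < n%:Z -> 0 <= y < n%:Z ->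
  (`|x - y| <= n)%N.
Proof. lia. Qed.

(** * Decay of the spectral density of a point set *)

Section symmetric_box.
Variable d : nat.
Implicit Type m : 'cV[int]_d.

Definition sym_box n : seq 'cV[int]_d :=
  [seq m - const_mx n%:Z | m <- int_box d (2 * n).+1].

Definition max_norm (m : 'cV[int]_d) : nat := \max_i `|m i ord0|%N.

Lemma max_norm_leP m n : reflect (forall i, `|m i ord0| <= n)%N (max_norm m <= n)%N.
Proof.
rewrite /max_norm; apply: (iffP idP) => [/bigmax_leqP h i|h]; first exact: h.
by apply/bigmax_leqP => i _; exact: h.
Qed.

Lemma mem_sym_box n m : (m \in sym_box n) = (max_norm m <= n)%N.
Proof.
apply/mapP/max_norm_leP => [[k + ->] i|h].
  by rewrite mem_int_box => /forallP /(_ i); rewrite !mxE => /absz_subz_le.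
exists (m + const_mx n%:Z); last by rewrite addrK.
by rewrite mem_int_box; apply/forallP => i; rewrite !mxE; exact: absz_addz_lt.
Qed.

Lemma uniq_sym_box n : uniq (sym_box n).
Proof. by rewrite map_inj_uniq ?uniq_int_box// => x y /addIr. Qed.

Lemma max_normN m : max_norm (- m) = max_norm m.
Proof. by apply: eq_bigr => i _; rewrite mxE abszN. Qed.

Lemma max_norm_gt0 m : (0 < max_norm m)%N = (m != 0).
Proof.
rewrite lt0n; congr negb; rewrite -leqn0; apply/max_norm_leP/eqP => [h|-> i].
  by apply/matrixP => i j; rewrite (ord1 j) mxE; have := h i; rewrite leqn0 absz_eq0 => /eqP.
by rewrite mxE.
Qed.

End symmetric_box.

Section spectral_sum.
Variables (R : realType) (d N : nat) (b : 'I_N -> 'cV[R]_d).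
Implicit Types (m k l : 'cV[int]_d).

(** The unnormalized structure factor S(w) at w = [dual_vector A m], for points with lattice
    coordinates b. *)
Definition spectral m : R := sqn (\sum_j expi (phase m (b j))).

Lemma spectral_ge0 m : 0 <= spectral m.
Proof. exact: sqn_ge0. Qed.

Lemma spectral0 : spectral 0 = N%:R ^+ 2.
Proof.
rewrite /spectral sqn_sum_expi (eq_bigr (fun=> N%:R)) => [|i _].
  by rewrite sumr_const card_ord -[LHS]mulr_natl expr2.
rewrite (eq_bigr (fun=> 1)) => [|j _]; last by rewrite !phase0 subrr cos0.
by rewrite sumr_const card_ord.
Qed.

(** In the addition formula the sines of f k - f l are antisymmetric in k and l, so their double sum
    is 0. *)
Lemma sum_cos_shift (I : Type) (s : seq I) (f : I -> R) (x : R) :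
  \sum_(k <- s) \sum_(l <- s) cos (x + (f k - f l)) =
  cos x * \sum_(k <- s) \sum_(l <- s) cos (f k - f l).
Proof.
have S0 : \sum_(k <- s) \sum_(l <- s) sin (f k - f l) = 0.
  have : \sum_(k <- s) \sum_(l <- s) sin (f k - f l) =
         - \sum_(k <- s) \sum_(l <- s) sin (f k - f l).
    rewrite {1}exchange_big/= -sumrN; apply: eq_bigr => k _; rewrite -sumrN.
    by apply: eq_bigr => l _; rewrite -sinN opprB.
  by set y := \sum_(k <- s) _; move=> h; lra.
transitivity (\sum_(k <- s) (cos x * (\sum_(l <- s) cos (f k - f l)) -
    sin x * (\sum_(l <- s) sin (f k - f l)))).
  apply: eq_bigr => k _; rewrite !mulr_sumr -sumrB; apply: eq_bigr => l _.
  by rewrite cosD.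
by rewrite sumrB -!mulr_sumr S0 mulr0 subr0.
Qed.

(* Sums of the spectral density over differences of [B] with itself pair the points with a
   nonnegative kernel, so that multiplying by a character only decreases them. *)
Lemma spectral_shift_le (B : seq 'cV[int]_d) m0 :
  \sum_(k <- B) \sum_(l <- B) spectral (m0 + (k - l)) <=
  \sum_(k <- B) \sum_(l <- B) spectral (k - l).
Proof.
have E x0 : \sum_(k <- B) \sum_(l <- B) spectral (x0 + (k - l)) =
    \sum_i \sum_j (cos (phase x0 (b i - b j)) *
      \sum_(k <- B) \sum_(l <- B) cos (phase k (b i - b j) - phase l (b i - b j))).
  transitivity (\sum_(k <- B) \sum_(l <- B) \sum_i \sum_j
      cos (phase x0 (b i - b j) + (phase k (b i - b j) - phase l (b i - b j)))).
    apply: eq_bigr => k _; apply: eq_bigr => l _; rewrite /spectral sqn_sum_expi.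
    by apply: eq_bigr => i _; apply: eq_bigr => j _; rewrite -phaseBr phaseD phaseB.
  under eq_bigr do rewrite exchange_big/=; rewrite exchange_big/=.
  apply: eq_bigr => i _.
  under eq_bigr do rewrite exchange_big/=; rewrite exchange_big/=.
  by apply: eq_bigr => j _; rewrite sum_cos_shift.
under [leRHS]eq_bigr do under eq_bigr do rewrite -[_ - _]add0r.
rewrite !E; apply: ler_sum => i _; apply: ler_sum => j _.
rewrite phase0 cos0 ler_wpM2r ?cos_le1// -sqn_sum_expi; exact: sqn_ge0.
Qed.

(** Every p of the box is (p + l) - l for n^d choices of l, with p + l and l in the doubled box.
    After the comparison with the unshifted sum there are (2n)^d values of l, each giving distinct
    frequencies in the symmetric box; the quotient is 2^d. *)
Lemma spectral_block_le n m0 : (0 < n)%N ->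
  \sum_(p <- int_box d n) spectral (m0 + p) <=
  2 ^+ d * \sum_(m <- sym_box d (2 * n)) spectral m.
Proof.
move=> n0; set U := \sum_(m <- sym_box _ _) _.
have nd : 0 < n%:R ^+ d :> R by rewrite exprn_gt0// ltr0n.
rewrite -(ler_pM2l nd).
apply: (@le_trans _ _ (\sum_(l <- int_box d n) \sum_(k <- int_box d (2 * n)) spectral (m0 + (k - l)))).
  rewrite [leLHS](_ : _ = \sum_(l <- int_box d n) \sum_(p <- int_box d n) spectral (m0 + p)); last first.
    by rewrite big_const_seq count_predT size_int_box iter_addr_0 -[RHS]mulr_natl natrX.
  rewrite big_seq [leRHS]big_seq; apply: ler_sum => l lB.
  rewrite (eq_bigr (fun p => spectral (m0 + ((p + l) - l)))) => [|p _]; last by rewrite addrK.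
  rewrite -(big_map (fun p => p + l) predT (fun k => spectral (m0 + (k - l)))).
  apply: ler_sum_uniq_sub => [|k /mapP[p pB ->] _|k]; last exact: spectral_ge0.
    by rewrite map_inj_uniq ?uniq_int_box// => x y /addIr.
  move: lB pB; rewrite !mem_int_box => /forallP hl /forallP hp; apply/forallP => i.
  by rewrite !mxE addz_lt2.
apply: (@le_trans _ _ (\sum_(l <- int_box d (2 * n)) \sum_(k <- int_box d (2 * n)) spectral (m0 + (k - l)))).
  apply: ler_sum_uniq_sub => [|l|l]; first exact: uniq_int_box.
    rewrite !mem_int_box => /forallP hl _; apply/forallP => i.
    exact: ltz_double.
  by apply: sumr_ge0 => k _; exact: spectral_ge0.
rewrite exchange_big/=; apply: (le_trans (spectral_shift_le _ _)).
rewrite exchange_big/=.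
apply: (@le_trans _ _ (\sum_(l <- int_box d (2 * n)) U)).
  rewrite big_seq [leRHS]big_seq; apply: ler_sum => l lB.
  rewrite -(big_map (fun k => k - l) predT spectral).
  apply: ler_sum_uniq_sub => [|k /mapP[p pB ->] _|k]; last exact: spectral_ge0.
    by rewrite map_inj_uniq ?uniq_int_box// => x y /addIr.
  rewrite mem_sym_box; apply/max_norm_leP => i.
  move: lB pB; rewrite !mem_int_box => /forallP hl /forallP hp.
  by rewrite !mxE; exact: absz_subz_lt (hp i) (hl i).
rewrite big_const_seq count_predT size_int_box iter_addr_0 -[U *+ _]mulr_natl natrX natrM exprMn.
by rewrite mulrA [n%:R ^+ d * _]mulrC.
Qed.

End spectral_sum.

Lemma powRN_le (R : realType) (x y s : R) : 0 < x -> x <= y -> 0 <= s -> y `^ (- s) <= x `^ (- s).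
Proof.
move=> x0 xy s0; have y0 := lt_le_trans x0 xy.
rewrite !powRN lef_pV2 ?posrE ?powR_gt0// ge0_ler_powR// nnegrE ltW//.
Qed.

(** * Summation over distant blocks of frequencies *)

Section pseries.
Variables (R : realType) (d : nat).
Hypothesis d0 : (0 < d)%N.

(** Above 1, for convergence, and with d s = d + 1, so that d such factors make up the decay of
    degree d + 1. *)
Let s : R := 1 + d%:R^-1.

(* With a = (k+2)^(1/d) and b = (k+1)^(1/d), a^d - b^d = 1 gives a - b >= 1/(d a^(d-1)). *)
Lemma powR_telescope k : (k.+2%:R : R) `^ (- s) <=
  d%:R * (k.+1%:R `^ (- d%:R^-1) - k.+2%:R `^ (- d%:R^-1)).
Proof.
have dn0 : (d%:R : R) != 0 by rewrite pnatr_eq0 -lt0n.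
have dp : 0 < d%:R :> R by rewrite ltr0n.
pose a : R := k.+2%:R `^ d%:R^-1; pose b : R := k.+1%:R `^ d%:R^-1.
have a0 : 0 < a by rewrite powR_gt0.
have b0 : 0 < b by rewrite powR_gt0.
have pd (x : R) : 0 <= x -> (x `^ d%:R^-1) ^+ d = x.
  by move=> x0; rewrite -powR_mulrn ?powR_ge0// -powRrM mulVf// powRr1.
have aE : a ^+ d = k.+2%:R by exact: pd.
have bE : b ^+ d = k.+1%:R by exact: pd.
have ba : b <= a by rewrite ge0_ler_powR ?nnegrE ?invr_ge0// ler_nat.
have -> : k.+2%:R `^ (- s) = (a ^+ d * a)^-1.
  by rewrite powRN aE /a /s powRD ?powRr1//; apply/implyP => _; rewrite pnatr_eq0.
rewrite !powRN -/a -/b.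
have ab : 1 <= (a - b) * (d%:R * a ^+ d.-1).
  rewrite [leLHS](_ : _ = a ^+ d - b ^+ d); last by rewrite aE bE -natrB// subSnn.
  rewrite subrXX ler_wpM2l ?subr_ge0//.
  rewrite [leRHS](_ : _ = \sum_(i < d) a ^+ d.-1); last first.
    by rewrite sumr_const card_ord -[RHS]mulr_natl.
  apply: ler_sum => i _.
  rewrite [X in _ <= _ ^+ X](_ : d.-1 = (d.-1 - i) + i)%N; last by have := ltn_ord i; lia.
  by rewrite exprD ler_wpM2l ?exprn_ge0 ?(ltW a0)// lerXn2r ?nnegrE ?(ltW a0) ?(ltW b0).
have -> : d%:R * (b^-1 - a^-1) = (d%:R * (a - b)) / (a * b) by field; rewrite !gt_eqF.
have adE : a ^+ d = a * a ^+ d.-1 by rewrite -exprS prednK.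
have y0 : 0 < a ^+ d.-1 by rewrite exprn_gt0.
rewrite adE ler_pdivlMr ?mulr_gt0// -(ler_pM2l (mulr_gt0 (mulr_gt0 a0 y0) a0)) mulrA divff ?mul1r; last first.
  by rewrite !mulf_neq0 ?gt_eqF.
set y := a ^+ d.-1 in ab y0 *.
rewrite [leRHS](_ : _ = (a * a) * ((a - b) * (d%:R * y))); last by ring.
have aa : a * b <= a * a by rewrite ler_wpM2l ?(ltW a0).
by apply: (le_trans aa); rewrite ler_peMr// mulr_ge0 ?(ltW a0).
Qed.

Lemma pseries_le K : \sum_(k < K) (k.+1%:R : R) `^ (- s) <= 1 + d%:R.
Proof.
(* The telescoping starts after the first term, so the empty sum is a case of its own. *)
suff : \sum_(k < K) (k.+1%:R : R) `^ (- s) <= 1 + d%:R * (1 - K%:R `^ (- d%:R^-1)) \/ K = 0%N.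
  case=> [h|->]; last by rewrite big_ord0 addr_ge0.
  apply: (le_trans h); rewrite lerD2l ler_piMr// gerBl powR_ge0 //.
elim: K => [|[|K] IH]; [by right|left|left].
  by rewrite big_ord_recl big_ord0 addr0 !powR1 subrr mulr0 addr0.
rewrite big_ord_recr/=; case: IH => // IH.
by apply: (le_trans (lerD IH (powR_telescope K))); lra.
Qed.

Lemma pseries_sym_le Q :
  \sum_(j < (2 * Q).+1) ((1 + `|(j : nat)%:Z - Q%:Z|)%N%:R : R) `^ (- s) <= 2 * (1 + d%:R).
Proof.
pose g k : R := (k.+1%:R : R) `^ (- s).
rewrite (eq_bigr (fun j : 'I__ => g `|(j : nat)%:Z - Q%:Z|%N)); last by move=> j _; rewrite add1n.
rewrite -(big_mkord xpredT (fun j => g `|j%:Z - Q%:Z|%N)).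
rewrite (@big_cat_nat _ _ _ Q)//=; last by lia.
rewrite mulr_natl mulr2n lerD//.
  rewrite big_nat_rev/= add0n big_mkord; apply: le_trans (pseries_le Q).
  apply: ler_sum => i _; have -> : `|((Q - i.+1)%N : int) - Q%:Z|%N = i.+1 by have := ltn_ord i; lia.
  by apply: powRN_le; rewrite ?ltr0n ?ler_nat// addr_ge0 ?invr_ge0.
rewrite -{1}[Q]add0n big_addn big_mkord (_ : (2 * Q).+1 - Q = Q.+1)%N; last by lia.
apply: le_trans (pseries_le Q.+1); apply: ler_sum => i _.
by rewrite (_ : `|_|%N = i)//; lia.
Qed.

End pseries.

(** The quotient times n differs from z by less than n, so the left side is at most |z| + 2n, hence
    at most 3k. *)
Lemma quotient_bound (z : int) (n k : nat) : (`|z| <= k)%N -> (n < k)%N -> (0 < n)%N ->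
  ((1 + `|(z %/ n%:Z)%Z|) * n <= 3 * k)%N.
Proof.
move=> zk nk n0.
have r0 := modz_ge0 z (_ : n%:Z != 0).
have rn := @ltz_pmod z n%:Z; have E := divz_eq z n%:Z.
have {}r0 : 0 <= (z %% n%:Z)%Z by apply: r0; lia.
have {}rn : (z %% n%:Z)%Z < n%:Z by apply: rn; lia.
rewrite mulnDl mul1n (_ : `|(z %/ n%:Z)%Z| * n = `|((z %/ n%:Z)%Z * n%:Z)%R|)%N; last by rewrite abszM absz_nat.
by move: ((z %/ n%:Z)%Z * n%:Z) (z %% n%:Z)%Z E r0 rn => x r E r0 rn; lia.
Qed.

Lemma absz_divz_le (z : int) (n : nat) : (0 < n)%N -> (`|(z %/ n%:Z)%Z| <= `|z|)%N.
Proof.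
move=> n0.
have r0 : 0 <= (z %% n%:Z)%Z by apply: modz_ge0; lia.
have rn : (z %% n%:Z)%Z < n%:Z by apply: ltz_pmod; lia.
have := divz_eq z n%:Z.
move: (z %/ n%:Z)%Z (z %% n%:Z)%Z r0 rn => q r r0 rn E.
by have [q0|q0] := lerP 0 q; nia.
Qed.

Section spectral_tail.
Variables (R : realType) (d N : nat) (b : 'I_N -> 'cV[R]_d).
Hypothesis d0 : (0 < d)%N.
Implicit Types (m q p : 'cV[int]_d).

Let s : R := 1 + d%:R^-1.
Let s0 : 0 <= s. Proof. by rewrite addr_ge0 ?invr_ge0. Qed.
Let sd : s * d%:R = d.+1%:R.
Proof. by rewrite mulrDl mul1r mulVf ?pnatr_eq0 -?lt0n// -natr1. Qed.

Let G q : R := \prod_i ((1 + `|q i ord0|)%N%:R : R) `^ (- s).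

Let G0 q : 0 <= G q. Proof. by apply: prodr_ge0 => i _; exact: powR_ge0. Qed.

(** Cut Z^d into blocks n q + [0, n)^d. When [max_norm m] exceeds n, [quotient_bound] gives 1 +
    |q_i| <= 3 max_norm / n for every i, so the weight of m is at most (3/n)^(d+1) G(q), constant on
    a block. The sum of G factors over the coordinates, and each block sum is bounded by
    [spectral_block_le]. *)
Lemma spectral_tail_le n (F : seq 'cV[int]_d) : (0 < n)%N -> uniq F ->
  \sum_(m <- F | (n < max_norm m)%N) spectral b m / (max_norm m)%:R ^+ d.+1 <=
  (3 / n%:R) ^+ d.+1 * (2 * (1 + d%:R)) ^+ d *
    (2 ^+ d * \sum_(m <- sym_box d (2 * n)) spectral b m).
Proof.
move=> n0 uF; set U := 2 ^+ d * _.
have n0R : 0 < n%:R :> R by rewrite ltr0n.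
pose quo m : 'cV[int]_d := \col_i (m i ord0 %/ n%:Z)%Z.
pose h m : R := (3 / n%:R) ^+ d.+1 * (G (quo m) * spectral b m).
have h0 m : 0 <= h m by rewrite mulr_ge0 ?exprn_ge0 ?divr_ge0// mulr_ge0// spectral_ge0.
(* A crude range for the block indices; the final bound is uniform in Q. *)
pose Q := (\sum_(m <- F) max_norm m)%N.
apply: (@le_trans _ _ (\sum_(m <- F) h m)).
  rewrite big_mkcond/=; apply: ler_sum => m _; case: ifP => // nm.
  have m0 : 0 < (max_norm m)%:R :> R by rewrite ltr0n (leq_trans _ nm).
  rewrite /h mulrA [_ * spectral b m]mulrC ler_wpM2l ?spectral_ge0//.
  have -> : ((max_norm m)%:R ^+ d.+1)^-1 =
      (3 / n%:R) ^+ d.+1 * ((3 * (max_norm m)%:R / n%:R) `^ (- s)) ^+ d :> R.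
    rewrite -[X in _ * X]powR_mulrn ?powR_ge0// -powRrM mulNr sd powRN powR_mulrn; last first.
      by rewrite divr_ge0 ?mulr_ge0.
    rewrite -!exprVn -exprMn; congr (_ ^+ _); field.
    by rewrite !gt_eqF.
  rewrite ler_wpM2l ?exprn_ge0 ?divr_ge0// -[X in _ ^+ X]card_ord -prodr_const.
  apply: ler_prod => i _; rewrite powR_ge0/=; apply: powRN_le => //.
  rewrite ler_pdivlMr// -!natrM ler_nat mxE.
  apply: quotient_bound => //; exact: (max_norm_leP m (max_norm m) (leqnn _)).
apply: (@le_trans _ _ (\sum_(q <- sym_box d Q) \sum_(p <- int_box d n) h (n%:Z *: q + p))).
  rewrite [leRHS](_ : _ = \sum_(m <- [seq n%:Z *: q + p | q <- sym_box d Q, p <- int_box d n]) h m); last first.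
    by rewrite big_allpairs_dep.
  apply: ler_sum_uniq_sub => // m mF _.
  apply/allpairsP; exists (quo m, \col_i (m i ord0 %% n%:Z)%Z); split => /=.
  - rewrite mem_sym_box; apply/max_norm_leP => i; rewrite mxE.
    have mi := max_norm_leP m (max_norm m) (leqnn _) i.
    have mQ : (max_norm m <= Q)%N by rewrite /Q (perm_big _ (perm_to_rem mF)) big_cons leq_addr.
    by apply: leq_trans mQ; apply: leq_trans mi; exact: absz_divz_le.
  - rewrite mem_int_box; apply/forallP => i; rewrite mxE modz_ge0 ?ltz_pmod//; lia.
  - apply/matrixP => i j; rewrite (ord1 j) !mxE mulrC; exact: divz_eq.
have quoE q p : p \in int_box d n -> quo (n%:Z *: q + p) = q.
  rewrite mem_int_box => /forallP hp; apply/matrixP => i j; rewrite (ord1 j) !mxE.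
  have n0' : n%:Z != 0 by lia.
  by rewrite mulrC divzMDl// divz_small ?addr0//; have := hp i; rewrite ger0_norm.
apply: (@le_trans _ _ (\sum_(q <- sym_box d Q) ((3 / n%:R) ^+ d.+1 * G q * U))); last first.
  have U0 : 0 <= U by rewrite mulr_ge0 ?exprn_ge0// sumr_ge0// => m _; exact: spectral_ge0.
  rewrite -mulr_suml ler_wpM2r// -mulr_sumr ler_wpM2l ?exprn_ge0 ?divr_ge0//.
  rewrite big_map big_int_box /G.
  rewrite (eq_bigr (fun f : {ffun 'I_d -> 'I_(2 * Q).+1} =>
      \prod_i ((1 + `|(f i : nat)%:Z - Q%:Z|)%N%:R : R) `^ (- s))); last first.
    by move=> f _; apply: eq_bigr => i _; rewrite !mxE.
  rewrite -(bigA_distr_bigA (fun _ (j : 'I_(2 * Q).+1) => ((1 + `|(j : nat)%:Z - Q%:Z|)%N%:R : R) `^ (- s)))/=.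
  rewrite -[X in _ <= _ ^+ X]card_ord -prodr_const; apply: ler_prod => i _.
  rewrite sumr_ge0 ?pseries_sym_le// => j _; exact: powR_ge0.
apply: ler_sum => q _.
rewrite big_seq (eq_bigr (fun p => (3 / n%:R) ^+ d.+1 * G q * spectral b (n%:Z *: q + p))).
  rewrite -big_seq -mulr_sumr ler_wpM2l ?mulr_ge0 ?exprn_ge0 ?divr_ge0//.
  exact: spectral_block_le.
by move=> p pB; rewrite /h quoE// mulrA.
Qed.

End spectral_tail.

Lemma double_pred_succ d : (0 < d)%N -> (2 * d = d.-1 + d.+1)%N.
Proof. lia. Qed.

Section spectral_decay.
Variables (R : realType) (d : nat).
Hypothesis d0 : (0 < d)%N.

(* The weight of the frequencies up to about M is controlled by the hypothesis since be >= d + 1,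
   that of the others by comparing each translated box with the central one. *)
Lemma spectral_decay (be K : R) : d%:R + 1 <= be -> 0 <= K -> exists2 C : R, 0 <= C &
  forall N (b : 'I_N -> 'cV[R]_d) (M : R), (0 < N)%N -> M = N%:R `^ d%:R^-1 ->
  (forall n, \sum_(m <- sym_box d n | m != 0) (max_norm m)%:R `^ (- be) * spectral b m <=
     K * (M ^+ (2 * d) * M `^ (- be))) ->
  forall F : seq 'cV[int]_d, uniq F ->
  \sum_(m <- F | m != 0) spectral b m / (max_norm m)%:R ^+ d.+1 <= C * M ^+ d.-1.
Proof.
move=> bed K0.
pose C1 : R := 2 `^ (be - d.+1%:R) * K.
pose C2 : R := 3 ^+ d.+1 * (2 * (1 + d%:R)) ^+ d * (2 ^+ d * (1 + 4 `^ be * K)).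
have C10 : 0 <= C1 by rewrite mulr_ge0// powR_ge0.
have C20 : 0 <= C2.
  by rewrite !mulr_ge0// ?exprn_ge0// ?mulr_ge0 ?addr_ge0// ?mulr_ge0// powR_ge0.
exists (C1 + C2); first exact: addr_ge0.
move=> N b M N0 ME HB F uF.
have M1 : 1 <= M.
  have -> : 1 = 1 `^ d%:R^-1 :> R by rewrite powR1.
  by rewrite ME ge0_ler_powR ?nnegrE ?invr_ge0// ler1n.
have M0 : 0 < M by lra.
have NE : N%:R = M ^+ d :> R.
  by rewrite ME -powR_mulrn ?powR_ge0// -powRrM mulVf ?powRr1// pnatr_eq0 -lt0n.
have be0 : 0 <= be by have := ler0n R d; lra.
(* An integer cutoff with M <= n <= 2 M, since M >= 1. *)
pose n := (Num.truncn M).+1.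
have nM : M <= n%:R by apply: ltW; exact: truncnS_gt.
have n2M : n%:R <= 2 * M.
  have : (Num.truncn M)%:R <= M by rewrite truncn_le// ltW.
  rewrite /n -natr1; lra.
have n0 : 0 < n%:R :> R by rewrite ltr0n.
pose B := K * (M ^+ (2 * d) * M `^ (- be)).
have B0 : 0 <= B by rewrite !mulr_ge0 ?exprn_ge0 ?powR_ge0// ltW.
have sp0 m : 0 <= spectral b m by exact: spectral_ge0.
have Mp (x : R) : M `^ x * M `^ (- x) = 1.
  by rewrite -powRD ?subrr ?powRr0//; apply/implyP => _; rewrite gt_eqF.
have ME2 : M ^+ (2 * d) = M ^+ d.-1 * M ^+ d.+1.
  by rewrite -exprD (double_pred_succ d0).
have MbeE : M `^ (be - d.+1%:R) * (M ^+ (2 * d) * M `^ (- be)) = M ^+ d.-1.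
  have Md1 : M ^+ d.+1 = M `^ d.+1%:R by rewrite powR_mulrn// ltW.
  rewrite ME2 Md1; 
  transitivity (M ^+ d.-1 * ((M `^ (be - d.+1%:R) * M `^ d.+1%:R) * M `^ (- be))).
    by ring.
  by rewrite -powRD ?subrK ?Mp ?mulr1//; apply/implyP => _; rewrite gt_eqF.
(* The ratio of the weights of degrees -d-1 and -be is the power be - d - 1 >= 0 of [max_norm m], so
   it is largest at the cutoff, where it costs (2 M)^(be-d-1). *)
have low : \sum_(m <- F | (m != 0) && (max_norm m <= n)%N) spectral b m / (max_norm m)%:R ^+ d.+1
    <= C1 * M ^+ d.-1.
  apply: (@le_trans _ _ (n%:R `^ (be - d.+1%:R) * B)); last first.
    rewrite /B /C1 -MbeE mulrCA.
    rewrite [leRHS](_ : _ = K * ((2 * M) `^ (be - d.+1%:R) * (M ^+ (2 * d) * M `^ (- be)))); last first.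
      by rewrite powRM ?(ltW M0)//; ring.
    rewrite ler_wpM2l// ler_wpM2r ?mulr_ge0 ?exprn_ge0 ?powR_ge0 ?(ltW M0)//.
    rewrite ge0_ler_powR ?nnegrE ?mulr_ge0 ?(ltW M0) ?(ltW n0)//.
    by rewrite -natr1; lra.
  apply: (le_trans _ (ler_wpM2l (powR_ge0 _ _) (HB n))).
  rewrite mulr_sumr big_mkcond [leRHS]big_mkcond/=.
  pose f m : R := if (m != 0) && (max_norm m <= n)%N then spectral b m / (max_norm m)%:R ^+ d.+1 else 0.
  apply: (@le_trans _ _ (\sum_(m <- sym_box d n) f m)).
    apply: ler_sum_uniq_sub => // m; rewrite /f; case: ifP => //.
      by move=> /andP[_ mn] _ _; rewrite mem_sym_box.
    by rewrite eqxx.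
    by move=> _; rewrite divr_ge0 ?exprn_ge0.
  apply: ler_sum => m _; rewrite /f.
  have [m0|m0] := eqVneq m 0 => //=.
  case: ifP => mn; last by rewrite mulr_ge0 ?powR_ge0 ?mulr_ge0 ?powR_ge0.
  have r0 : 0 < (max_norm m)%:R :> R by rewrite ltr0n max_norm_gt0.
  rewrite mulrA [leLHS]mulrC ler_wpM2r//.
  have -> : ((max_norm m)%:R ^+ d.+1)^-1 = (max_norm m)%:R `^ (be - d.+1%:R) * (max_norm m)%:R `^ (- be) :> R.
    rewrite -powRD; last by apply/implyP => _; rewrite gt_eqF.
    by rewrite addrAC subrr sub0r powRN powR_mulrn// ltW.
  rewrite ler_wpM2r ?powR_ge0// ge0_ler_powR ?nnegrE ?(ltW r0) ?(ltW n0) ?ler_nat//.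
  by rewrite -natr1; lra.
have high : \sum_(m <- F | (m != 0) && ~~ (max_norm m <= n)%N) spectral b m / (max_norm m)%:R ^+ d.+1
    <= C2 * M ^+ d.-1.
  apply: (@le_trans _ _ (\sum_(m <- F | (n < max_norm m)%N) spectral b m / (max_norm m)%:R ^+ d.+1)).
    rewrite big_mkcond [leRHS]big_mkcond/=; apply: ler_sum => m _; rewrite ltnNge.
    by case: (m != 0) => //=; case: ifP => // _; rewrite divr_ge0 ?exprn_ge0.
  apply: (le_trans (spectral_tail_le b d0 (isT : (0 < n)%N) uF)).
  (* The frequency 0 contributes N^2 = M^(2d). For the others the weight of degree -be is at least
     (2n)^(-be), with 2n <= 4 M, so removing it costs (4 M)^be. *)
  have U : \sum_(m <- sym_box d (2 * n)) spectral b m <= (1 + 4 `^ be * K) * M ^+ (2 * d).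
    rewrite (bigD1_seq 0) ?uniq_sym_box//=; last by rewrite mem_sym_box; apply/max_norm_leP => i; rewrite mxE.
    rewrite spectral0 NE -exprM mulnC mulrDl mul1r lerD2l.
    apply: (@le_trans _ _ ((2 * n)%:R `^ be * B)).
      apply: (le_trans _ (ler_wpM2l (powR_ge0 _ _) (HB (2 * n)%N))).
      rewrite mulr_sumr big_seq_cond [leRHS]big_seq_cond; apply: ler_sum => m /andP[mB m0].
      have r0 : 0 < (max_norm m)%:R :> R by rewrite ltr0n max_norm_gt0.
      rewrite mulrA ler_peMl// powRN ler_pdivlMr ?powR_gt0// mul1r.
      by rewrite ge0_ler_powR ?nnegrE// ler_nat -mem_sym_box.
    rewrite /B (mulrCA _ K) [4 `^ be * K]mulrC -mulrA ler_wpM2l//.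
    apply: (@le_trans _ _ ((4 * M) `^ be * (M ^+ (2 * d) * M `^ (- be)))).
      rewrite ler_wpM2r ?mulr_ge0 ?exprn_ge0 ?powR_ge0 ?(ltW M0)//.
      rewrite ge0_ler_powR ?nnegrE ?mulr_ge0 ?(ltW M0)//.
      by rewrite natrM; lra.
    rewrite powRM ?(ltW M0)// -mulrA ler_wpM2l ?powR_ge0//.
    by rewrite mulrCA Mp mulr1.
  have nM' : (3 / n%:R) ^+ d.+1 <= 3 ^+ d.+1 / M ^+ d.+1 :> R.
    rewrite -expr_div_n lerXn2r ?nnegrE ?divr_ge0 ?(ltW M0)//.
    by rewrite ler_pM2l// lef_pV2.
  have fin (x y z t u w v : R) : x != 0 -> v = y * x ->
      z / x * t * (u * (w * v)) = z * t * (u * w) * y.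
    by clear; move=> x0 ->; field.
  rewrite /C2 -(fin _ _ _ _ _ _ _ (lt0r_neq0 (exprn_gt0 d.+1 M0)) ME2).
  have S0 : 0 <= \sum_(m <- sym_box d (2 * n)) spectral b m by apply: sumr_ge0.
  apply: ler_pM.
  - by rewrite mulr_ge0 ?exprn_ge0 ?divr_ge0 ?mulr_ge0 ?addr_ge0.
  - by rewrite mulr_ge0 ?exprn_ge0.
  - by rewrite ler_wpM2r ?exprn_ge0 ?mulr_ge0 ?addr_ge0.
  - by rewrite ler_wpM2l ?exprn_ge0.
by rewrite (bigID (fun m => (max_norm m <= n)%N))/= mulrDl lerD.
Qed.

End spectral_decay.

(** * From the quadrature estimate to the spectral sum *)

Section norm_comparison.
Variables (R : realType) (d : nat).

Lemma coord_le_enorm (x : 'cV[R]_d) i : `|x i ord0| <= enorm x.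
Proof.
rewrite -[leLHS]ger0_norm// -(@ler_pXn2r _ 2)// ?nnegrE ?enorm_ge0// enorm_sqr.
rewrite normr_id real_normK ?num_real// /dotv (bigD1 i)//= expr2 lerDl.
by apply: sumr_ge0 => j _; rewrite -expr2 sqr_ge0.
Qed.

Lemma mulmx_coord_le (B : 'M[R]_d) : exists2 C : R, 0 < C & forall (x : 'cV[R]_d) (t : R),
  (forall i, `|x i ord0| <= t) -> forall i, `|(B *m x) i ord0| <= C * t.
Proof.
exists (1 + \sum_i \sum_j `|B i j|).
  by rewrite ltr_pwDl// sumr_ge0// => i _; rewrite sumr_ge0.
move=> x t xt i; have t0 : 0 <= t by exact: le_trans (normr_ge0 _) (xt i).
rewrite mxE; apply: (le_trans (ler_norm_sum _ _ _)).
apply: (@le_trans _ _ ((\sum_j `|B i j|) * t)).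
  by rewrite mulr_suml; apply: ler_sum => j _; rewrite normrM ler_wpM2l.
rewrite ler_wpM2r// [X in _ <= 1 + X](bigD1 i)//= addrCA lerDl addr_ge0// sumr_ge0// => k _.
by rewrite sumr_ge0.
Qed.

Variable A : 'M[R]_d.
Hypothesis uA : A \in unitmx.

Lemma max_norm_le_dual : exists2 C : R, 0 < C & forall m, (max_norm m)%:R <= C * enorm (dual_vector A m).
Proof.
have [C C0 hC] := mulmx_coord_le A^T; exists C => // m.
have h := hC (dual_vector A m) _ (coord_le_enorm _).
have mi i : (`|m i ord0|%N)%:R <= C * enorm (dual_vector A m).
  have := h i; rewrite /dual_vector mulmxA -trmx_mul mulVmx// trmx1 mul1mx mxE.
  by rewrite -intr_norm -natr_absz.
rewrite /max_norm; elim/big_ind : _ => // [|x y xs ys].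
  by rewrite mulr_ge0 ?(ltW C0)// enorm_ge0.
by rewrite /maxn; case: ifP.
Qed.

(** A nonzero integer vector has max norm at least 1, which absorbs the summand 1 of the weight. *)
Lemma sobolev_weight_le : exists2 C : R, 1 <= C & forall m, m != 0 ->
  sobolev_weight A m <= C * (max_norm m)%:R ^+ 2.
Proof.
have [C C0 hC] := mulmx_coord_le (invmx A)^T.
pose C' : R := 4 * pi ^+ 2 * (d%:R * C ^+ 2).
have C'0 : 0 <= C' := mulr_ge0 (mulr_ge0 (ler0n _ 4) (sqr_ge0 _)) (mulr_ge0 (ler0n _ d) (sqr_ge0 _)).
exists (1 + C'); first by rewrite lerDl.
move=> m m0; rewrite mulrDl mul1r /sobolev_weight lerD//.
  by rewrite exprn_ege1// ler1n max_norm_gt0.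
rewrite /C' -[leRHS]mulrA ler_wpM2l ?(mulr_ge0 (ler0n _ 4) (sqr_ge0 _))// enorm_sqr.
rewrite -[X in X%:R * _](card_ord d) -mulrA mulr_natl -sumr_const; apply: ler_sum => i _.
rewrite -expr2 -[leLHS]real_normK ?num_real// -exprMn lerXn2r ?nnegrE ?(mulr_ge0 (ltW C0))//.
apply: hC => j; rewrite mxE -intr_norm -natr_absz ler_nat.
exact: (max_norm_leP m (max_norm m) (leqnn _)).
Qed.

Lemma sobolev_weight_gt0 m : 0 < sobolev_weight A m.
Proof. by rewrite ltr_pwDl// (mulr_ge0 (mulr_ge0 (ler0n _ 4) (sqr_ge0 _)) (sqr_ge0 _)). Qed.

Lemma dual_vectorN m : dual_vector A (- m) = - dual_vector A m.
Proof. by rewrite /dual_vector map_mxN mulmxN. Qed.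

Lemma sobolev_weightN m : sobolev_weight A (- m) = sobolev_weight A m.
Proof. by rewrite /sobolev_weight dual_vectorN !enorm_sqr dotvNl dotvNr opprK. Qed.

(* Testing the quadrature on sum_m h_m^(-alpha) (p_m cos + q_m sin), with p_m + i q_m the
   exponential sums of the points, makes both sides of the QMC estimate multiples of
   sum_m h_m^(-alpha) |p_m + i q_m|^2. *)
Lemma qmc_spectral_weight (alpha c : R) N (Y : 'I_N -> 'cV[R]_d) n :
  (0 < N)%N -> 0 <= c ->
  (forall f, sobolev A alpha f ->
     `|N%:R^-1 * \sum_(j < N) f (Y j) - torus_integral A f| <= c * sobolev_norm A alpha f) ->
  \sum_(m <- sym_box d n | m != 0)
     sobolev_weight A m `^ (- alpha) * spectral (fun j => invmx A *m Y j) m <=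
  (N%:R * c) ^+ 2.
Proof.
move=> N0 c0 hY; pose b j := invmx A *m Y j.
pose F := [seq m <- sym_box d n | m != 0].
pose cc m := sobolev_weight A m `^ (- alpha).
pose p m : R := \sum_j cos (phase m (b j)).
pose q m : R := \sum_j sin (phase m (b j)).
have uF : uniq F by rewrite filter_uniq// uniq_sym_box.
have symF m : (- m \in F) = (m \in F).
  by rewrite !mem_filter !mem_sym_box max_normN oppr_eq0.
have phN m a : phase (- m) a = - phase m a :> R.
  by rewrite -[- m]sub0r phaseB phase0 sub0r.
have cN m : cc (- m) = cc m by rewrite /cc sobolev_weightN.
have pN m : p (- m) = p m by apply: eq_bigr => j _; rewrite phN cosN.
have qN m : q (- m) = - q m by rewrite -sumrN; apply: eq_bigr => j _; rewrite phN sinN.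
have spE m : spectral b m = p m ^+ 2 + q m ^+ 2 by rewrite /spectral ReIm_sum_expi.
pose f := trig_poly A F cc p q.
have F0 : 0 \notin F by rewrite mem_filter eqxx.
have := hY f (sobolev_trig_poly alpha uA uF symF cN pN qN).
rewrite (integral_trig_poly uA uF symF cN pN qN F0) subr0.
pose S := \sum_(m <- F) cc m * spectral b m.
have S0 : 0 <= S by apply: sumr_ge0 => m _; rewrite mulr_ge0 ?powR_ge0 ?spectral_ge0.
have -> : \sum_(j < N) f (Y j) = S.
  transitivity (\sum_(j < N) \sum_(m <- F) cc m * (p m * cos (phase m (b j)) + q m * sin (phase m (b j)))).
    by apply: eq_bigr => j _; rewrite -(trig_poly_phase uA) /f /b mulKVmx.
  rewrite exchange_big/=; apply: eq_bigr => m _.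
  by rewrite -mulr_sumr big_split/= -!mulr_sumr spE !expr2.
have nf : sobolev_norm A alpha f <= Num.sqrt S.
  rewrite /sobolev_norm ler_wsqrtr//.
  have := sobolev_trig_poly_le alpha uA uF symF cN pN qN; rewrite -/f.
  have -> : \sum_(m <- F) sobolev_weight A m `^ alpha * (cc m ^+ 2 * (p m ^+ 2 + q m ^+ 2)) = S.
    apply: eq_bigr => m _; rewrite -spE expr2 !mulrA; congr (_ * _).
    rewrite /cc -powRD ?subrr ?powRr0 ?mul1r//.
    by apply/implyP => _; rewrite gt_eqF// sobolev_weight_gt0.
  have q0 : (0 <= sobolev_sqnorm A alpha f)%E.
    by apply: esum_ge0 => w _; rewrite lee_fin mulr_ge0 ?powR_ge0 ?sqr_ge0.
  by move: q0; case: (sobolev_sqnorm A alpha f) => [x| |]//=.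
rewrite ger0_norm ?mulr_ge0 ?invr_ge0// => hS.
have N0R : 0 < N%:R :> R by rewrite ltr0n.
(* The point sum is exactly S and the norm at most its root; dividing by the root leaves the
   claim. *)
have {}hS : S <= N%:R * c * Num.sqrt S.
  rewrite -mulrA -ler_pdivrMl//; apply: (le_trans hS); rewrite ler_wpM2l//.
rewrite -big_filter -/F -/b -/S.
have sS : Num.sqrt S ^+ 2 = S by rewrite sqr_sqrtr.
have [s0|s0] := eqVneq (Num.sqrt S) 0.
  by rewrite -sS s0 expr0n/= sqr_ge0.
have sp : 0 < Num.sqrt S by rewrite lt_def s0 sqrtr_ge0.
have : Num.sqrt S <= N%:R * c.
  by rewrite -(ler_pM2r sp) -expr2 sS.
by move=> h; rewrite -sS lerXn2r ?nnegrE ?sqrtr_ge0// mulr_ge0.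
Qed.

(** [spectral_decay] is used with be = 2 alpha and K = W^alpha c^2: the Sobolev weight to the power
    -alpha dominates W^(-alpha) max_norm^(-2 alpha), and N c N^(-alpha/d) squared is c^2 M^(2d)
    M^(-2 alpha) for M = N^(1/d). *)
Lemma qmc_spectral_decay (alpha : R) (X : forall N, 'I_N -> 'cV[R]_d) :
  (0 < d)%N -> (d%:R + 1) / 2 < alpha -> qmc_design A alpha X ->
  exists2 C : R, 0 <= C & forall N, (0 < N)%N -> forall F, uniq F ->
    \sum_(m <- F | m != 0) spectral (fun j => invmx A *m X N j) m / (max_norm m)%:R ^+ d.+1 <=
    C * (N%:R `^ d%:R^-1) ^+ d.-1.
Proof.
move=> d0 ha [c c0 hX].
have [W W1 hW] := sobolev_weight_le.
have W0 : 0 < W by lra.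
have al0 : 0 <= alpha by have := ler0n R d; lra.
have be : d%:R + 1 <= 2 * alpha by lra.
have K0 : 0 <= W `^ alpha * c ^+ 2 by rewrite mulr_ge0 ?powR_ge0 ?sqr_ge0.
have [C C0 hC] := spectral_decay d0 be K0.
exists C => // N N0 F uF.
apply: (hC _ _ _ N0 erefl) uF => n.
set M := N%:R `^ _; have N0R : 0 < N%:R :> R by rewrite ltr0n.
have M0 : 0 < M by rewrite powR_gt0.
have dn0 : (d%:R : R) != 0 by rewrite pnatr_eq0 -lt0n.
have cN0 : 0 <= c * N%:R `^ (- (alpha / d%:R)) by rewrite mulr_ge0 ?powR_ge0// ltW.
have h := qmc_spectral_weight n N0 cN0 (fun f sf => hX f sf N N0).
have -> : W `^ alpha * c ^+ 2 * (M ^+ (2 * d) * M `^ (- (2 * alpha))) =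
    W `^ alpha * (N%:R * (c * N%:R `^ (- (alpha / d%:R)))) ^+ 2.
  have -> : M ^+ (2 * d) = N%:R ^+ 2.
    rewrite mulnC exprM; congr (_ ^+ _).
    by rewrite /M -powR_mulrn ?powR_ge0// -powRrM mulVf// powRr1// ltW.
  have -> : M `^ (- (2 * alpha)) = (N%:R `^ (- (alpha / d%:R))) ^+ 2.
    rewrite -powR_mulrn ?powR_ge0// -!powRrM; congr (_ `^ _); ring.
  by rewrite !exprMn; ring.
apply: le_trans (ler_wpM2l (powR_ge0 _ _) h); rewrite mulr_sumr.
apply: ler_sum => m m0.
rewrite mulrA ler_wpM2r ?spectral_ge0//.
have n0 : 0 < (max_norm m)%:R :> R by rewrite ltr0n max_norm_gt0.
apply: (@le_trans _ _ (W `^ alpha * (W * (max_norm m)%:R ^+ 2) `^ (- alpha))); last first.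
  by rewrite ler_wpM2l ?powR_ge0// powRN_le// ?sobolev_weight_gt0// hW.
rewrite powRM ?exprn_ge0 ?(ltW W0)// mulrA -powRD ?subrr ?powRr0 ?mul1r; last first.
  by apply/implyP => _; rewrite gt_eqF.
by rewrite -powR_mulrn ?(ltW n0)// -powRrM mulrN.
Qed.

End norm_comparison.

Lemma absz_le_itv (z : int) (n : nat) : - n%:Z <= z <= n%:Z -> (`|z| <= n)%N.
Proof. lia. Qed.

(** * Fourier coefficients of the discrepancy of balls *)

Section lattice_sum.
Variables (R : realType) (d : nat) (A : 'M[R]_d).
Hypothesis uA : A \in unitmx.
Variables (r : R) (K : nat).
Hypothesis r0 : 0 <= r.
Hypothesis hK : forall x : 'cV[R]_d, cball r (A *m x) -> forall i, `|x i ord0| + 1 <= K%:R.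

Definition in_ball (b a : 'cV[R]_d) (k : 'cV[int]_d) : bool :=
  dotv (A *m (b + map_mx intr k - a)) (A *m (b + map_mx intr k - a)) <= r ^+ 2.

Lemma card_fset_set_seq (T : choiceType) (s : seq T) : uniq s ->
  #|` fset_set [set` s]| = size s.
Proof.
move=> us; have -> : [set` s] = [set` seq_fset tt s].
  by apply/seteqP; split => x /=; have /= -> := seq_fsetE tt s x.
by rewrite set_fsetK size_seq_fset undup_id.
Qed.

(** The summand 1 in [hK] pays for the distance of a and b in each coordinate. *)
Lemma in_ball_sym_box a b k : cube d a -> cube d b -> in_ball b a k -> k \in sym_box d K.
Proof.
move=> ca cb h; rewrite mem_sym_box; apply/max_norm_leP => i.
rewrite -(ler_nat R) natr_absz intr_norm.
have := hK h i; rewrite !mxE => hi.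
have /andP[a0 a1] := ca i; have /andP[b0 b1] := cb i.
move: hi a0 a1 b0 b1; move: (a i ord0) (b i ord0) (k i ord0)%:~R (K%:R) => x y z t.
move=> + x0 x1 y0 y1; have := ler_normB (y + z - x) (y - x).
rewrite (_ : y + z - x - (y - x) = z); last by ring.
have : `|y - x| <= 1 by rewrite ler_norml; apply/andP; split; lra.
by move=> h1 h2 h3; apply: (le_trans h2); lra.
Qed.

(** [fset_set] is meaningful on finite sets only, so the counted lattice vectors are exhibited as a
    duplicate-free list. *)
Lemma ball_indicatorE a b : cube d a -> cube d b ->
  ball_indicator A (A *m a) r (A *m b) = (\sum_(k <- sym_box d K) in_ball b a k)%N.
Proof.
move=> ca cb; rewrite /ball_indicator.
pose s := [seq A *m map_mx intr k | k <- [seq k <- sym_box d K | in_ball b a k]].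
have -> : [set v | lattice A v /\ enorm (A *m b + v - A *m a) <= r] = [set` s].
  apply/seteqP; split => v /=.
    move=> [[k ->]]; rewrite -mulmxDr -mulmxBr enorm_le// -/(in_ball b a k) => h.
    by apply/mapP; exists k => //; rewrite mem_filter h (in_ball_sym_box ca cb h).
  move=> /mapP[k]; rewrite mem_filter => /andP[h _] ->; split; first by exists k.
  by rewrite -mulmxDr -mulmxBr enorm_le.
rewrite card_fset_set_seq ?size_map ?size_filter ?sum1_count -?sum1_count.
  by rewrite big_mkcond/=; apply: eq_bigr => k _; case: in_ball.
rewrite map_inj_uniq ?filter_uniq ?uniq_sym_box// => k l /(congr1 (mulmx (invmx A))).
rewrite !mulKmx// => /matrixP h; apply/matrixP => i j; have := h i j.
by rewrite !mxE => /intr_inj.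
Qed.

(* x + k is in the cube for k = - floor x only. *)
Lemma sym_box_tile (x : 'cV[R]_d) : (forall i, `|x i ord0| <= K%:R) ->
  \sum_(k <- sym_box d K) \1_(cube d) (x + map_mx intr k) = 1 :> R.
Proof.
move=> hx; pose k0 : 'cV[int]_d := \col_i (- Num.floor (x i ord0)).
have hk0 k : cube d (x + map_mx intr k) <-> k = k0.
  split=> [h|->].
    apply/matrixP => i j; rewrite (ord1 j) mxE; have := h i; rewrite !mxE => /andP[h0 h1].
    rewrite (@floor_def _ _ (- k i ord0)) ?opprK// !rmorphD !rmorphN/=.
    by apply/andP; split; [lra|rewrite mulr1z; lra].
  move=> i; rewrite !mxE rmorphN/=; have := floor_itv (x i ord0); rewrite rmorphD/= => /andP[h0 h1].
  by apply/andP; split; lra.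
have k0K : k0 \in sym_box d K.
  rewrite mem_sym_box; apply/max_norm_leP => i; rewrite mxE abszN; apply: absz_le_itv.
  have := hx i; rewrite !ler_norml => /andP[h0 h1]; apply/andP; split.
    by rewrite floor_ge_int rmorphN.
  have := floor_itv (x i ord0) => /andP[h2 _].
  by rewrite -(ler_int R); exact: le_trans h2 h1.
rewrite (bigD1_seq k0 k0K (uniq_sym_box _ _))/= big1 => [|k /eqP kk0].
  by rewrite addr0 indicE mem_set//; exact/hk0.
by rewrite indicE memNset// => /hk0.
Qed.

(** Unfolding: translation by k turns each term into the integral over the part of T in one
    translate of the cube, and these translates tile T. *)
Lemma integral_tile (T : set 'cV[R]_d) (f : 'cV[R]_d -> R) (M : R) :
  measurable T -> (lebesgue_cV T < +oo)%E -> (forall x, T x -> forall i, `|x i ord0| <= K%:R) ->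
  measurable_fun setT f -> (forall x, `|f x| <= M) ->
  \sum_(k <- sym_box d K) \int[lebesgue_cV]_(a in cube d)
     (\1_T (a - map_mx intr k) * f (a - map_mx intr k)) = \int[lebesgue_cV]_(x in T) f x.
Proof.
move=> mT Tf TK mf fM; pose t (k : 'cV[int]_d) : 'cV[R]_d := map_mx intr k.
have mt k (D : set 'cV[R]_d) : measurable D -> measurable [set x | D (x + t k)].
  move=> mD; have := measurable_mulmx_add (1%:M : 'M[R]_d) (t k) measurableT mD.
  by rewrite setTI; congr measurable; apply/seteqP; split => x /=; rewrite /preimage/= mul1mx.
have mc k := mt k _ (@measurable_cube R d).
have step k : \int[lebesgue_cV]_(a in cube d) (\1_T (a - t k) * f (a - t k)) =
    \int[lebesgue_cV]_(x in T) (\1_(cube d) (x + t k) * f x).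
  transitivity (\int[lebesgue_cV]_(x in [set x | cube d (x + t k)]) (\1_T x * f x)).
    have u1 : (1%:M : 'M[R]_d) \in unitmx by exact: unitmx1.
    have mh : measurable_fun [set x | cube d (x + t k)] (fun x => \1_T x * f x).
      by apply: measurable_funTS; apply: measurable_funM.
    rewrite -(Rintegral_affine (- t k) u1 (mc k) mh) det1 normr1 mul1r.
    have -> : [set x | [set x0 | cube d (x0 + t k)] (1%:M *m x - t k)] = cube d.
      by apply/seteqP; split => x /=; rewrite mul1mx subrK.
    by apply: eq_Rintegral => x _; rewrite mul1mx.
  rewrite Rintegral_mkcond [RHS]Rintegral_mkcond; apply: eq_Rintegral => x _.
  rewrite /patch !indicE.
  have -> : (x \in [set x | cube d (x + t k)]) = (x + t k \in cube d).
    by apply/idP/idP => /set_mem h; apply/mem_set.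
  by case: (x \in T); case: (x + t k \in cube d); rewrite ?mul0r ?mul1r.
under eq_bigr do rewrite step.
rewrite -Rintegral_sum//.
  apply: eq_Rintegral => x /set_mem xT.
  by rewrite -mulr_suml sym_box_tile ?mul1r//; exact: TK.
move=> k; apply: (integrable_bounded (M := M)) => //.
  apply: measurable_funM => //.
  have : measurable_fun setT (\1_[set x | cube d (x + t k)] : 'cV[R]_d -> R).
    exact: measurable_indic (mc k).
  by apply: eq_measurable_fun => x _; rewrite /= !indicE; congr ((nat_of_bool _)%:R).
move=> x; rewrite normrM -[leRHS]mul1r; apply: ler_pM => //.
by rewrite indicE; case: (_ \in _); rewrite ?normr1 ?normr0.
Qed.

End lattice_sum.

Section discrepancy.
Variables (R : realType) (d : nat) (A : 'M[R]_d).
Hypothesis uA : A \in unitmx.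
Variables (r : R) (K : nat).
Hypothesis r0 : 0 <= r.
Hypothesis hK : forall x : 'cV[R]_d, cball r (A *m x) -> forall i, `|x i ord0| + 1 <= K%:R.

(** Linear part of the substitution a = b - A^(-1) x, the inverse of x = A (b - a). *)
Let B : 'M[R]_d := - invmx A.

Let uB : B \in unitmx.
Proof. by rewrite /B -scaleN1r unitmxZ ?unitrN1// unitmx_inv. Qed.

Let detB : `|\det B| = (covolume A)^-1.
Proof.
by rewrite /B -scaleN1r detZ normrM normrX normrN1 expr1n mul1r det_inv normfV.
Qed.

Let cell (b : 'cV[R]_d) : set 'cV[R]_d := [set x | cball r (A *m (b - x))].

Let measurable_cell b : measurable (cell b).
Proof.
have := measurable_mulmx_add (- A) (A *m b) measurableT (@measurable_cball R d r).
rewrite setTI; congr measurable; apply/seteqP; split => x /=;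
  by rewrite /preimage/= mulNmx addrC -mulmxBr.
Qed.

Let cellE b : [set x | cell b (B *m x + b)] = cball r.
Proof.
apply/seteqP; split => x /=; rewrite /cell/= /B mulNmx opprD opprK addrCA subrr addr0;
  by rewrite mulKVmx.
Qed.

Let lebesgue_cell_lty b : (lebesgue_cV (cell b) < +oo)%E.
Proof.
rewrite -(lebesgue_cV_affine b uB (measurable_cell b)) cellE.
by rewrite [X in (_ * X)%E]lebesgue_cball// -EFinM ltry.
Qed.

Let in_ballE b a k : ((in_ball A r b a k)%:R : R) = \1_(cell b) (a - map_mx intr k).
Proof.
rewrite indicE /in_ball; congr ((nat_of_bool _)%:R).
have -> : b + map_mx intr k - a = b - (a - map_mx intr k) by rewrite opprB addrA.
by apply/idP/idP => [h|/set_mem//]; exact: mem_set.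
Qed.

Definition ball_cos m : R :=
  \int[lebesgue_cV]_(x in cball r) cos (2 * pi * dotv (dual_vector A m) x).

Lemma ball_cos0 : ball_cos 0 = unit_ball_volume d * r ^+ d.
Proof.
transitivity (\int[lebesgue_cV]_(x in @cball R d r) (1 : R)).
  by apply: eq_Rintegral => x _; rewrite /dual_vector map_mx0 mulmx0 dotv0l mulr0 cos0.
rewrite Rintegral_cst ?mul1r; last exact: measurable_cball.
by rewrite -[RHS]/(fine _%:E) -lebesgue_cball.
Qed.

(** Integer shifts change the phase by multiples of 2 pi, so the sum over k unfolds to an integral
    over one ellipsoid. The substitution by [B] makes it a ball, where the sine part vanishes by
    symmetry. *)
Lemma integral_in_ball b m th : cube d b ->
  \sum_(k <- sym_box d K) \int[lebesgue_cV]_(a in cube d)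
    ((in_ball A r b a k)%:R * cos (phase m a + th)) =
  (covolume A)^-1 * (cos (phase m b + th) * ball_cos m).
Proof.
move=> cb; have mcos : measurable_fun setT (fun x : 'cV[R]_d => cos (phase m x + th)).
  by apply: measurable_cos_comp; apply: measurable_funD => //; exact: measurable_phase.
transitivity (\int[lebesgue_cV]_(x in cell b) cos (phase m x + th)).
  rewrite -(integral_tile (K := K) (M := 1) (measurable_cell b))//.
  - apply: eq_bigr => k _; apply: eq_Rintegral => a _; rewrite in_ballE; congr (_ * _).
    rewrite phaseBr.
    have [z ->] : exists z : int, phase m (map_mx intr k) = z%:~R * (2 * pi) :> R.
      exists (\sum_i m i ord0 * k i ord0); rewrite /phase mulrC rmorph_sum; congr (_ * _).
      by apply: eq_bigr => i _; rewrite !mxE rmorphM.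
    by rewrite -[LHS](cosD2piz _ (- z)) rmorphN/= mulNr addrAC.
  - move=> x cx i; have := hK cx i; have /andP[b0 b1] := cb i; rewrite !mxE.
    move: (x i ord0) (b i ord0) b0 b1 (K%:R) => y z z0 z1 t.
    have := ler_normB (z - y) z; rewrite (_ : z - y - z = - y) ?normrN; last by ring.
    by rewrite [in `|z|]ger0_norm// => h1 h2; apply: (le_trans h1); lra.
  - by move=> x; exact: norm_cos_le1.
have mb := @measurable_cball R d r.
rewrite -(Rintegral_affine b uB (measurable_cell b) (measurable_funTS mcos)) cellE detB.
congr (_ * _); set u := phase m b + th.
pose w := dual_vector A m.
have mw : measurable_fun setT (fun x => 2 * pi * dotv w x).
  by apply: measurable_funM => //; exact: measurable_dotv_l.
transitivity (\int[lebesgue_cV]_(x in cball r)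
    (cos u * cos (2 * pi * dotv w x) + sin u * sin (2 * pi * dotv w x))).
  apply: eq_Rintegral => x _; rewrite -cosB /u; congr cos.
  have -> : B *m x + b = b - invmx A *m x by rewrite /B mulNmx addrC.
  rewrite phaseBr addrAC; congr (_ - _).
  by rewrite /phase -(dotv_dual uA) mulKVmx.
have ic (f : 'cV[R]_d -> R) (c : R) : measurable_fun setT f -> (forall x, `|f x| <= 1) ->
    lebesgue_cV.-integrable (cball r) (EFin \o f) /\
    lebesgue_cV.-integrable (cball r) (EFin \o (fun x => c * f x)).
  move=> mf f1; have h : lebesgue_cV.-integrable (cball r) (EFin \o f).
    by apply: (integrable_bounded (M := 1)) => //; exact: lebesgue_cball_lty.
  by split => //; exact: integrable_EFinZ.
have [i1 i1'] := ic _ (cos u) (measurable_cos_comp mw) (fun x => norm_cos_le1 _).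
have [i2 i2'] := ic _ (sin u) (measurable_sin_comp mw) (fun x => norm_sin_le1 _).
by rewrite RintegralD// !RintegralZl// sin_ball_eq0// mulr0 addr0.
Qed.

Variables (N : nat) (b : 'I_N -> 'cV[R]_d).
Hypothesis cb : forall j, cube d (b j).

(** The integrand of the number variance in lattice coordinates. The fixed finite range of k makes
    it bounded and measurable on all of R^d; on the cube it agrees with the periodized count. *)
Definition discrepancy a : R :=
  \sum_j \sum_(k <- sym_box d K) (in_ball A r (b j) a k)%:R - N%:R * ball_vol A r.

Let measurable_in_ball j k : measurable_fun setT (fun a => (in_ball A r (b j) a k)%:R : R).
Proof.
pose c := map_mx intr k : 'cV[R]_d.
have mT : measurable [set a | cell (b j) (a - c)].
  have := measurable_mulmx_add (1%:M : 'M[R]_d) (- c) measurableT (measurable_cell (b j)).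
  by rewrite setTI; congr measurable; apply/seteqP; split => x /=; rewrite /preimage/= mul1mx.
have : measurable_fun setT (\1_[set a | cell (b j) (a - c)] : 'cV[R]_d -> R).
  exact: measurable_indic mT.
by apply: eq_measurable_fun => x _; rewrite in_ballE/= !indicE; congr ((nat_of_bool _)%:R).
Qed.

Lemma measurable_discrepancy : measurable_fun setT discrepancy.
Proof.
apply: measurable_funB => //.
by apply: measurable_sum => j; apply: measurable_sum => k.
Qed.

Lemma norm_discrepancy_le a :
  `|discrepancy a| <= N%:R * (size (sym_box d K))%:R + `|N%:R * ball_vol A r|.
Proof.
apply: (le_trans (ler_normB _ _)); rewrite lerD2r ger0_norm; last first.
  by apply: sumr_ge0 => j _; apply: sumr_ge0.
apply: (@le_trans _ _ (\sum_(j < N) (size (sym_box d K))%:R)).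
  apply: ler_sum => j _; rewrite -sum1_size natr_sum; apply: ler_sum => k _.
  by rewrite ler_nat leq_b1.
by rewrite sumr_const card_ord mulr_natl.
Qed.

Lemma integral_discrepancy_cos m th :
  \int[lebesgue_cV]_(a in cube d) (discrepancy a * cos (phase m a + th)) =
  (covolume A)^-1 * ball_cos m * (\sum_j cos (phase m (b j) + th)) -
  N%:R * ball_vol A r * ((m == 0)%:R * cos th).
Proof.
pose f a := cos (phase m a + th) : R.
have mcos : measurable_fun setT (fun x : 'cV[R]_d => cos (phase m x + th)).
  by apply: measurable_cos_comp; apply: measurable_funD => //; exact: measurable_phase.
have i1 j k : lebesgue_cV.-integrable (cube d) (EFin \o (fun a => (in_ball A r (b j) a k)%:R * f a)).
  apply: (integrable_cube (M := 1)); first exact: measurable_funM.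
  move=> x; rewrite normrM -[leRHS]mul1r; apply: ler_pM => //; last exact: norm_cos_le1.
  by case: in_ball; rewrite ?normr1 ?normr0.
have i2 : lebesgue_cV.-integrable (cube d) (EFin \o f).
  by apply: (integrable_cube (M := 1)) => // x; exact: norm_cos_le1.
have mC := @measurable_cube R d.
under eq_Rintegral do rewrite /discrepancy mulrBl mulr_suml.
rewrite RintegralB//; first last.
- exact: integrable_EFinZ.
- apply: integrable_EFin_sum => // j; under eq_fun do rewrite mulr_suml.
  exact: integrable_EFin_sum.
rewrite RintegralZl// integral_cube_phase; congr (_ - _).
rewrite Rintegral_sum//; last first.
  by move=> j; under eq_fun do rewrite mulr_suml; exact: integrable_EFin_sum.
rewrite mulr_sumr; apply: eq_bigr => j _.
under eq_Rintegral do rewrite mulr_suml.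
by rewrite Rintegral_sum// integral_in_ball// mulrAC mulrA.
Qed.

Lemma discrepancy_fourier m :
  fourier_cos discrepancy m ^+ 2 + fourier_sin discrepancy m ^+ 2 =
  if m == 0 then 0 else ((covolume A)^-1 * ball_cos m) ^+ 2 * spectral b m.
Proof.
have -> : fourier_cos discrepancy m =
    \int[lebesgue_cV]_(a in cube d) (discrepancy a * cos (phase m a + 0)).
  by apply: eq_Rintegral => a _; rewrite addr0.
have -> : fourier_sin discrepancy m =
    \int[lebesgue_cV]_(a in cube d) (discrepancy a * cos (phase m a + - (pi / 2))).
  by apply: eq_Rintegral => a _; rewrite cosBpihalf.
rewrite !integral_discrepancy_cos; have [->|m0] := eqVneq m 0.
  (* At frequency 0 the subtracted mean is exact, by [ball_volE]. *)
  have e th : (covolume A)^-1 * ball_cos 0 * (\sum_j cos (phase 0 (b j) + th)) -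
      N%:R * ball_vol A r * (1 * cos th) = 0.
    under eq_bigr do rewrite phase0 add0r.
    by rewrite sumr_const card_ord ball_cos0 ball_volE -mulr_natl; ring.
  by rewrite !e expr0n addr0.
rewrite !mul0r !mulr0 !subr0 !exprMn -mulrDr; congr (_ * _).
rewrite /spectral ReIm_sum_expi; congr (_ ^+ 2 + _ ^+ 2).
  by apply: eq_bigr => j _; rewrite addr0.
by apply: eq_bigr => j _; rewrite cosBpihalf.
Qed.

Lemma in_ball_near j k a : dotv (A *m (b j + map_mx intr k - a)) (A *m (b j + map_mx intr k - a)) != r ^+ 2 ->
  \forall x \near a, in_ball A r (b j) x k = in_ball A r (b j) a k.
Proof.
set c := b j + map_mx intr k.
have cvg : dotv (A *m (c - x)) (A *m (c - x)) @[x --> a] --> dotv (A *m (c - a)) (A *m (c - a)).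
  apply: continuous_sum_at => i.
  have ci : (A *m (c - x)) i ord0 @[x --> a] --> (A *m (c - a)) i ord0.
    under eq_fun do rewrite mxE; rewrite mxE; apply: continuous_sum_at => l.
    under eq_fun do rewrite !mxE; rewrite !mxE.
    have cl : x l ord0 @[x --> a] --> a l ord0 by exact: (@coord_continuous R d 1 l ord0 a).
    apply: (@cvgM R 'cV[R]_d (nbhs a)); first exact: cvg_cst.
    by apply: cvgB => //; exact: cvg_cst.
  exact: (@cvgM R 'cV[R]_d (nbhs a)).
rewrite neq_lt => /orP[h|h]; near=> x; rewrite /in_ball -/c.
  rewrite (ltW h); apply: ltW; near: x; exact: (cvgr_lt _ cvg).
rewrite [RHS]leNgt h; apply/negbTE; rewrite -ltNge; near: x; exact: (cvgr_gt _ cvg).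
Unshelve. all: by end_near. Qed.

Lemma near_sum (I : eqType) (s : seq I) (F : I -> 'cV[R]_d -> R) a :
  (forall i, i \in s -> \forall x \near a, F i x = F i a) ->
  \forall x \near a, \sum_(i <- s) F i x = \sum_(i <- s) F i a.
Proof.
elim: s => [_|i s IH h]; first by near=> x; rewrite !big_nil.
near=> x; rewrite !big_cons; congr (_ + _); near: x.
  by apply: h; rewrite mem_head.
by apply: IH => j js; apply: h; rewrite inE js orbT.
Unshelve. all: by end_near. Qed.

End discrepancy.

(** * The variance bound and the three kinds of hyperuniformity *)

Section variance_bound.
Variables (R : realType) (d : nat) (A : 'M[R]_d.+1).
Hypothesis uA : A \in unitmx.

Lemma lebesgue_in_ball_boundary (c : 'cV[R]_d.+1) (s : R) :
  measurable [set a | dotv (A *m (c - a)) (A *m (c - a)) = s] /\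
  lebesgue_cV [set a | dotv (A *m (c - a)) (A *m (c - a)) = s] = 0%E.
Proof.
pose S : set 'cV[R]_d.+1 := [set x | dotv (x - 0) (x - 0) = s].
have mS : measurable S.
  by have := @measurable_sub_enorm R d.+1 0 measurableT _ (measurable_set1 s); rewrite setTI.
have uB : - A \in unitmx by rewrite -scaleN1r unitmxZ ?unitrN1.
have E : [set a | dotv (A *m (c - a)) (A *m (c - a)) = s] = [set x | S (- A *m x + A *m c)].
  have e x : - A *m x + A *m c = A *m (c - x) by rewrite mulNmx addrC -mulmxBr.
  by apply/seteqP; split => x /=; rewrite /S/= subr0 e.
rewrite E; split.
  by have := measurable_mulmx_add (- A) (A *m c) measurableT mS; rewrite setTI.
have := lebesgue_cV_affine (A *m c) uB mS.
rewrite [X in _ = X -> _]lebesgue_cV_sphere => /eqP.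
rewrite mule_eq0 eqe normr_eq0 => /orP[/eqP h|/eqP//].
by move: uB; rewrite unitmxE h unitr0.
Qed.

Variables (r : R) (K : nat).
Hypothesis r0 : 0 <= r.
Hypothesis hK : forall x : 'cV[R]_d.+1, cball r (A *m x) -> forall i, `|x i ord0| + 1 <= K%:R.

Lemma number_varianceE N (Y : 'I_N -> 'cV[R]_d.+1) :
  (forall j, fundamental_domain A (Y j)) ->
  number_variance A Y r =
  \int[lebesgue_cV]_(a in cube d.+1) discrepancy A r K (fun j => invmx A *m Y j) a ^+ 2.
Proof.
move=> hY; pose b j := invmx A *m Y j; pose D := discrepancy A r K b.
have cb j : cube d.+1 (b j) by have := hY j; rewrite fundamental_domainE.
have mD : measurable_fun setT D by exact: measurable_discrepancy.
pose M : R := N%:R * (size (sym_box d.+1 K))%:R + `|N%:R * ball_vol A r|.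
have DM a : `|D a| <= M by exact: norm_discrepancy_le.
pose f u := D (invmx A *m u) ^+ 2.
have mf : measurable_fun setT f.
  apply: measurable_funX; apply: (measurableT_comp mD).
  have := measurable_mulmx_add (invmx A) 0.
  by under eq_fun do rewrite addr0.
have fM u : `|f u| <= M ^+ 2.
  by rewrite /f normrX lerXn2r ?nnegrE// (le_trans (normr_ge0 _) (DM 0)).
transitivity (torus_integral A f).
  apply: eq_Rintegral => x /set_mem; rewrite (fundamental_domainE uA)/= => cx.
  rewrite /f /D /discrepancy; congr ((_ - _) ^+ 2); apply: eq_bigr => j _.
  have := ball_indicatorE uA r0 hK cx (cb j); rewrite /b !(mulKVmx uA) => ->.
  by rewrite natr_sum.
rewrite (torus_integralE uA mf fM); apply: eq_Rintegral => x _.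
by rewrite /f mulKmx.
Qed.

(** The discrepancy jumps only on finitely many ellipsoids, the spheres seen in lattice coordinates.
    They form the null set Z, off which it is locally constant, as [integral_sqr_le] requires. *)
Lemma number_variance_le N (Y : 'I_N -> 'cV[R]_d.+1) (V : R) :
  (forall j, fundamental_domain A (Y j)) ->
  (forall F : seq 'cV[int]_d.+1, uniq F -> \sum_(m <- F | m != 0)
     ((covolume A)^-1 * ball_cos A r m) ^+ 2 * spectral (fun j => invmx A *m Y j) m <= V) ->
  number_variance A Y r <= V.
Proof.
move=> hY hV; rewrite number_varianceE//.
pose b j := invmx A *m Y j; rewrite -/b.
have cb j : cube d.+1 (b j) by have := hY j; rewrite fundamental_domainE.
pose c j (k : 'cV[int]_d.+1) := b j + map_mx intr k.
pose S j k := [set a | dotv (A *m (c j k - a)) (A *m (c j k - a)) = r ^+ 2].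
pose Z := \big[setU/set0]_(j < N) \big[setU/set0]_(k <- sym_box d.+1 K) S j k.
have [mZ Z0] : measurable Z /\ lebesgue_cV Z = 0%E.
  rewrite /Z; apply: (big_ind (fun Z => measurable Z /\ lebesgue_cV Z = 0%E)).
  - by rewrite measure0.
  - by move=> S1 S2 [m1 z1] [m2 z2]; split; [exact: measurableU|exact: null_set_setU].
  - move=> j _; apply: (big_ind (fun Z => measurable Z /\ lebesgue_cV Z = 0%E)).
    + by rewrite measure0.
    + by move=> S1 S2 [m1 z1] [m2 z2]; split; [exact: measurableU|exact: null_set_setU].
    + by move=> k _; exact: lebesgue_in_ball_boundary.
have md : measurable_fun setT (discrepancy A r K b) by exact: measurable_discrepancy.
apply: (integral_sqr_le md
  (norm_discrepancy_le A r K b) mZ Z0) => [a nZ e e0|F uF]; last first.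
  rewrite (eq_bigr _ (fun m _ => discrepancy_fourier uA r0 hK cb m)).
  apply: le_trans (hV F uF); rewrite [leRHS]big_mkcond/=; apply: ler_sum => m _.
  by case: eqP.
have nr : \forall x \near a, discrepancy A r K b x = discrepancy A r K b a.
  near=> x; rewrite /discrepancy; congr (_ - _); near: x.
  apply: near_sum => j _; apply: near_sum => k kK.
  have : dotv (A *m (c j k - a)) (A *m (c j k - a)) != r ^+ 2.
    apply/eqP => h; apply: nZ; rewrite /Z -bigcup_seq; exists j => /=.
      by rewrite mem_index_enum.
    by rewrite -bigcup_seq; exists k.
  by move=> /in_ball_near; apply: filterS => x ->.
(* Balls of matrices are taken in the sup norm, which is the coordinatewise closeness asked for. *)
have /nbhs_ballP[de /= de0 hde] := nr.
exists de => // x hx; rewrite (hde x) ?subrr ?normr0 ?(ltW e0)//.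
split => // i j; rewrite (ord1 j); exact: hx.
Unshelve. all: by end_near.
Qed.

End variance_bound.

(** In dimension d + 1 the ball contributes r^d |w|^(-d-2). The radius enters elsewhere only through
    the truncation [K], which does not occur in [number_variance_le], so the constant is uniform in
    r. *)
Lemma qmc_variance_le (R : realType) d (A : 'M[R]_d.+1) (alpha : R)
    (X : forall N, 'I_N -> 'cV[R]_d.+1) :
  A \in unitmx -> (d.+1%:R + 1) / 2 < alpha -> point_sets A X -> qmc_design A alpha X ->
  exists2 C : R, 0 < C & forall N (r : R), (0 < N)%N -> 0 < r ->
    number_variance A (X N) r <= C * r ^+ d * (N%:R `^ d.+1%:R^-1) ^+ d.
Proof.
move=> uA ha hX qX.
have [Cs Cs0 hCs] := qmc_spectral_decay uA (ltn0Sn d) ha qX.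
have [Cn Cn0 hCn] := max_norm_le_dual uA.
have [Cb Cb0 hCb] := cos_ball_decay R d.
have [Ci Ci0 hCi] := mulmx_coord_le (invmx A).
pose k : R := (covolume A)^-1 ^+ 2 * (Cb * Cn ^+ d.+2).
have k0 : 0 <= k.
  exact: mulr_ge0 (sqr_ge0 _) (mulr_ge0 (ltW Cb0) (exprn_ge0 _ (ltW Cn0))).
exists (k * Cs + 1); first by rewrite ltr_wpDl// mulr_ge0.
move=> N r N0 r0.
have hK (x : 'cV[R]_d.+1) : cball r (A *m x) -> forall i,
    `|x i ord0| + 1 <= (Num.bound (Ci * r + 1))%:R.
  move=> cx i; have Ax j : `|(A *m x) j ord0| <= r.
    by rewrite (le_trans (coord_le_enorm _ _))// enorm_le// ltW.
  have := hCi _ _ Ax i; rewrite mulKmx// => h.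
  apply: (@le_trans _ _ (Ci * r + 1)); first by rewrite lerD2r.
  by apply/ltW/archi_boundP; rewrite addr_ge0// mulr_ge0 ?ltW.
have [_ hY] := hX N.
set M := N%:R `^ _; have M0 : 0 <= M by exact: powR_ge0.
apply: (number_variance_le uA (ltW r0) hK hY) => F uF.
apply: (@le_trans _ _ (k * r ^+ d * (Cs * M ^+ d))); last first.
  rewrite (_ : k * r ^+ d * (Cs * M ^+ d) = k * Cs * r ^+ d * M ^+ d); last by ring.
  by rewrite ler_wpM2r ?exprn_ge0// ler_wpM2r ?exprn_ge0 ?(ltW r0)// lerDl.
apply: le_trans (ler_wpM2l _ (hCs N N0 F uF)); last first.
  by rewrite mulr_ge0// exprn_ge0// ltW.
rewrite mulr_sumr; apply: ler_sum => m m0.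
have n0 : 0 < (max_norm m)%:R :> R by rewrite ltr0n max_norm_gt0.
have nw := hCn m.
have w0 : 0 < enorm (dual_vector A m).
  by rewrite -(pmulr_rgt0 _ Cn0); exact: lt_le_trans n0 nw.
have wn0 : dual_vector A m != 0.
  apply/eqP => e; move: w0; rewrite e /enorm dotv0l sqrtr0 ltxx//.
have key : ball_cos A r m ^+ 2 <= Cb * r ^+ d * (Cn ^+ d.+2 / (max_norm m)%:R ^+ d.+2).
  apply: (le_trans (hCb _ r wn0 r0)); rewrite ler_wpM2l//.
    exact: mulr_ge0 (ltW Cb0) (exprn_ge0 _ (ltW r0)).
  rewrite ler_pdivlMr ?exprn_gt0// ler_pdivrMl ?exprn_gt0// mulrC -exprMn.
  rewrite lerXn2r ?nnegrE ?(ltW n0)//.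
  by rewrite mulr_ge0 ?enorm_ge0 ?(ltW Cn0).
rewrite (_ : k * r ^+ d * (_ / _) = (covolume A)^-1 ^+ 2 *
  spectral (fun j => invmx A *m X N j) m * (Cb * r ^+ d * (Cn ^+ d.+2 / (max_norm m)%:R ^+ d.+2))).
  by rewrite exprMn mulrAC ler_wpM2l// mulr_ge0 ?sqr_ge0// spectral_ge0.
by rewrite /k; move: (_ ^-1) (_^-1) => x y; ring.
Qed.

Lemma number_variance_ge0 (R : realType) d (A : 'M[R]_d) N (Y : 'I_N -> 'cV[R]_d) r :
  0 <= number_variance A Y r.
Proof. by apply: Rintegral_ge0 => x _; exact: sqr_ge0. Qed.

(** V / E is at most C / (c x), and x tends to infinity with E. *)
Lemma littleo_power_gap (R : realType) n (c C : R) (V E x : R^nat) :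
  0 < c -> 0 < C -> (forall N, 0 <= x N) -> (forall N, E N = c * x N ^+ n.+1) ->
  (forall N, 0 <= V N) -> (forall N, (0 < N)%N -> V N <= C * x N ^+ n) ->
  E N @[N --> \oo] --> +oo -> V =o_\oo E.
Proof.
move=> c0 C0 x0 hE V0 hV /cvgryPge cE; apply/eqoP => e e0.
pose K : R := C / (e * c); have ec : 0 < e * c by exact: mulr_gt0.
have K0 : 0 <= K by rewrite divr_ge0// ltW.
have big := cE (c * K ^+ n.+1).
near=> N; have N0 : (0 < N)%N by near: N; exact: nbhs_infty_gt.
have E0 : 0 <= E N by rewrite hE mulr_ge0 ?exprn_ge0 ?(ltW c0).
rewrite !ger0_norm ?V0// hE (le_trans (hV N N0))//.
have : K <= x N.
  rewrite -(@ler_pXn2r _ n.+1)// ?nnegrE// -(ler_pM2l c0) -hE.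
  by near: N; exact: big.
rewrite /K ler_pdivrMr// => h; rewrite exprS.
rewrite (_ : e * _ = x N * (e * c) * x N ^+ n); last by ring.
by rewrite ler_wpM2r ?exprn_ge0.
Unshelve. all: by end_near. Qed.

Lemma powR_inv_natK (R : realType) n N : (N%:R `^ n.+1%:R^-1) ^+ n.+1 = N%:R :> R.
Proof.
by rewrite -powR_mulrn ?powR_ge0// -powRrM mulVf ?powRr1// pnatr_eq0.
Qed.

Theorem theorem4p1 (R : realType) (d : nat) (d_gt0 : (0 < d)%N)
    (A : 'M[R]_d) (A_unit : A \in unitmx)
    (alpha : R) (alpha_gt : (d%:R + 1) / 2 < alpha)
    (X : forall N : nat, 'I_N -> 'cV[R]_d) (X_points : point_sets A X)
    (X_qmc : qmc_design A alpha X) :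
  [/\ hyperuniform_large A X,
      hyperuniform_small A X &
      hyperuniform_threshold A X].
Proof.
case: d d_gt0 A A_unit alpha_gt X X_points X_qmc => [//|d] _ A uA ha X hX qX.
have [C C0 hC] := qmc_variance_le uA ha hX qX.
pose s N : R := N%:R `^ d.+1%:R^-1.
have s0 N : 0 <= s N by exact: powR_ge0.
have sK N : s N ^+ d.+1 = N%:R by exact: powR_inv_natK.
split.
(* With x = r N^(1/(d+1)) the variance bound is C x^d, and N is r^(-d-1) x^(d+1). *)
- move=> r r0 _; apply: (@littleo_power_gap _ d (r ^- d.+1) C _ _ (fun N => r * s N)) => //.
  + by rewrite invr_gt0 exprn_gt0.
  + by move=> N; rewrite mulr_ge0// ltW.
  + by move=> N; rewrite exprMn sK mulKf// expf_neq0// gt_eqF.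
  + by move=> N; exact: number_variance_ge0.
  + by move=> N N0; rewrite exprMn mulrA; exact: hC.
  + exact: cvgr_idn.
- move=> r r0 _ cr.
  (* The same x with varying radius: the expected number of points in a ball is a constant times
     x^(d+1). *)
  apply: (@littleo_power_gap _ d ((covolume A)^-1 * unit_ball_volume d.+1) C _ _ (fun N => r N * s N)) => //.
  + rewrite mulr_gt0 ?unit_ball_volume_gt0// invr_gt0 normr_gt0 -unitfE.
    by rewrite -unitmxE.
  + by move=> N; rewrite mulr_ge0// ltW.
  + by move=> N; rewrite exprMn sK ball_volE mulrC -!mulrA.
  + by move=> N; exact: number_variance_ge0.
  + by move=> N N0; rewrite exprMn mulrA; exact: hC.
exists C; near=> t; have t0 : 0 < t by near: t; exact: nbhs_pinfty_gt.
(* The limsup is at most the supremum over N > 0, and at radius t / s N the bound C (r s)^d is C t^d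
   for every such N. *)
apply: (@le_trans _ _ (ereal_sup [set
    (number_variance A (X N) (t * N%:R `^ (- d.+1%:R^-1)))%:E | N in [set N | (0 < N)%N]])).
  apply: ereal_inf_lbound; exists [set N | (0 < N)%N] => //.
  exact: nbhs_infty_gt.
apply: ge_ereal_sup => _ [N N0 <-]; rewrite lee_fin.
have sp : 0 < s N by rewrite powR_gt0// ltr0n.
have -> : N%:R `^ (- d.+1%:R^-1) = (s N)^-1 by rewrite powRN.
apply: (le_trans (hC _ _ N0 (divr_gt0 t0 sp))).
by rewrite -mulrA -exprMn divfK// gt_eqF.
Unshelve. all: by end_near. Qed.
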